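(* Let $\mathcal A=\mathcal O(\mathrm{SL}_q(2))$, $(\Gamma,d)$ one of the $4D_\pm$-calculi, and $\mathcal S_0\subset\mathrm{Cl}(\Gamma,\sigma,g)$ the spinor module with left $\mathcal A$-basis $\psi_1^\pm,\psi_2^\pm$ of left-invariant elements. (i) The right coaction $\Delta_R'$ of $\tilde{\mathcal A}$ on the vector space $(\mathcal S_0)_L=\mathrm{Lin}\{\psi^\pm_i\}$, $\Delta_R'(\psi^\pm_i)=\psi^\pm_j\otimes u^j_i\chi$, can be extended to a right coaction $\Delta_R:\mathcal S_0\to\mathcal S_0\otimes\tilde{\mathcal A}$ on the left-covariant $\mathcal A$-bimodule $\mathcal S_0$. That is, $\mathcal S_0$, with right multiplication as right action of $\mathcal A$ and with $\Delta_R$ as right coaction of $\tilde{\mathcal A}$, becomes a Doi–Hopf module in the category $\mathbf M(\mathcal A)^{\tilde{\mathcal A}}_{\mathcal A}$: $\Delta_R(\psi a)=\Delta_R(\psi)\varDelta(a)$ for $\psi\in\mathcal S_0$, $a\in\mathcal A$. (ii) The right coaction $\Delta_R$ on $\mathcal S_0$ is compatible with the left multiplication of $\mathrm{Cl}(\Gamma,\sigma,g)$ on $\mathcal S_0$, i.e. $\Delta_R(u\psi)=\Delta_R(u)\Delta_R(\psi)$ for all $u\in\mathrm{Cl}(\Gamma,\sigma,g)$ and $\psi\in\mathcal S_0$.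
   Context: Repeated indices are summed. $q\in\mathbb C\setminus\{0\}$ is not a root of unity, and $q\in\mathbb R$ or $|q|=1$; $q^{1/2}$ is a fixed square root; $\hat q=q-q^{-1}$, $[2]=q+q^{-1}$. Indices run over $1,2$. Put $\check C^{ij}=q^{-1/2}\delta^i_1\delta^j_2-q^{1/2}\delta^i_2\delta^j_1$, $\hat C_{ij}=-\check C^{ij}$, $\hat R^{ij}_{kl}=q^{1/2}\delta^i_k\delta^j_l+q^{-1/2}\check C^{ij}\hat C_{kl}$, with inverse $\hat R^{-1}$. Subscripts $\hat R_{12},\dots$ denote tensor legs. $\mathcal A=\mathcal O(\mathrm{SL}_q(2))$ is the Hopf algebra generated by $u^i_j$ with relations $\hat R^{ij}_{kl}u^k_mu^l_n=u^i_ku^j_l\hat R^{kl}_{mn}$, $u^1_1u^2_2-qu^1_2u^2_1=1$, $\varDelta(u^i_j)=u^i_k\otimes u^k_j$, $\varepsilon(u^i_j)=\delta^i_j$, $S(u^i_j)=\check C^{ik}\hat C_{lj}u^l_k$. The $4D_\pm$-calculus: $\Gamma$ is the free left $\mathcal A$-module with left-invariant basis $\theta_{ij}$, right multiplication $\theta_{ij}u^k_l=\nu_0\hat R^{mr}_{it}\hat R^{-1}{}^{ts}_{jl}u^k_m\theta_{rs}$ ($\nu_0=\pm1$ for $4D_\pm$), $da=\theta a-a\theta$, $\theta=\frac{q^{1/2}}{\hat q}\check C^{ij}\theta_{ij}$. It is bicovariant, with right coaction $\Delta_R(\theta_{ij})=\theta_{kl}\otimes u^k_iu^l_j$. The braiding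 is left $\mathcal A$-linear with $\sigma(\theta_{mn}\otimes\theta_{rs})=(\hat R_{23}\hat R_{12}\hat R^{-1}_{34}\hat R^{-1}_{23})^{ijkl}_{mnrs}\theta_{ij}\otimes\theta_{kl}$; the $\sigma$-metric $g:\Gamma\otimes_{\mathcal A}\Gamma\to\mathcal A$ is left $\mathcal A$-linear with $g(\theta_{ij}\otimes\theta_{kl})=-q^{1/2}c_1\hat C_{im}\hat C_{nl}\hat R^{-1}{}^{mn}_{jk}$, $c_1\in\mathbb R\setminus\{0\}$. $\mathrm{Cl}(\Gamma,\sigma,g)=\Gamma^\otimes/\mathcal I$, with $\Gamma^\otimes$ the tensor algebra over $\mathcal A$ and $\mathcal I$ the two-sided ideal generated by $\rho_2-g(\rho_2)$, $\sigma(\rho_2)=\rho_2$. The right coaction $\Delta_R$ of $\mathcal A$ on $\mathrm{Cl}(\Gamma,\sigma,g)$ is the algebra homomorphism induced by $\varDelta$ on $\mathcal A$ and $\Delta_R$ on $\Gamma$. $\mathcal S_0$ is the left ideal of $\mathrm{Cl}(\Gamma,\sigma,g)$ generated by $\psi^+_1=\frac{q}{[2]c_1}\theta_{11}\theta_{12}\theta_{21}\theta_{22}$, $\psi^+_2=\theta_{21}\theta_{22}$, $\psi^-_1=\theta_{11}\theta_{21}\theta_{22}$, $\psi^-_2=q\theta_{12}\theta_{21}\theta_{22}$; these four left-invariant elements form a basis of $\mathcal S_0$ as a left $\mathcal A$-module, and $\mathcal S_0$ is invariant under right multiplication by $\mathcal A$. $\tilde{\mathcal A}=\mathcal A\rtimes\mathbb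 C[\chi,\chi^{-1}]$ is the crossed product algebra with $(a\chi^k)(b\chi^l)=a(\chi^k\triangleright b)\chi^{k+l}$, where $\chi\triangleright$ is the algebra automorphism of $\mathcal A$ with $\chi\triangleright u^i_j=q^{j-i}u^i_j$; it is a Hopf algebra with $\varDelta(\chi)=\chi\otimes\chi$, $S(\chi)=\chi^{-1}$, containing $\mathcal A$ as a Hopf subalgebra. *)

(* Defs.v *)
From HB Require Import structures.
From mathcomp Require Import all_boot all_order all_algebra.
From mathcomp Require Import boolp ring.

Set Implicit Arguments.
Unset Strict Implicit.
Unset Printing Implicit Defensive.

Import GRing.Theory.
Local Open Scope ring_scope.
Local Open Scope quotient_scope.

(* Associative unital K-algebras.  Unlike in [algType], 1 = 0 is allowed, so    *)
(* that the quotient by an arbitrary two-sided ideal is again one.              *)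
Record algebra (K : comNzRingType) := Algebra {
  alg_lmod : lmodType K;
  alg_mul : alg_lmod -> alg_lmod -> alg_lmod;
  alg_one : alg_lmod;
  alg_mulA : associative alg_mul;
  alg_mul1l : left_id alg_one alg_mul;
  alg_mul1r : right_id alg_one alg_mul;
  alg_mulDl : left_distributive alg_mul +%R;
  alg_mulDr : right_distributive alg_mul +%R;
  alg_scaleAl : forall k x y, k *: alg_mul x y = alg_mul (k *: x) y;
  alg_scaleAr : forall k x y, k *: alg_mul x y = alg_mul x (k *: y)
}.

Definition alg_sort (K : comNzRingType) (A : algebra K) : Type := alg_lmod A.
Coercion alg_sort : algebra >-> Sortclass.

HB.instance Definition _ (K : comNzRingType) (A : algebra K) :=
  GRing.Lmodule.copy (alg_sort A) (alg_lmod A).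
HB.instance Definition _ (K : comNzRingType) (A : algebra K) :=
  GRing.Zmodule_isPzRing.Build (alg_sort A) (@alg_mulA K A)
    (@alg_mul1l K A) (@alg_mul1r K A) (@alg_mulDl K A) (@alg_mulDr K A).

Section AlgebraTheory.
Variables (K : comNzRingType) (A : algebra K).

Lemma ascalerAl (k : K) (x y : A) : k *: (x * y) = (k *: x) * y.
Proof. exact: alg_scaleAl. Qed.
Lemma ascalerAr (k : K) (x y : A) : k *: (x * y) = x * (k *: y).
Proof. exact: alg_scaleAr. Qed.

End AlgebraTheory.

Definition base_alg (K : comNzRingType) : algebra K :=
  @Algebra K K^o *%R 1 (@mulrA K) (@mul1r K) (@mulr1 K) (@mulrDl K) (@mulrDr K)
    (@mulrA K) (@mulrCA K).

Definition alg_hom (K : comNzRingType) (A B : algebra K) (f : A -> B) :=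
  [/\ forall k x y, f (k *: x + y) = k *: f x + f y,
      f 1 = 1 & forall x y, f (x * y) = f x * f y].

Section FreeAlgebra.
Variables (K : comNzRingType) (B : algebra K) (X : Type).

Inductive fterm : Type :=
  | FCst of B | FGen of X | FAdd of fterm & fterm | FMul of fterm & fterm.

Inductive fcong : fterm -> fterm -> Prop :=
  | fcong_refl s : fcong s s
  | fcong_sym s t : fcong s t -> fcong t s
  | fcong_trans s t r : fcong s t -> fcong t r -> fcong s r
  | fcong_add s s' t t' :
      fcong s s' -> fcong t t' -> fcong (FAdd s t) (FAdd s' t')
  | fcong_mul s s' t t' :
      fcong s s' -> fcong t t' -> fcong (FMul s t) (FMul s' t')
  | fcong_addA s t r : fcong (FAdd s (FAdd t r)) (FAdd (FAdd s t) r)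
  | fcong_addC s t : fcong (FAdd s t) (FAdd t s)
  | fcong_add0 s : fcong (FAdd (FCst 0) s) s
  | fcong_addN s : fcong (FAdd (FMul (FCst (-1)) s) s) (FCst 0)
  | fcong_mulA s t r : fcong (FMul s (FMul t r)) (FMul (FMul s t) r)
  | fcong_mul1 s : fcong (FMul (FCst 1) s) s
  | fcong_1mul s : fcong (FMul s (FCst 1)) s
  | fcong_mulDl s t r : fcong (FMul (FAdd s t) r) (FAdd (FMul s r) (FMul t r))
  | fcong_mulDr s t r : fcong (FMul s (FAdd t r)) (FAdd (FMul s t) (FMul s r))
  | fcong_cstD a b : fcong (FCst (a + b)) (FAdd (FCst a) (FCst b))
  | fcong_cstM a b : fcong (FCst (a * b)) (FMul (FCst a) (FCst b))
  | fcong_scal (k : K) s :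
      fcong (FMul (FCst (k *: (1 : B))) s) (FMul s (FCst (k *: (1 : B)))).

HB.instance Definition _ := gen_eqMixin fterm.
HB.instance Definition _ := gen_choiceMixin fterm.

Definition fcongb (s t : fterm) : bool := `[< fcong s t >].

Fact fcongb_equiv : equiv_class_of fcongb.
Proof.
split=> [s | s t | t s r].
- by apply/asboolP; exact: fcong_refl.
- by apply/asboolP/asboolP; exact: fcong_sym.
- by move=> /asboolP st /asboolP tr; apply/asboolP; exact: fcong_trans st tr.
Qed.
Canonical fcongb_equivRel := EquivRelPack fcongb_equiv.

Definition fquot : Type := {eq_quot fcongb}.
HB.instance Definition _ := Choice.on fquot.
HB.instance Definition _ := Quotient.on fquot.

Lemma fquotP s t : fcong s t <-> \pi_fquot s = \pi_fquot t.
Proof.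
by split=> [st | /eqmodP/asboolP //]; apply/eqmodP/asboolP.
Qed.

Definition fq_cst (b : B) : fquot := \pi_fquot (FCst b).
Definition fq_add : fquot -> fquot -> fquot :=
  locked (fun x y => \pi_fquot (FAdd (repr x) (repr y))).
Definition fq_mul : fquot -> fquot -> fquot :=
  locked (fun x y => \pi_fquot (FMul (repr x) (repr y))).
Definition fq_opp (x : fquot) : fquot := fq_mul (fq_cst (-1)) x.
Definition fq_scale (k : K) (x : fquot) : fquot := fq_mul (fq_cst (k *: (1 : B))) x.

Let repr_pi s : fcong (repr (\pi_fquot s)) s.
Proof. by apply/fquotP; rewrite reprK. Qed.
Lemma fq_pi_add s t : fq_add (\pi_fquot s) (\pi_fquot t) = \pi_fquot (FAdd s t).
Proof. by rewrite /fq_add -lock; apply/fquotP/fcong_add; exact: repr_pi. Qed.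
Lemma fq_pi_mul s t : fq_mul (\pi_fquot s) (\pi_fquot t) = \pi_fquot (FMul s t).
Proof. by rewrite /fq_mul -lock; apply/fquotP/fcong_mul; exact: repr_pi. Qed.

Let faddA : associative fq_add.
Proof.
by do 3![elim/quotW=> ?]; rewrite !fq_pi_add; apply/fquotP/fcong_addA.
Qed.
Let faddC : commutative fq_add.
Proof.
by do 2![elim/quotW=> ?]; rewrite !fq_pi_add; apply/fquotP/fcong_addC.
Qed.
Let fadd0 : left_id (fq_cst 0) fq_add.
Proof. by elim/quotW=> ?; rewrite !fq_pi_add; apply/fquotP/fcong_add0. Qed.
Let faddN : left_inverse (fq_cst 0) fq_opp fq_add.
Proof.
by elim/quotW=> ?; rewrite /fq_opp fq_pi_mul fq_pi_add; apply/fquotP/fcong_addN.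
Qed.
HB.instance Definition _ :=
  GRing.isZmodule.Build fquot faddA faddC fadd0 faddN.

Let fmulA : associative fq_mul.
Proof.
by do 3![elim/quotW=> ?]; rewrite !fq_pi_mul; apply/fquotP/fcong_mulA.
Qed.
Let fmul1 : left_id (fq_cst 1) fq_mul.
Proof. by elim/quotW=> ?; rewrite !fq_pi_mul; apply/fquotP/fcong_mul1. Qed.
Let f1mul : right_id (fq_cst 1) fq_mul.
Proof. by elim/quotW=> ?; rewrite !fq_pi_mul; apply/fquotP/fcong_1mul. Qed.
Let fmulDl : left_distributive fq_mul fq_add.
Proof.
do 3![elim/quotW=> ?]; rewrite !(fq_pi_mul, fq_pi_add).
by apply/fquotP/fcong_mulDl.
Qed.
Let fmulDr : right_distributive fq_mul fq_add.
Proof.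
do 3![elim/quotW=> ?]; rewrite !(fq_pi_mul, fq_pi_add).
by apply/fquotP/fcong_mulDr.
Qed.
HB.instance Definition _ :=
  GRing.Zmodule_isPzRing.Build fquot fmulA fmul1 f1mul fmulDl fmulDr.

Let fcstD a b : fq_cst (a + b) = fq_cst a + fq_cst b.
Proof. by rewrite [RHS]fq_pi_add; apply/fquotP/fcong_cstD. Qed.
Let fcstM a b : fq_cst (a * b) = fq_cst a * fq_cst b.
Proof. by rewrite [RHS]fq_pi_mul; apply/fquotP/fcong_cstM. Qed.
Let fcentral (k : K) (x : fquot) :
  fq_cst (k *: (1 : B)) * x = x * fq_cst (k *: (1 : B)).
Proof.
by elim/quotW: x => ?; rewrite /fq_cst [LHS]fq_pi_mul [RHS]fq_pi_mul;
   apply/fquotP/fcong_scal.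
Qed.

Let fscaleA (a b : K) x : fq_scale a (fq_scale b x) = fq_scale (a * b) x.
Proof.
rewrite [LHS]mulrA -fcstM; congr (fq_cst _ * _).
by rewrite -ascalerAl mul1r scalerA.
Qed.
Let fscale1 x : fq_scale 1 x = x.
Proof. by rewrite /fq_scale scale1r; exact: fmul1. Qed.
Let fscaleDr : right_distributive fq_scale +%R.
Proof. by move=> k x y; exact: mulrDr. Qed.
Let fscaleDl x : {morph fq_scale^~ x : a b / a + b}.
Proof. by move=> a b; rewrite /fq_scale scalerDl fcstD; exact: mulrDl. Qed.
HB.instance Definition _ := GRing.Zmodule_isLmodule.Build K fquot
  fscaleA fscale1 fscaleDr fscaleDl.

Let fscalerAl (k : K) (x y : fquot) : k *: (x * y) = (k *: x) * y.
Proof. exact: mulrA. Qed.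
Let fscalerAr (k : K) (x y : fquot) : k *: (x * y) = x * (k *: y).
Proof.
by rewrite [LHS]mulrA fcentral -mulrA.
Qed.

(* The K-algebra freely generated by the algebra B and the elements of X;       *)
(* for B = K it is the free algebra K<X>.                                       *)
Definition freeAlg : algebra K :=
  @Algebra K fquot *%R 1 (@mulrA fquot) (@mul1r fquot) (@mulr1 fquot)
    (@mulrDl fquot) (@mulrDr fquot) fscalerAl fscalerAr.
Definition falg_cst (b : B) : freeAlg := \pi_fquot (FCst b).
Definition falg_gen (x : X) : freeAlg := \pi_fquot (FGen x).

End FreeAlgebra.

Section AlgHomTheory.
Variables (K : comNzRingType) (A B C : algebra K) (f : A -> B).
Hypothesis f_hom : alg_hom f.

Lemma alg_hom0 : f 0 = 0.
Proof.
by case: f_hom => lin _ _; have := lin (-1) 0 0;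
   rewrite scaler0 addr0 scaleN1r addNr.
Qed.
Lemma alg_homD x y : f (x + y) = f x + f y.
Proof. by case: f_hom => lin _ _; have := lin 1 x y; rewrite !scale1r. Qed.
Lemma alg_homZ k x : f (k *: x) = k *: f x.
Proof.
by case: f_hom => lin _ _; have := lin k x 0; rewrite alg_hom0 !addr0.
Qed.
Lemma alg_homN x : f (- x) = - f x.
Proof. by rewrite -scaleN1r alg_homZ scaleN1r. Qed.
Lemma alg_homB x y : f (x - y) = f x - f y.
Proof. by rewrite alg_homD alg_homN. Qed.
Lemma alg_hom1 : f 1 = 1. Proof. by case: f_hom. Qed.
Lemma alg_homM x y : f (x * y) = f x * f y. Proof. by case: f_hom. Qed.
Lemma alg_hom_sum I (r : seq I) (P : pred I) F :
  f (\sum_(i <- r | P i) F i) = \sum_(i <- r | P i) f (F i).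
Proof. by rewrite (big_morph f alg_homD alg_hom0). Qed.

Lemma alg_hom_comp (h : B -> C) : alg_hom h -> alg_hom (h \o f).
Proof.
case: f_hom => lf f1 fM [lh h1 hM]; split=> [k x y | | x y] /=.
- by rewrite lf lh.
- by rewrite f1 h1.
- by rewrite fM hM.
Qed.

End AlgHomTheory.

Lemma base_alg_hom (K : comNzRingType) (A : algebra K) :
  alg_hom (fun k : base_alg K => (k : K) *: (1 : A)).
Proof.
split=> [k x y | | x y] /=.
- by rewrite scalerDl; congr (_ + _); rewrite scalerA.
- exact: scale1r.
- by rewrite -ascalerAl mul1r scalerA.
Qed.

Section FreeAlgebraLift.
Variables (K : comNzRingType) (B : algebra K) (X : Type) (Z : algebra K).
Variables (f : B -> Z) (g : X -> Z).

Fixpoint feval (t : fterm B X) : Z :=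
  match t with
  | FCst b => f b
  | FGen x => g x
  | FAdd s t => feval s + feval t
  | FMul s t => feval s * feval t
  end.

Definition falg_lift (x : freeAlg B X) : Z := feval (repr (x : fquot B X)).

Hypothesis f_hom : alg_hom f.

Lemma fevalP s t : fcong s t -> feval s = feval t.
Proof.
elim=> {s t} //=.
- by move=> s t r _ -> _ ->.
- by move=> s s' t t' _ -> _ ->.
- by move=> s s' t t' _ -> _ ->.
- by move=> s t r; rewrite addrA.
- by move=> s t; rewrite addrC.
- by move=> s; rewrite (alg_hom0 f_hom) add0r.
- move=> s.
  by rewrite (alg_homN f_hom) (alg_hom1 f_hom) (alg_hom0 f_hom) mulN1r addNr.
- by move=> s t r; rewrite mulrA.
- by move=> s; rewrite (alg_hom1 f_hom) mul1r.
- by move=> s; rewrite (alg_hom1 f_hom) mulr1.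
- by move=> s t r; rewrite mulrDl.
- by move=> s t r; rewrite mulrDr.
- by move=> a b; rewrite (alg_homD f_hom).
- by move=> a b; rewrite (alg_homM f_hom).
- move=> k s; rewrite (alg_homZ f_hom) (alg_hom1 f_hom).
  by rewrite -ascalerAl -ascalerAr mul1r mulr1.
Qed.

Let lift_pi s : falg_lift (\pi_(fquot B X) s) = feval s.
Proof. by apply: fevalP; apply/fquotP; rewrite reprK. Qed.

Lemma falg_lift_cst b : falg_lift (falg_cst X b) = f b.
Proof. exact: lift_pi. Qed.
Lemma falg_lift_gen x : falg_lift (falg_gen B x) = g x.
Proof. exact: lift_pi. Qed.

Lemma falg_lift_hom : alg_hom falg_lift.
Proof.
have lM (x y : freeAlg B X) : falg_lift (x * y) = falg_lift x * falg_lift y.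
  rewrite -[x in LHS](reprK (x : fquot B X)) -[y in LHS](reprK (y : fquot B X)).
  have -> : ((\pi_(fquot B X) (repr (x : fquot B X)) : freeAlg B X) *
             (\pi_(fquot B X) (repr (y : fquot B X)) : freeAlg B X)) =
    \pi_(fquot B X) (FMul (repr (x : fquot B X)) (repr (y : fquot B X))).
    exact: fq_pi_mul.
  exact: lift_pi.
have lD (x y : freeAlg B X) : falg_lift (x + y) = falg_lift x + falg_lift y.
  rewrite -[x in LHS](reprK (x : fquot B X)) -[y in LHS](reprK (y : fquot B X)).
  have -> : ((\pi_(fquot B X) (repr (x : fquot B X)) : freeAlg B X) +
             (\pi_(fquot B X) (repr (y : fquot B X)) : freeAlg B X)) =
    \pi_(fquot B X) (FAdd (repr (x : fquot B X)) (repr (y : fquot B X))).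
    exact: fq_pi_add.
  exact: lift_pi.
split=> // [k x y|]; last by rewrite [LHS]lift_pi /= (alg_hom1 f_hom).
rewrite lD; congr (_ + _).
have -> : k *: x = falg_cst X (k *: (1 : B)) * x by [].
by rewrite lM falg_lift_cst (alg_homZ f_hom) (alg_hom1 f_hom) -ascalerAl mul1r.
Qed.

End FreeAlgebraLift.

Lemma falg_cst_hom (K : comNzRingType) (B : algebra K) (X : Type) :
  alg_hom (@falg_cst K B X).
Proof.
have cM (a b : B) : falg_cst X (a * b) = falg_cst X a * falg_cst X b.
  have -> : falg_cst X a * falg_cst X b =
    \pi_(fquot B X) (FMul (FCst X a) (FCst X b)) by exact: fq_pi_mul.
  by apply/fquotP; exact: fcong_cstM.
split=> // k a b.
have -> : k *: falg_cst X a = falg_cst X (k *: (1 : B)) * falg_cst X a by [].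
rewrite -cM -ascalerAl mul1r.
have -> : falg_cst X (k *: a) + falg_cst X b =
  \pi_(fquot B X) (FAdd (FCst X (k *: a)) (FCst X b)) by exact: fq_pi_add.
by apply/fquotP; exact: fcong_cstD.
Qed.

Section Quotient.
Variables (K : comNzRingType) (A : algebra K) (S : A -> Prop).

Inductive ideal : A -> Prop :=
  | ideal_gen x of S x : ideal x
  | ideal_zero : ideal 0
  | ideal_add x y of ideal x & ideal y : ideal (x + y)
  | ideal_mull a x of ideal x : ideal (a * x)
  | ideal_mulr a x of ideal x : ideal (x * a).

Lemma ideal_opp x : ideal x -> ideal (- x).
Proof. by move=> Ix; rewrite -mulN1r; exact: ideal_mull. Qed.

Definition idealb (x y : A) : bool := `[< ideal (x - y) >].
Fact idealb_equiv : equiv_class_of idealb.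
Proof.
split=> [x | x y | y x z].
- by apply/asboolP; rewrite subrr; exact: ideal_zero.
- by apply/asboolP/asboolP => /ideal_opp; rewrite opprB.
- move=> /asboolP xy /asboolP yz; apply/asboolP.
  by rewrite -[x](subrK y) -addrA; exact: ideal_add.
Qed.
Canonical idealb_equivRel := EquivRelPack idealb_equiv.

Definition qquot : Type := {eq_quot idealb}.
HB.instance Definition _ := Choice.on qquot.
HB.instance Definition _ := Quotient.on qquot.

Lemma qquotP x y : ideal (x - y) <-> \pi_qquot x = \pi_qquot y.
Proof. by split=> [st | /eqmodP/asboolP //]; apply/eqmodP/asboolP. Qed.

Definition qq_add : qquot -> qquot -> qquot :=
  locked (fun x y => \pi_qquot (repr x + repr y)).
Definition qq_mul : qquot -> qquot -> qquot :=
  locked (fun x y => \pi_qquot (repr x * repr y)).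
Definition qq_opp : qquot -> qquot := locked (fun x => \pi_qquot (- repr x)).
Definition qq_scale : K -> qquot -> qquot :=
  locked (fun k x => \pi_qquot (k *: repr x)).

Let repr_pi x : ideal (repr (\pi_qquot x) - x).
Proof. by apply/qquotP; rewrite reprK. Qed.

Let pi_add x y : qq_add (\pi_qquot x) (\pi_qquot y) = \pi_qquot (x + y).
Proof.
rewrite /qq_add -lock; apply/qquotP.
by rewrite opprD addrACA; apply: ideal_add; exact: repr_pi.
Qed.
Let pi_mul x y : qq_mul (\pi_qquot x) (\pi_qquot y) = \pi_qquot (x * y).
Proof.
rewrite /qq_mul -lock; apply/qquotP.
rewrite -[X in X - _](subrK (x * repr (\pi_qquot y))) -addrA -mulrBl -mulrBr.
by apply: ideal_add; [apply: ideal_mulr | apply: ideal_mull]; exact: repr_pi.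
Qed.
Let pi_opp x : qq_opp (\pi_qquot x) = \pi_qquot (- x).
Proof.
rewrite /qq_opp -lock; apply/qquotP.
by rewrite -opprD; apply: ideal_opp; exact: repr_pi.
Qed.
Let pi_scale k x : qq_scale k (\pi_qquot x) = \pi_qquot (k *: x).
Proof.
rewrite /qq_scale -lock; apply/qquotP.
rewrite -scalerBr -[_ - _]mul1r ascalerAl; apply: ideal_mull; exact: repr_pi.
Qed.

Let qaddA : associative qq_add.
Proof. by do 3![elim/quotW=> ?]; rewrite !pi_add addrA. Qed.
Let qaddC : commutative qq_add.
Proof. by do 2![elim/quotW=> ?]; rewrite !pi_add addrC. Qed.
Let qadd0 : left_id (\pi_qquot 0) qq_add.
Proof. by elim/quotW=> ?; rewrite !pi_add add0r. Qed.
Let qaddN : left_inverse (\pi_qquot 0) qq_opp qq_add.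
Proof. by elim/quotW=> ?; rewrite pi_opp pi_add addNr. Qed.
HB.instance Definition _ :=
  GRing.isZmodule.Build qquot qaddA qaddC qadd0 qaddN.

Let qmulA : associative qq_mul.
Proof. by do 3![elim/quotW=> ?]; rewrite !pi_mul mulrA. Qed.
Let qmul1 : left_id (\pi_qquot 1) qq_mul.
Proof. by elim/quotW=> ?; rewrite !pi_mul mul1r. Qed.
Let q1mul : right_id (\pi_qquot 1) qq_mul.
Proof. by elim/quotW=> ?; rewrite !pi_mul mulr1. Qed.
Let qmulDl : left_distributive qq_mul +%R.
Proof.
do 3![elim/quotW=> ?]; rewrite [X in qq_mul X _]pi_add !pi_mul mulrDl.
by rewrite [RHS]pi_add.
Qed.
Let qmulDr : right_distributive qq_mul +%R.
Proof.
do 3![elim/quotW=> ?]; rewrite [X in qq_mul _ X]pi_add !pi_mul mulrDr.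
by rewrite [RHS]pi_add.
Qed.

Let qscaleA a b x : qq_scale a (qq_scale b x) = qq_scale (a * b) x.
Proof. by elim/quotW: x => ?; rewrite !pi_scale scalerA. Qed.
Let qscale1 : left_id 1 qq_scale.
Proof. by elim/quotW=> ?; rewrite !pi_scale scale1r. Qed.
Let qscaleDr : right_distributive qq_scale +%R.
Proof.
move=> k; do 2![elim/quotW=> ?].
by rewrite [X in qq_scale _ X]pi_add !pi_scale scalerDr [RHS]pi_add.
Qed.
Let qscaleDl x : {morph qq_scale^~ x : a b / a + b}.
Proof.
by elim/quotW: x => ? a b; rewrite !pi_scale scalerDl [RHS]pi_add.
Qed.
HB.instance Definition _ := GRing.Zmodule_isLmodule.Build K qquot
  qscaleA qscale1 qscaleDr qscaleDl.

Let qscaleAl k x y : k *: qq_mul x y = qq_mul (k *: x) y.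
Proof.
elim/quotW: x => x; elim/quotW: y => y.
by rewrite pi_mul [LHS]pi_scale [X in qq_mul X _]pi_scale pi_mul ascalerAl.
Qed.
Let qscaleAr k x y : k *: qq_mul x y = qq_mul x (k *: y).
Proof.
elim/quotW: x => x; elim/quotW: y => y.
by rewrite pi_mul [LHS]pi_scale [X in qq_mul _ X]pi_scale pi_mul ascalerAr.
Qed.

Definition quotAlg : algebra K :=
  @Algebra K qquot qq_mul (\pi_qquot 1) qmulA qmul1 q1mul qmulDl qmulDr
    qscaleAl qscaleAr.

Definition quot_proj (x : A) : quotAlg := \pi_qquot x.

Lemma quot_proj_hom : alg_hom quot_proj.
Proof.
split=> // [k x y | x y]; last by rewrite [RHS]pi_mul.
rewrite /quot_proj -[\pi_qquot (_ + _)]pi_add -pi_scale //.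
Qed.

Lemma quot_proj_eq0 x : S x -> quot_proj x = 0.
Proof. by move=> Sx; apply/qquotP; rewrite subr0; exact: ideal_gen. Qed.

Section Lift.
Variables (Z : algebra K) (f : A -> Z).

Definition quot_lift (x : quotAlg) : Z := f (repr (x : qquot)).

Hypotheses (f_hom : alg_hom f) (fS : forall x, S x -> f x = 0).

Lemma ideal_ker x : ideal x -> f x = 0.
Proof.
elim=> {x} [x /fS // | | x y _ fx _ fy | a x _ fx | a x _ fx].
- exact: alg_hom0.
- by rewrite (alg_homD f_hom) fx fy addr0.
- by rewrite (alg_homM f_hom) fx mulr0.
- by rewrite (alg_homM f_hom) fx mul0r.
Qed.

Lemma quot_lift_proj x : quot_lift (quot_proj x) = f x.
Proof.
apply/eqP; rewrite -subr_eq0 -(alg_homB f_hom); apply/eqP/ideal_ker.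
exact: repr_pi.
Qed.

Lemma quot_projW (P : quotAlg -> Prop) :
  (forall x, P (quot_proj x)) -> forall x, P x.
Proof. by move=> Pp; elim/quotW => x; exact: Pp. Qed.

Lemma quot_lift_hom : alg_hom quot_lift.
Proof.
have [ql q1 qM] := quot_proj_hom; have [fl f1 fM] := f_hom.
split=> [k | | ].
- elim/quot_projW=> x; elim/quot_projW=> y.
  by rewrite -ql !quot_lift_proj fl.
- by rewrite -q1 quot_lift_proj f1.
- elim/quot_projW=> x; elim/quot_projW=> y.
  by rewrite -qM !quot_lift_proj fM.
Qed.

End Lift.
End Quotient.

Section Tensor.
Variables (K : comNzRingType) (V W : lmodType K).

Inductive tterm : Type :=
  | TZero | TPure of V & W | TAdd of tterm & tterm | TScale of K & tterm.

Inductive tcong : tterm -> tterm -> Prop :=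
  | tcong_refl s : tcong s s
  | tcong_sym s t : tcong s t -> tcong t s
  | tcong_trans s t r : tcong s t -> tcong t r -> tcong s r
  | tcong_add s s' t t' :
      tcong s s' -> tcong t t' -> tcong (TAdd s t) (TAdd s' t')
  | tcong_scale k s s' : tcong s s' -> tcong (TScale k s) (TScale k s')
  | tcong_addA s t r : tcong (TAdd s (TAdd t r)) (TAdd (TAdd s t) r)
  | tcong_addC s t : tcong (TAdd s t) (TAdd t s)
  | tcong_add0 s : tcong (TAdd TZero s) s
  | tcong_addN s : tcong (TAdd (TScale (-1) s) s) TZero
  | tcong_scaleA k l s : tcong (TScale k (TScale l s)) (TScale (k * l) s)
  | tcong_scale1 s : tcong (TScale 1 s) s
  | tcong_scaleDr k s t :
      tcong (TScale k (TAdd s t)) (TAdd (TScale k s) (TScale k t))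
  | tcong_scaleDl k l s :
      tcong (TScale (k + l) s) (TAdd (TScale k s) (TScale l s))
  | tcong_pureDl v v' w :
      tcong (TPure (v + v') w) (TAdd (TPure v w) (TPure v' w))
  | tcong_pureDr v w w' :
      tcong (TPure v (w + w')) (TAdd (TPure v w) (TPure v w'))
  | tcong_pureZl k v w : tcong (TPure (k *: v) w) (TScale k (TPure v w))
  | tcong_pureZr k v w : tcong (TPure v (k *: w)) (TScale k (TPure v w)).

HB.instance Definition _ := gen_eqMixin tterm.
HB.instance Definition _ := gen_choiceMixin tterm.

Definition tcongb (s t : tterm) : bool := `[< tcong s t >].
Fact tcongb_equiv : equiv_class_of tcongb.
Proof.
split=> [s | s t | t s r].
- by apply/asboolP; exact: tcong_refl.
- by apply/asboolP/asboolP; exact: tcong_sym.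
- by move=> /asboolP st /asboolP tr; apply/asboolP; exact: tcong_trans st tr.
Qed.
Canonical tcongb_equivRel := EquivRelPack tcongb_equiv.

Definition tensor : Type := {eq_quot tcongb}.
HB.instance Definition _ := Choice.on tensor.
HB.instance Definition _ := Quotient.on tensor.

Lemma tensorP s t : tcong s t <-> \pi_tensor s = \pi_tensor t.
Proof. by split=> [st | /eqmodP/asboolP //]; apply/eqmodP/asboolP. Qed.

Definition tens_add : tensor -> tensor -> tensor :=
  locked (fun x y => \pi_tensor (TAdd (repr x) (repr y))).
Definition tens_scale : K -> tensor -> tensor :=
  locked (fun k x => \pi_tensor (TScale k (repr x))).
Definition tens_opp (x : tensor) : tensor := tens_scale (-1) x.

Let repr_pi s : tcong (repr (\pi_tensor s)) s.
Proof. by apply/tensorP; rewrite reprK. Qed.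
Lemma tens_pi_add s t :
  tens_add (\pi_tensor s) (\pi_tensor t) = \pi_tensor (TAdd s t).
Proof. by rewrite /tens_add -lock; apply/tensorP/tcong_add; exact: repr_pi. Qed.
Lemma tens_pi_scale k s :
  tens_scale k (\pi_tensor s) = \pi_tensor (TScale k s).
Proof.
by rewrite /tens_scale -lock; apply/tensorP/tcong_scale; exact: repr_pi.
Qed.

Let taddA : associative tens_add.
Proof.
by do 3![elim/quotW=> ?]; rewrite !tens_pi_add; apply/tensorP/tcong_addA.
Qed.
Let taddC : commutative tens_add.
Proof.
by do 2![elim/quotW=> ?]; rewrite !tens_pi_add; apply/tensorP/tcong_addC.
Qed.
Let tadd0 : left_id (\pi_tensor TZero) tens_add.
Proof. by elim/quotW=> ?; rewrite !tens_pi_add; apply/tensorP/tcong_add0. Qed.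
Let taddN : left_inverse (\pi_tensor TZero) tens_opp tens_add.
Proof.
elim/quotW=> ?; rewrite /tens_opp tens_pi_scale tens_pi_add.
by apply/tensorP/tcong_addN.
Qed.
HB.instance Definition _ :=
  GRing.isZmodule.Build tensor taddA taddC tadd0 taddN.

Let tscaleA a b x : tens_scale a (tens_scale b x) = tens_scale (a * b) x.
Proof.
by elim/quotW: x => ?; rewrite !tens_pi_scale; apply/tensorP/tcong_scaleA.
Qed.
Let tscale1 : left_id 1 tens_scale.
Proof.
by elim/quotW=> ?; rewrite !tens_pi_scale; apply/tensorP/tcong_scale1.
Qed.
Let tscaleDr : right_distributive tens_scale +%R.
Proof.
move=> k; do 2![elim/quotW=> ?].
rewrite [X in tens_scale _ X]tens_pi_add !tens_pi_scale [RHS]tens_pi_add.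
by apply/tensorP/tcong_scaleDr.
Qed.
Let tscaleDl x : {morph tens_scale^~ x : a b / a + b}.
Proof.
elim/quotW: x => ? a b; rewrite !tens_pi_scale [RHS]tens_pi_add.
by apply/tensorP/tcong_scaleDl.
Qed.
HB.instance Definition _ := GRing.Zmodule_isLmodule.Build K tensor
  tscaleA tscale1 tscaleDr tscaleDl.

Definition pure (v : V) (w : W) : tensor := \pi_tensor (TPure v w).

Lemma pureDl v v' w : pure (v + v') w = pure v w + pure v' w.
Proof. by rewrite [RHS]tens_pi_add; apply/tensorP/tcong_pureDl. Qed.
Lemma pureDr v w w' : pure v (w + w') = pure v w + pure v w'.
Proof. by rewrite [RHS]tens_pi_add; apply/tensorP/tcong_pureDr. Qed.
Lemma pureZl k v w : pure (k *: v) w = k *: pure v w.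
Proof. by rewrite [RHS]tens_pi_scale; apply/tensorP/tcong_pureZl. Qed.
Lemma pureZr k v w : pure v (k *: w) = k *: pure v w.
Proof. by rewrite [RHS]tens_pi_scale; apply/tensorP/tcong_pureZr. Qed.

Lemma tens_ind (P : tensor -> Prop) :
    (forall v w, P (pure v w)) -> (forall x y, P x -> P y -> P (x + y)) ->
  forall x, P x.
Proof.
move=> Pp PD; have Pt t : forall k, P (k *: (\pi_tensor t : tensor)).
  elim: t => [|v w|s IHs t IHt|l s IHs] k.
  - have -> : \pi_tensor TZero = pure 0 0.
      by rewrite -[in RHS](scale0r 0) pureZl scale0r.
    by rewrite -pureZl.
  - by rewrite -pureZl.
  - by rewrite -tens_pi_add scalerDr; exact: PD.
  - have -> : \pi_tensor (TScale l s) = l *: (\pi_tensor s : tensor).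
      by rewrite [RHS]tens_pi_scale.
    by rewrite scalerA.
by elim/quotW => t; rewrite -[\pi_tensor t]scale1r.
Qed.

Section Lift.
Variables (Z : lmodType K) (f : V -> W -> Z).

Fixpoint teval (t : tterm) : Z :=
  match t with
  | TZero => 0
  | TPure v w => f v w
  | TAdd s t => teval s + teval t
  | TScale k s => k *: teval s
  end.

(* Meaningful for bilinear f only: it evaluates a chosen representative. *)
Definition tens_lift (x : tensor) : Z := teval (repr x).

Definition bilinear_map :=
  (forall w, linear (f^~ w)) /\ (forall v, linear (f v)).

Hypothesis f_bil : bilinear_map.

Lemma tevalP s t : tcong s t -> teval s = teval t.
Proof.
have [fl fr] := f_bil.
have fDl v v' w : f (v + v') w = f v w + f v' w.
  by have := fl w 1 v v'; rewrite !scale1r.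
have fDr v w w' : f v (w + w') = f v w + f v w'.
  by have := fr v 1 w w'; rewrite !scale1r.
have f0l w : f 0 w = 0.
  by have := fl w (-1) 0 0; rewrite scaler0 addr0 scaleN1r addNr.
have f0r v : f v 0 = 0.
  by have := fr v (-1) 0 0; rewrite scaler0 addr0 scaleN1r addNr.
have fZl k v w : f (k *: v) w = k *: f v w.
  by have := fl w k v 0; rewrite !addr0 f0l addr0.
have fZr k v w : f v (k *: w) = k *: f v w.
  by have := fr v k w 0; rewrite !addr0 f0r addr0.
elim=> {s t} //=.
- by move=> s t r _ -> _ ->.
- by move=> s s' t t' _ -> _ ->.
- by move=> k s s' _ ->.
- by move=> s t r; rewrite addrA.
- by move=> s t; rewrite addrC.
- by move=> s; rewrite add0r.
- by move=> s; rewrite scaleN1r addNr.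
- by move=> k l s; rewrite scalerA.
- by move=> s; rewrite scale1r.
- by move=> k s t; rewrite scalerDr.
- by move=> k l s; rewrite scalerDl.
Qed.

Lemma tens_lift_pure v w : tens_lift (pure v w) = f v w.
Proof. by apply: (@tevalP _ (TPure v w)); exact: repr_pi. Qed.

Lemma tens_lift_linear : linear tens_lift.
Proof.
move=> k; elim/quotW => s; elim/quotW => t.
have -> : k *: (\pi_tensor s : tensor) + \pi_tensor t =
  \pi_tensor (TAdd (TScale k s) t) by rewrite -tens_pi_add -tens_pi_scale.
by rewrite /tens_lift !(tevalP (repr_pi _)).
Qed.

End Lift.
End Tensor.

Notation "x \ox y" := (pure x y) (at level 40, left associativity).

Section TensorMaps.
Variable K : comNzRingType.

Lemma linear_sumP (V W : lmodType K) (f g : V -> W) (k : K) :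
  linear f -> linear g -> linear (fun x => k *: f x + g x).
Proof.
move=> lf lg l x y; rewrite lf lg !scalerDr !scalerA mulrC -!addrA.
by congr (_ + _); rewrite addrCA.
Qed.

Lemma tens_eq (V W Z : lmodType K) (f g : tensor V W -> Z) :
  linear f -> linear g -> (forall v w, f (v \ox w) = g (v \ox w)) -> f =1 g.
Proof.
move=> lf lg fg; elim/tens_ind=> // x y fx fy.
by have := lf 1 x y; have := lg 1 x y; rewrite !scale1r => -> ->; rewrite fx fy.
Qed.

(* (v \ox v', w \ox w') |-> f v w \ox g v' w' *)
Definition tens_mul2 (V W Z V' W' Z' : lmodType K)
    (f : V -> W -> Z) (g : V' -> W' -> Z') (x : tensor V V') (y : tensor W W') :
    tensor Z Z' :=
  tens_lift (fun v v' => tens_lift (fun w w' => f v w \ox g v' w') y) x.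

Definition tens_map (V W V' W' : lmodType K) (f : V -> W) (g : V' -> W') :
    tensor V V' -> tensor W W' :=
  tens_lift (fun v v' => f v \ox g v').

Definition tens_assoc (U V W : lmodType K) :
    tensor (tensor U V) W -> tensor U (tensor V W) :=
  tens_lift (fun t w => tens_lift (fun u v => u \ox (v \ox w)) t).

Section Mul2.
Variables (V W Z V' W' Z' : lmodType K).
Variables (f : V -> W -> Z) (g : V' -> W' -> Z').
Hypotheses (f_bil : bilinear_map f) (g_bil : bilinear_map g).

Let inner v v' : bilinear_map (fun w w' => f v w \ox g v' w').
Proof.
by split=> [w' k x y | w k x y];
   rewrite ?f_bil.2 ?g_bil.2 ?pureDl ?pureDr ?pureZl ?pureZr.
Qed.
Let outer y : bilinear_map
  (fun v v' => tens_lift (fun w w' => f v w \ox g v' w') y).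
Proof.
split=> [v' k v1 v2 | v k v1 v2].
  move: y; apply: tens_eq => [||w w'].
  - exact: tens_lift_linear (inner _ _).
  - by apply: linear_sumP; apply: tens_lift_linear; exact: inner.
  - by rewrite !tens_lift_pure // f_bil.1 pureDl pureZl.
move: y; apply: tens_eq => [||w w'].
- exact: tens_lift_linear (inner _ _).
- by apply: linear_sumP; apply: tens_lift_linear; exact: inner.
- by rewrite !tens_lift_pure // g_bil.1 pureDr pureZr.
Qed.

Lemma tens_mul2_pure v v' w w' :
  tens_mul2 f g (v \ox v') (w \ox w') = f v w \ox g v' w'.
Proof. by rewrite /tens_mul2 !tens_lift_pure. Qed.

Lemma tens_mul2_bilinear : bilinear_map (tens_mul2 f g).
Proof.
split=> [y | x k y1 y2]; first exact: tens_lift_linear (outer y).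
move: x; apply: tens_eq => [||v v'].
- exact: tens_lift_linear (outer _).
- by apply: linear_sumP; apply: tens_lift_linear; exact: outer.
- by rewrite /tens_mul2 !tens_lift_pure // tens_lift_linear.
Qed.

End Mul2.

Lemma tens_map_bilinear (V W V' W' : lmodType K) (f : V -> W) (g : V' -> W') :
  linear f -> linear g -> bilinear_map (fun v v' => f v \ox g v').
Proof.
by move=> lf lg; split=> [w' k x y | w k x y];
   rewrite ?lf ?lg ?pureDl ?pureDr ?pureZl ?pureZr.
Qed.

End TensorMaps.

Section TensorAlgebra.
Variables (K : comNzRingType) (A B : algebra K).

Lemma mul_bilinear (C : algebra K) : bilinear_map (fun x y : C => x * y).
Proof.
split=> [w k x y | v k x y]; first by rewrite mulrDl -ascalerAl.
by rewrite mulrDr -ascalerAr.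
Qed.

Definition tens_mul : tensor A B -> tensor A B -> tensor A B :=
  tens_mul2 (fun x y : A => x * y) (fun x y : B => x * y).

Let mb : bilinear_map tens_mul.
Proof. by apply: tens_mul2_bilinear; exact: mul_bilinear. Qed.
Let mpure a b c d : tens_mul (a \ox b) (c \ox d) = (a * c) \ox (b * d).
Proof. by apply: tens_mul2_pure; exact: mul_bilinear. Qed.
Let mDl : left_distributive tens_mul +%R.
Proof. by move=> x y z; have := mb.1 z 1 x y; rewrite !scale1r. Qed.
Let mDr : right_distributive tens_mul +%R.
Proof. by move=> z x y; have := mb.2 z 1 x y; rewrite !scale1r. Qed.
Let m0l x : tens_mul 0 x = 0.
Proof. by apply: (addIr (tens_mul 0 x)); rewrite -mDl !add0r. Qed.
Let m0r x : tens_mul x 0 = 0.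
Proof. by apply: (addIr (tens_mul x 0)); rewrite -mDr !add0r. Qed.
Let mZl k x y : k *: tens_mul x y = tens_mul (k *: x) y.
Proof. by have := mb.1 y k x 0; rewrite !addr0 m0l addr0. Qed.
Let mZr k x y : k *: tens_mul x y = tens_mul x (k *: y).
Proof. by have := mb.2 x k y 0; rewrite !addr0 m0r addr0. Qed.
Let mA : associative tens_mul.
Proof.
elim/tens_ind => [a a'|x1 x2 H1 H2] y z; last by rewrite !mDl H1 H2.
elim/tens_ind: y => [b b'|y1 y2 H1 H2]; last by rewrite mDr !mDl mDr H1 H2.
elim/tens_ind: z => [c c'|z1 z2 H1 H2]; last by rewrite !mDr H1 H2.
by rewrite !mpure !mulrA.
Qed.
Let m1l : left_id ((1 : A) \ox (1 : B)) tens_mul.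
Proof.
elim/tens_ind => [a a'|x1 x2 H1 H2]; last by rewrite mDr H1 H2.
by rewrite mpure !mul1r.
Qed.
Let m1r : right_id ((1 : A) \ox (1 : B)) tens_mul.
Proof.
elim/tens_ind => [a a'|x1 x2 H1 H2]; last by rewrite mDl H1 H2.
by rewrite mpure !mulr1.
Qed.

Definition tensAlg : algebra K :=
  @Algebra K (tensor A B) tens_mul ((1 : A) \ox (1 : B))
    mA m1l m1r mDl mDr mZl mZr.

Definition apure (a : A) (b : B) : tensAlg := a \ox b.

Lemma apureM a b c d : apure a b * apure c d = apure (a * c) (b * d).
Proof. exact: mpure. Qed.

End TensorAlgebra.

Section TensorAlgebraTheory.
Variable K : comNzRingType.

Lemma apure_suml (A B : algebra K) I (r : seq I) (P : pred I) (F : I -> A)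
    (b : B) :
  apure (\sum_(i <- r | P i) F i) b = \sum_(i <- r | P i) apure (F i) b.
Proof.
apply: (big_morph (fun a => apure a b)) => [x y|]; first exact: pureDl.
by have := @pureZl K A B 0 0 b; rewrite !scale0r.
Qed.
Lemma apure_sumr (A B : algebra K) I (r : seq I) (P : pred I) (F : I -> B)
    (a : A) :
  apure a (\sum_(i <- r | P i) F i) = \sum_(i <- r | P i) apure a (F i).
Proof.
apply: (big_morph (fun b => apure a b)) => [x y|]; first exact: pureDr.
by have := @pureZr K A B 0 a 0; rewrite !scale0r.
Qed.
Lemma apureZl (A B : algebra K) k (a : A) (b : B) :
  apure (k *: a) b = k *: apure a b.
Proof. exact: pureZl. Qed.
Lemma apureZr (A B : algebra K) k (a : A) (b : B) :
  apure a (k *: b) = k *: apure a b.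
Proof. exact: pureZr. Qed.

Lemma tens_map_hom (A B A' B' : algebra K) (f : A -> B) (g : A' -> B') :
  alg_hom f -> alg_hom g ->
  alg_hom (tens_map f g : tensAlg A A' -> tensAlg B B').
Proof.
move=> f_hom g_hom; have [lf f1 fM] := f_hom; have [lg g1 gM] := g_hom.
have bil := tens_map_bilinear lf lg.
have mp a b : tens_map f g (a \ox b) = f a \ox g b by exact: tens_lift_pure.
have ml := tens_lift_linear bil.
have mD x y : tens_map f g (x + y) = tens_map f g x + tens_map f g y.
  by have := ml 1 x y; rewrite !scale1r.
split=> [||x y]; first exact: ml.
  by rewrite [LHS]mp f1 g1.
elim/tens_ind: x => [a a'|x1 x2 H1 H2]; last first.
  rewrite [X in tens_map _ _ X](_ : _ = (x1 : tensAlg A A') * y +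
    (x2 : tensAlg A A') * y); last exact: mulrDl.
  by rewrite mD H1 H2 mD [RHS]mulrDl.
elim/tens_ind: y => [b b'|y1 y2 H1 H2]; last first.
  rewrite [X in tens_map _ _ X](_ : _ = (a \ox a' : tensAlg A A') * y1 +
    (a \ox a' : tensAlg A A') * y2); last exact: mulrDr.
  by rewrite mD H1 H2 mD [RHS]mulrDr.
rewrite [X in tens_map _ _ X](_ : _ = (a * b) \ox (a' * b')); last exact: apureM.
by rewrite !mp fM gM; apply/esym/apureM.
Qed.

End TensorAlgebraTheory.

Section RMatrix.
Variables (K : fieldType) (p : K).   (* p = q^{1/2} *)

Definition qpar : K := p ^+ 2.

(* Indices 1, 2 are the elements 0, 1 of 'I_2. *)
Definition Cup (i j : 'I_2) : K :=
  p^-1 * ((i == 0)%:R * (j == 1)%:R) - p * ((i == 1)%:R * (j == 0)%:R).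
(* Clow is \hat C, with lower indices; RhatV is the inverse of Rhat, by [RhatK]. *)
Definition Clow (i j : 'I_2) : K := - Cup i j.
Definition Rhat (i j k l : 'I_2) : K :=
  p * ((i == k)%:R * (j == l)%:R) + p^-1 * (Cup i j * Clow k l).
Definition RhatV (i j k l : 'I_2) : K :=
  p^-1 * ((i == k)%:R * (j == l)%:R) + p * (Cup i j * Clow k l).

Lemma RhatK (p0 : p != 0) i j k l :
  \sum_a \sum_b Rhat i j a b * RhatV a b k l = (i == k)%:R * (j == l)%:R.
Proof.
case: i => [[|[|//]] ?]; case: j => [[|[|//]] ?];
case: k => [[|[|//]] ?]; case: l => [[|[|//]] ?];
by rewrite !big_ord_recl !big_ord0 /Rhat /RhatV /Clow /Cup /=; field.
Qed.

End RMatrix.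

Section SLq.
Variables (K : fieldType) (p : K).

Let q := qpar p.
Let R := Rhat p.

Definition SLq_free : algebra K := freeAlg (base_alg K) ('I_2 * 'I_2).
Definition SLq_gen (i j : 'I_2) : SLq_free := falg_gen (base_alg K) (i, j).

Inductive SLq_rel : SLq_free -> Prop :=
  | SLq_rel_RTT i j m n : SLq_rel
      (\sum_k \sum_l R i j k l *: (SLq_gen k m * SLq_gen l n)
       - \sum_k \sum_l R k l m n *: (SLq_gen i k * SLq_gen j l))
  | SLq_rel_det : SLq_rel
      (SLq_gen 0 0 * SLq_gen 1 1 - q *: (SLq_gen 0 1 * SLq_gen 1 0) - 1).

(* O(SL_q(2)) *)
Definition SLq : algebra K := quotAlg SLq_rel.
Definition SLq_u (i j : 'I_2) : SLq := quot_proj SLq_rel (SLq_gen i j).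

Section Lift.
Variables (Z : algebra K) (v : 'I_2 -> 'I_2 -> Z).

Definition SLq_point :=
  (forall i j m n, \sum_k \sum_l R i j k l *: (v k m * v l n)
                   = \sum_k \sum_l R k l m n *: (v i k * v j l))
  /\ v 0 0 * v 1 1 - q *: (v 0 1 * v 1 0) = 1.

(* The algebra homomorphism u i j |-> v i j, for v satisfying [SLq_point]. *)
Definition SLq_lift : SLq -> Z :=
  @quot_lift K _ SLq_rel Z
    (falg_lift (fun k : base_alg K => (k : K) *: (1 : Z))
               (fun ij : 'I_2 * 'I_2 => v ij.1 ij.2)).

Hypothesis v_pt : SLq_point.

Let free_hom := falg_lift_hom (fun ij : 'I_2 * 'I_2 => v ij.1 ij.2)
  (base_alg_hom Z).
Let free_gen i j := @falg_lift_gen _ _ _ Z _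
  (fun ij : 'I_2 * 'I_2 => v ij.1 ij.2) (base_alg_hom Z) (i, j).

Let free_rel x : SLq_rel x ->
  falg_lift (fun k : base_alg K => (k : K) *: (1 : Z))
            (fun ij : 'I_2 * 'I_2 => v ij.1 ij.2) x = 0.
Proof.
case: v_pt => vR vd; case=> [i j m n|].
- rewrite (alg_homB free_hom) !(alg_hom_sum free_hom); apply/eqP.
  rewrite subr_eq0; apply/eqP; under eq_bigr do rewrite (alg_hom_sum free_hom).
  under [RHS]eq_bigr do rewrite (alg_hom_sum free_hom).
  under eq_bigr do under eq_bigr do
    rewrite (alg_homZ free_hom) (alg_homM free_hom) !free_gen /=.
  under [RHS]eq_bigr do under eq_bigr do
    rewrite (alg_homZ free_hom) (alg_homM free_hom) !free_gen /=.
  exact: vR.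
- rewrite !(alg_homB free_hom) (alg_homZ free_hom) !(alg_homM free_hom).
  by rewrite !free_gen (alg_hom1 free_hom) /= vd subrr.
Qed.

Lemma SLq_lift_hom : alg_hom SLq_lift.
Proof. exact: quot_lift_hom free_hom free_rel. Qed.
Lemma SLq_lift_u i j : SLq_lift (SLq_u i j) = v i j.
Proof. by rewrite [LHS](quot_lift_proj free_hom free_rel) free_gen. Qed.

End Lift.

Lemma SLq_u_point : SLq_point SLq_u.
Proof.
have ph := quot_proj_hom SLq_rel; split=> [i j m n|].
- have /(@quot_proj_eq0 _ _ SLq_rel) := SLq_rel_RTT i j m n.
  rewrite (alg_homB ph) !(alg_hom_sum ph) => /eqP; rewrite subr_eq0 => /eqP.
  under eq_bigr do rewrite (alg_hom_sum ph).
  under [RHS]eq_bigr do rewrite (alg_hom_sum ph).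
  under eq_bigr do under eq_bigr do rewrite (alg_homZ ph) (alg_homM ph).
  by under [RHS]eq_bigr do under eq_bigr do rewrite (alg_homZ ph) (alg_homM ph).
- have /(@quot_proj_eq0 _ _ SLq_rel) := SLq_rel_det.
  rewrite !(alg_homB ph) (alg_homZ ph) !(alg_homM ph) (alg_hom1 ph).
  by move/eqP; rewrite subr_eq0 => /eqP.
Qed.

Lemma SLq_hom_eq (Z : algebra K) (f g : SLq -> Z) :
  alg_hom f -> alg_hom g -> (forall i j, f (SLq_u i j) = g (SLq_u i j)) ->
  f =1 g.
Proof.
move=> fh gh fg; elim/quot_projW; elim/quotW; elim=> [k|[i j]|s IHs t IHt|s IHs t IHt].
- have -> : \pi_(fquot (base_alg K) ('I_2 * 'I_2)) (FCst _ k)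
            = (k : K) *: (1 : SLq_free).
    rewrite -[X in FCst _ X]mulr1.
    have := alg_homZ (@falg_cst_hom K (base_alg K) ('I_2 * 'I_2)) k 1.
    by rewrite (alg_hom1 (@falg_cst_hom K (base_alg K) ('I_2 * 'I_2))).
  have ph := quot_proj_hom SLq_rel.
  by rewrite (alg_homZ ph) (alg_homZ fh) (alg_homZ gh) (alg_hom1 ph) (alg_hom1 fh) (alg_hom1 gh).
- exact: fg.
- have ph := quot_proj_hom SLq_rel; rewrite -fq_pi_add.
  by rewrite (alg_homD ph) (alg_homD fh) (alg_homD gh) IHs IHt.
- have ph := quot_proj_hom SLq_rel; rewrite -fq_pi_mul.
  by rewrite (alg_homM ph) (alg_homM fh) (alg_homM gh) IHs IHt.
Qed.

End SLq.

Section Sums.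
Variables (K : fieldType) (V : lmodType K).

Lemma sum2D (F G : 'I_2 -> 'I_2 -> V) :
  \sum_k \sum_l (F k l + G k l) = \sum_k \sum_l F k l + \sum_k \sum_l G k l.
Proof. by rewrite -big_split; apply: eq_bigr => k _; rewrite big_split. Qed.
Lemma sum2Z c (F : 'I_2 -> 'I_2 -> V) :
  \sum_k \sum_l c *: F k l = c *: \sum_k \sum_l F k l.
Proof. by rewrite scaler_sumr; apply: eq_bigr => k _; rewrite scaler_sumr. Qed.
Lemma sum1_delta i (G : 'I_2 -> V) : \sum_k (i == k)%:R *: G k = G i.
Proof.
rewrite (bigD1 i) //= eqxx scale1r big1 ?addr0 // => k /negbTE.
by rewrite eq_sym => ->; rewrite scale0r.
Qed.
Lemma sum2_delta i j (G : 'I_2 -> 'I_2 -> V) :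
  \sum_k \sum_l ((i == k)%:R * (j == l)%:R) *: G k l = G i j.
Proof.
under eq_bigr do under eq_bigr do rewrite -scalerA.
by under eq_bigr do rewrite -scaler_sumr sum1_delta; rewrite sum1_delta.
Qed.
Lemma sum_ord2 (F : 'I_2 -> V) : \sum_k F k = F 0 + F 1.
Proof.
by rewrite big_ord_recl big_ord1; congr (_ + F _); apply: val_inj.
Qed.
End Sums.

Section SLqHopf.
Variables (K : fieldType) (p : K).
Hypothesis p0 : p != 0.

Let q := qpar p.
Let R := Rhat p.
Notation A := (SLq p).
Notation u := (@SLq_u K p).

Section Points.
Variables (Z : algebra K) (v : 'I_2 -> 'I_2 -> Z).

Definition RTT := forall i j m n,
  \sum_k \sum_l R i j k l *: (v k m * v l n)
  = \sum_k \sum_l R k l m n *: (v i k * v j l).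

Let Cvv m n := \sum_k \sum_l Clow p k l *: (v k m * v l n).
Let vvC i j := \sum_k \sum_l Cup p k l *: (v i k * v j l).

Let R_l i j m n : \sum_k \sum_l R i j k l *: (v k m * v l n)
  = p *: (v i m * v j n) + p^-1 *: (Cup p i j *: Cvv m n).
Proof.
rewrite -[v i m * v j n](sum2_delta i j (fun k l => v k m * v l n)).
rewrite -!sum2Z -sum2D.
by do 2![apply: eq_bigr => ? _]; rewrite /R /Rhat scalerDl !scalerA -mulrA.
Qed.
Let R_r i j m n : \sum_k \sum_l R k l m n *: (v i k * v j l)
  = p *: (v i m * v j n) + p^-1 *: (Clow p m n *: vvC i j).
Proof.
rewrite -[v i m * v j n](sum2_delta m n (fun k l => v i k * v j l)).
rewrite -!sum2Z -sum2D.
do 2![apply: eq_bigr => ? _]; rewrite /R /Rhat scalerDl !scalerA.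
congr (_ + _); congr (_ *: _); last by rewrite [Cup _ _ _ * _]mulrC mulrA.
by rewrite [m == _]eq_sym [n == _]eq_sym.
Qed.

Lemma RTT_C : RTT <-> forall i j m n, Cup p i j *: Cvv m n = Clow p m n *: vvC i j.
Proof.
split=> H i j m n; last by rewrite R_l R_r H.
have := H i j m n; rewrite R_l R_r => /addrI /scalerI; apply.
by rewrite invr_eq0.
Qed.

Lemma SLq_pointP : SLq_point p v <->
  (forall i j, vvC i j = Cup p i j *: (1 : Z))
  /\ (forall m n, Cvv m n = Clow p m n *: (1 : Z)).
Proof.
have C01 : Cup p 0 1 = p^-1 by rewrite /Cup !eqxx !mulr1 /= mul0r mulr0 subr0.
have vvC01 : p *: vvC 0 1 = v 0 0 * v 1 1 - q *: (v 0 1 * v 1 0).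
  rewrite /vvC !sum_ord2 C01 /Cup /= !(mul0r, mulr0, mulr1, subr0, sub0r, oppr0).
  rewrite !scale0r add0r addr0 scalerDr !scalerA mulfV // scale1r.
  by rewrite scale0r addr0 scalerA mulrN scaleNr.
split=> [[vR vd] | [vC Cv]]; last first.
  split; last by rewrite -vvC01 vC C01 scalerA mulfV // scale1r.
  by apply/RTT_C => i j m n; rewrite vC Cv !scalerA mulrC.
have /RTT_C H := vR; rewrite vd in vvC01.
have vvC01' : vvC 0 1 = Cup p 0 1 *: (1 : Z).
  by rewrite C01 -vvC01 scalerA mulVf // scale1r.
have C01n : Cup p 0 1 != 0 by rewrite C01 invr_eq0.
have Cv m n : Cvv m n = Clow p m n *: (1 : Z).
  by apply: (scalerI C01n); rewrite H vvC01' !scalerA mulrC.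
split=> // i j; have Cn : Clow p 0 1 != 0 by rewrite oppr_eq0.
by apply: (scalerI Cn); rewrite -H Cv !scalerA mulrC.
Qed.
End Points.

Lemma SLq_RTT (i j m n : 'I_2) :
  \sum_k \sum_l R i j k l *: (u k m * u l n)
  = \sum_k \sum_l R k l m n *: (u i k * u j l).
Proof. exact: (SLq_u_point p).1. Qed.
Lemma SLq_Cup i j :
  \sum_k \sum_l Cup p k l *: (u i k * u j l) = Cup p i j *: (1 : A).
Proof. by case/SLq_pointP: (SLq_u_point p). Qed.
Lemma SLq_Clow m n :
  \sum_k \sum_l Clow p k l *: (u k m * u l n) = Clow p m n *: (1 : A).
Proof. by case/SLq_pointP: (SLq_u_point p). Qed.

Definition SLq_Delta : A -> tensAlg A A :=
  @SLq_lift K p (tensAlg A A) (fun i j => \sum_k apure (u i k) (u k j)).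

Definition SLq_eps : A -> base_alg K :=
  @SLq_lift K p (base_alg K) (fun i j => (i == j)%:R : K).

(* chi |> u^i_j = q^(j-i) u^i_j *)
Definition SLq_chi : A -> A :=
  @SLq_lift K p A (fun i j => (q ^ (j%:Z - i%:Z)) *: u i j).

Let apure_sum2 (Z Z' : algebra K) (F : 'I_2 -> Z) (G : 'I_2 -> Z')
    (F' : 'I_2 -> Z) (G' : 'I_2 -> Z') :
  (\sum_k apure (F k) (G k)) * (\sum_l apure (F' l) (G' l))
  = \sum_k \sum_l apure (F k * F' l) (G k * G' l).
Proof.
rewrite mulr_suml; apply: eq_bigr => k _; rewrite mulr_sumr.
by apply: eq_bigr => l _; rewrite apureM.
Qed.

Let sum2_apurel (Z Z' : algebra K) (c : 'I_2 -> 'I_2 -> K)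
    (F : 'I_2 -> 'I_2 -> Z) (b : Z') :
  \sum_k \sum_l c k l *: apure (F k l) b
  = apure (\sum_k \sum_l c k l *: F k l) b.
Proof.
rewrite apure_suml; apply: eq_bigr => k _; rewrite apure_suml.
by apply: eq_bigr => l _; rewrite apureZl.
Qed.
Let sum2_apurer (Z Z' : algebra K) (c : 'I_2 -> 'I_2 -> K)
    (F : 'I_2 -> 'I_2 -> Z') (a : Z) :
  \sum_k \sum_l c k l *: apure a (F k l)
  = apure a (\sum_k \sum_l c k l *: F k l).
Proof.
rewrite apure_sumr; apply: eq_bigr => k _; rewrite apure_sumr.
by apply: eq_bigr => l _; rewrite apureZr.
Qed.

Let exch4 (V : zmodType) (F : 'I_2 -> 'I_2 -> 'I_2 -> 'I_2 -> V) :
  \sum_i \sum_j \sum_k \sum_l F i j k l = \sum_k \sum_l \sum_i \sum_j F i j k l.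
Proof.
under eq_bigr do rewrite exchange_big; rewrite exchange_big.
apply: eq_bigr => k _; under eq_bigr do rewrite exchange_big.
by rewrite exchange_big.
Qed.

Lemma SLq_Delta_point :
  @SLq_point K p (tensAlg A A) (fun i j => \sum_k apure (u i k) (u k j)).
Proof.
have vv k m l n : (\sum_a apure (u k a) (u a m)) * (\sum_b apure (u l b) (u b n))
    = \sum_a \sum_b apure (u k a * u l b) (u a m * u b n).
  exact: apure_sum2.
have lsum (c : 'I_2 -> 'I_2 -> K) m n : \sum_k \sum_l c k l *:
    ((\sum_a apure (u k a) (u a m)) * (\sum_b apure (u l b) (u b n)))
  = \sum_a \sum_b apure (\sum_k \sum_l c k l *: (u k a * u l b)) (u a m * u b n).
  under eq_bigr do under eq_bigr do rewrite vv -sum2Z.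
  by rewrite exch4; do 2![apply: eq_bigr => ? _]; rewrite sum2_apurel.
have rsum (c : 'I_2 -> 'I_2 -> K) i j : \sum_k \sum_l c k l *:
    ((\sum_a apure (u i a) (u a k)) * (\sum_b apure (u j b) (u b l)))
  = \sum_a \sum_b apure (u i a * u j b) (\sum_k \sum_l c k l *: (u a k * u b l)).
  under eq_bigr do under eq_bigr do rewrite vv -sum2Z.
  by rewrite exch4; do 2![apply: eq_bigr => ? _]; rewrite sum2_apurer.
apply/SLq_pointP; split=> [i j | m n].
- rewrite rsum; under eq_bigr do under eq_bigr do rewrite SLq_Cup apureZr -apureZl.
  under eq_bigr do rewrite -apure_suml.
  by rewrite -apure_suml SLq_Cup apureZl.
- rewrite lsum; under eq_bigr do under eq_bigr do rewrite SLq_Clow apureZl -apureZr.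
  under eq_bigr do rewrite -apure_sumr.
  by rewrite -apure_sumr SLq_Clow apureZr.
Qed.

Lemma SLq_Delta_hom : alg_hom SLq_Delta.
Proof. exact: SLq_lift_hom SLq_Delta_point. Qed.
Lemma SLq_Delta_u i j : SLq_Delta (u i j) = \sum_k apure (u i k) (u k j).
Proof. exact: SLq_lift_u SLq_Delta_point i j. Qed.

Lemma SLq_eps_point :
  @SLq_point K p (base_alg K) (fun i j => (i == j)%:R : K).
Proof.
apply/SLq_pointP; split=> [i j | m n].
- rewrite -[RHS]/(Cup p i j * 1) mulr1.
  rewrite -[RHS](@sum2_delta K K^o i j (fun k l => Cup p k l)).
  by do 2![apply: eq_bigr => ? _]; apply: mulrC.
- rewrite -[RHS]/(Clow p m n * 1) mulr1.
  rewrite -[RHS](@sum2_delta K K^o m n (fun k l => Clow p k l)).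
  do 2![apply: eq_bigr => ? _].
  by rewrite [m == _]eq_sym [n == _]eq_sym; apply: mulrC.
Qed.

Lemma SLq_eps_hom : alg_hom SLq_eps.
Proof. exact: SLq_lift_hom SLq_eps_point. Qed.
Lemma SLq_eps_u i j : SLq_eps (u i j) = (i == j)%:R.
Proof. exact: SLq_lift_u SLq_eps_point i j. Qed.

Lemma SLq_chi_point :
  @SLq_point K p A (fun i j => (q ^ (j%:Z - i%:Z)) *: u i j).
Proof.
have qn : q != 0 by rewrite expf_neq0.
have wt (k l : 'I_2) : (Cup p k l != 0) -> k%:Z + l%:Z = 1.
  case: k => [[|[|//]] ?]; case: l => [[|[|//]] ?] //;
  by rewrite /Cup /= !(mul0r, mulr0) subrr eqxx.
have Cwt (k l : 'I_2) (e : int) : Cup p k l * q ^ (k%:Z + l%:Z - e) = Cup p k l * q ^ (1 - e).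
  by have [->|/wt ->//] := eqVneq (Cup p k l) 0; rewrite !mul0r.
have Cwt' (k l : 'I_2) (e : int) : Cup p k l * q ^ (e - (k%:Z + l%:Z)) = Cup p k l * q ^ (e - 1).
  by have [->|/wt ->//] := eqVneq (Cup p k l) 0; rewrite !mul0r.
have uu (i j k l : 'I_2) : (q ^ (k%:Z - i%:Z) *: u i k) * (q ^ (l%:Z - j%:Z) *: u j l)
    = q ^ (k%:Z + l%:Z - (i%:Z + j%:Z)) *: (u i k * u j l).
  rewrite -ascalerAl -ascalerAr scalerA -expfzDr //; congr (_ ^ _ *: _).
  by rewrite opprD addrACA.
apply/SLq_pointP; split=> [i j | m n].
- under eq_bigr do under eq_bigr do rewrite uu scalerA Cwt mulrC -scalerA.
  by rewrite sum2Z SLq_Cup scalerA mulrC -Cwt subrr expr0z mulr1.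
- under eq_bigr do under eq_bigr do rewrite uu scalerA {1}/Clow mulNr Cwt' -mulNr mulrC -scalerA.
  rewrite sum2Z SLq_Clow scalerA mulrC {1}/Clow mulNr -Cwt' subrr expr0z.
  by rewrite mulr1.
Qed.

Lemma SLq_chi_hom : alg_hom SLq_chi.
Proof. exact: SLq_lift_hom SLq_chi_point. Qed.
Lemma SLq_chi_u i j : SLq_chi (u i j) = (q ^ (j%:Z - i%:Z)) *: u i j.
Proof. exact: SLq_lift_u SLq_chi_point i j. Qed.

End SLqHopf.

Section CrossedProduct.
Variables (K : comNzRingType) (A : algebra K) (phi : A -> A).

Inductive chi_gen := Chi | ChiInv.

Let F := freeAlg A chi_gen.
Let X : F := falg_gen A Chi.
Let Y : F := falg_gen A ChiInv.
Let cst : A -> F := falg_cst chi_gen.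

Inductive crossed_rel : F -> Prop :=
  | crossed_rel_r : crossed_rel (X * Y - 1)
  | crossed_rel_l : crossed_rel (Y * X - 1)
  | crossed_rel_comm a : crossed_rel (X * cst a - cst (phi a) * X).

(* A x| K[chi, chi^-1]: A with an invertible chi adjoined that implements the  *)
(* automorphism phi, chi a = phi(a) chi; hence (a chi^k)(b chi^l) =            *)
(* a phi^k(b) chi^(k+l).                                                       *)
Definition crossed : algebra K := quotAlg crossed_rel.

Definition crossed_in (a : A) : crossed := quot_proj crossed_rel (cst a).
Definition crossed_chi : crossed := quot_proj crossed_rel X.
Definition crossed_chiV : crossed := quot_proj crossed_rel Y.

Lemma crossed_in_hom : alg_hom crossed_in.
Proof.
exact: (alg_hom_comp (@falg_cst_hom K A chi_gen) (quot_proj_hom crossed_rel)).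
Qed.

Let ph := quot_proj_hom crossed_rel.

Lemma crossed_chiK : crossed_chi * crossed_chiV = 1.
Proof.
apply/eqP; rewrite -subr_eq0 -(alg_homM ph) -(alg_hom1 ph) -(alg_homB ph).
by apply/eqP/quot_proj_eq0/crossed_rel_r.
Qed.
Lemma crossed_chiVK : crossed_chiV * crossed_chi = 1.
Proof.
apply/eqP; rewrite -subr_eq0 -(alg_homM ph) -(alg_hom1 ph) -(alg_homB ph).
by apply/eqP/quot_proj_eq0/crossed_rel_l.
Qed.
Lemma crossed_chiC a : crossed_chi * crossed_in a = crossed_in (phi a) * crossed_chi.
Proof.
apply/eqP; rewrite -subr_eq0 -!(alg_homM ph) -(alg_homB ph).
by apply/eqP/quot_proj_eq0/crossed_rel_comm.
Qed.

Lemma crossed_mul a b (k l : nat) :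
  (crossed_in a * crossed_chi ^+ k) * (crossed_in b * crossed_chi ^+ l)
  = crossed_in (a * iter k phi b) * crossed_chi ^+ (k + l).
Proof.
have comm : crossed_chi ^+ k * crossed_in b
    = crossed_in (iter k phi b) * crossed_chi ^+ k.
  elim: k => [|k IHk] /=; first by rewrite expr0 mul1r mulr1.
  by rewrite exprS -mulrA IHk mulrA crossed_chiC -mulrA.
rewrite -mulrA [_ ^+ k * _]mulrA comm (alg_homM crossed_in_hom).
by rewrite exprD !mulrA.
Qed.

Section Lift.
Variables (Z : algebra K) (f : A -> Z) (x y : Z).

Definition crossed_lift : crossed -> Z :=
  @quot_lift K F crossed_rel Z
    (falg_lift f (fun g => match g with Chi => x | ChiInv => y end)).

Hypotheses (f_hom : alg_hom f) (xy : x * y = 1) (yx : y * x = 1).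
Hypothesis xf : forall a, x * f a = f (phi a) * x.

Let g := fun g => match g with Chi => x | ChiInv => y end.
Let lh := falg_lift_hom g f_hom.

Let lift_rel z : crossed_rel z -> falg_lift f g z = 0.
Proof.
have gX : falg_lift f g X = x by exact: falg_lift_gen.
have gY : falg_lift f g Y = y by exact: falg_lift_gen.
have gc a : falg_lift f g (cst a) = f a by exact: falg_lift_cst.
case=> [||a]; rewrite (alg_homB lh) !(alg_homM lh).
- by rewrite (alg_hom1 lh) gX gY xy subrr.
- by rewrite (alg_hom1 lh) gX gY yx subrr.
- by rewrite !gc gX xf subrr.
Qed.

Lemma crossed_lift_hom : alg_hom crossed_lift.
Proof. exact: quot_lift_hom lh lift_rel. Qed.
Lemma crossed_lift_in a : crossed_lift (crossed_in a) = f a.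
Proof. by rewrite [LHS](quot_lift_proj lh lift_rel); apply: falg_lift_cst. Qed.
Lemma crossed_lift_chi : crossed_lift crossed_chi = x.
Proof. by rewrite [LHS](quot_lift_proj lh lift_rel); apply: falg_lift_gen. Qed.
Lemma crossed_lift_chiV : crossed_lift crossed_chiV = y.
Proof. by rewrite [LHS](quot_lift_proj lh lift_rel); apply: falg_lift_gen. Qed.

End Lift.
End CrossedProduct.

Section SLqTilde.
Variables (K : fieldType) (p : K).
Hypothesis p0 : p != 0.
Notation A := (SLq p).
Notation u := (@SLq_u K p).

(* O(SL_q(2)) x| K[chi, chi^-1] *)
Definition SLqt : algebra K := crossed (@SLq_chi K p).
Definition SLqt_in : A -> SLqt := @crossed_in K A (@SLq_chi K p).
Definition chi : SLqt := crossed_chi (@SLq_chi K p).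
Definition chiV : SLqt := crossed_chiV (@SLq_chi K p).

Definition SLqt_Delta : SLqt -> tensAlg SLqt SLqt :=
  @crossed_lift K A _ (tensAlg SLqt SLqt)
    (fun a => tens_map SLqt_in SLqt_in (SLq_Delta a))
    (apure chi chi) (apure chiV chiV).

Definition SLqt_eps : SLqt -> base_alg K :=
  @crossed_lift K A _ (base_alg K) (@SLq_eps K p) 1 1.

Lemma SLqt_in_hom : alg_hom SLqt_in.
Proof. exact: crossed_in_hom. Qed.

Let mapD := fun a => tens_map SLqt_in SLqt_in (SLq_Delta a) : tensAlg SLqt SLqt.

Let mapD_hom : alg_hom mapD.
Proof.
exact: (alg_hom_comp (SLq_Delta_hom p0) (tens_map_hom SLqt_in_hom SLqt_in_hom)).
Qed.
Let chi2 : apure chi chi * apure chiV chiV = 1.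
Proof. by rewrite apureM crossed_chiK. Qed.
Let chi2V : apure chiV chiV * apure chi chi = 1.
Proof. by rewrite apureM crossed_chiVK. Qed.

Let mapD_chi a : apure chi chi * mapD a = mapD (SLq_chi a) * apure chi chi.
Proof.
have q0 : qpar p != 0 by rewrite expf_neq0.
have ch := SLq_chi_hom p0; have ih := SLqt_in_hom.
have mh := tens_map_hom ih ih.
have key : (mapD \o @SLq_chi K p) =1
    (fun a => apure chi chi * mapD a * apure chiV chiV).
  apply: SLq_hom_eq => [||i j].
  - exact: (alg_hom_comp ch mapD_hom).
  - split=> [k x y||x y].
    + rewrite (alg_homD mapD_hom) (alg_homZ mapD_hom) mulrDr mulrDl.
      by rewrite -ascalerAr -ascalerAl.
    + by rewrite (alg_hom1 mapD_hom) mulr1.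
    + rewrite (alg_homM mapD_hom) -!mulrA; congr (_ * (_ * _)).
      by rewrite [in RHS]mulrA chi2V mul1r.
  - have mp c d : tens_map SLqt_in SLqt_in (c \ox d)
                  = apure (SLqt_in c) (SLqt_in d).
      by apply: tens_lift_pure; apply: tens_map_bilinear; case: ih.
    rewrite /= (SLq_chi_u p0) (alg_homZ mapD_hom).
    rewrite /mapD (SLq_Delta_u p0) (alg_hom_sum mh).
    rewrite mulr_sumr mulr_suml scaler_sumr; apply: eq_bigr => k _.
    rewrite mp !apureM !crossed_chiC !(SLq_chi_u p0).
    rewrite !(alg_homZ (crossed_in_hom (@SLq_chi K p))).
    rewrite -!mulrA !crossed_chiK !mulr1 apureZl apureZr scalerA -expfzDr //.
    by congr (_ ^ _ *: _); ring.
by rewrite -[mapD (SLq_chi a)]/((mapD \o @SLq_chi K p) a) key -mulrA chi2V mulr1.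
Qed.

Lemma SLqt_Delta_hom : alg_hom SLqt_Delta.
Proof. exact: crossed_lift_hom mapD_hom chi2 chi2V mapD_chi. Qed.
Lemma SLqt_Delta_in a :
  SLqt_Delta (SLqt_in a) = tens_map SLqt_in SLqt_in (SLq_Delta a).
Proof. exact: crossed_lift_in mapD_hom chi2 chi2V mapD_chi a. Qed.
Lemma SLqt_Delta_chi : SLqt_Delta chi = apure chi chi.
Proof. exact: crossed_lift_chi mapD_hom chi2 chi2V mapD_chi. Qed.

Let eps_chi (a : A) : 1 * SLq_eps a = SLq_eps (SLq_chi a) * 1.
Proof.
rewrite mul1r mulr1; move: a; have eh := SLq_eps_hom p0.
have ch := SLq_chi_hom p0.
apply: SLq_hom_eq => // [|i j]; first exact: (alg_hom_comp ch eh).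
rewrite (SLq_chi_u p0) (alg_homZ eh) (SLq_eps_u p0).
have [->|_] := eqVneq i j; first by rewrite subrr expr0z scale1r.
by rewrite scaler0.
Qed.

Lemma SLqt_eps_hom : alg_hom SLqt_eps.
Proof.
by apply: crossed_lift_hom; [exact: SLq_eps_hom p0 | rewrite mul1r
  | rewrite mul1r | exact: eps_chi].
Qed.
Lemma SLqt_eps_in a : SLqt_eps (SLqt_in a) = SLq_eps a.
Proof.
by apply: crossed_lift_in; [exact: SLq_eps_hom p0 | rewrite mul1r
  | rewrite mul1r | exact: eps_chi].
Qed.
Lemma SLqt_eps_chi : SLqt_eps chi = 1.
Proof.
by apply: crossed_lift_chi; [exact: SLq_eps_hom p0 | rewrite mul1r
  | rewrite mul1r | exact: eps_chi].
Qed.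

End SLqTilde.

Section Clifford.
Variables (K : fieldType) (p nu0 c1 : K).

Let q := qpar p.
Let R := Rhat p.
Let RV := RhatV p.
Notation A := (SLq p).
Notation u := (@SLq_u K p).

(* The calculus Gamma is free as a left A-module on the theta_ij, with right    *)
(* multiplication fixed on generators by the relation below.  Its tensor        *)
(* algebra over A is therefore generated by A and the theta_ij subject to that  *)
(* relation.                                                                    *)
Let F := freeAlg A ('I_2 * 'I_2).
Let th (i j : 'I_2) : F := falg_gen A (i, j).
Let cst : A -> F := falg_cst ('I_2 * 'I_2).

Inductive TGamma_rel : F -> Prop :=
  | TGamma_rel_comm i j k l : TGamma_rel
      (th i j * cst (u k l)
       - nu0 *: \sum_m \sum_r \sum_t \sum_s
           (R m r i t * RV t s j l) *: (cst (u k m) * th r s)).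

Definition TGamma : algebra K := quotAlg TGamma_rel.
Definition TGamma_in (a : A) : TGamma := quot_proj TGamma_rel (cst a).
Definition TGamma_theta (i j : 'I_2) : TGamma := quot_proj TGamma_rel (th i j).

(* Operators on (K^2)^{\otimes 4} as matrices X^a_b, a, b : I4. *)
Definition I4 : finType := ('I_2 * 'I_2 * 'I_2 * 'I_2)%type.
Definition mat4 := I4 -> I4 -> K.
Definition mul4 (X Y : mat4) : mat4 := fun a c => \sum_b X a b * Y b c.
Definition leg12 (X : 'I_2 -> 'I_2 -> 'I_2 -> 'I_2 -> K) : mat4 :=
  fun '(i, j, k, l) '(i', j', k', l') =>
    X i j i' j' * ((k == k')%:R * (l == l')%:R).
Definition leg23 (X : 'I_2 -> 'I_2 -> 'I_2 -> 'I_2 -> K) : mat4 :=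
  fun '(i, j, k, l) '(i', j', k', l') =>
    X j k j' k' * ((i == i')%:R * (l == l')%:R).
Definition leg34 (X : 'I_2 -> 'I_2 -> 'I_2 -> 'I_2 -> K) : mat4 :=
  fun '(i, j, k, l) '(i', j', k', l') =>
    X k l k' l' * ((i == i')%:R * (j == j')%:R).

Definition sigma_mx : mat4 :=
  mul4 (mul4 (mul4 (leg23 R) (leg12 R)) (leg34 RV)) (leg23 RV).

Definition metric : I4 -> K := fun '(i, j, k, l) =>
  - (p * c1 * \sum_m \sum_n Clow p i m * Clow p n l * RV m n j k).

(* The left A-module Gamma \otimes_A Gamma is free on the                       *)
(* theta_ij \otimes theta_kl; its elements are given by their coefficients.     *)
Definition Gamma2 := I4 -> A.
Definition Gamma2_in (rho : Gamma2) : TGamma :=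
  \sum_(a : I4) let '(i, j, k, l) := a in
    TGamma_in (rho a) * (TGamma_theta i j * TGamma_theta k l).
Definition sigma (rho : Gamma2) : Gamma2 :=
  fun b => \sum_a sigma_mx b a *: rho a.
Definition gmetric (rho : Gamma2) : A := \sum_a metric a *: rho a.

Inductive Cl_rel : TGamma -> Prop :=
  | Cl_rel_metric rho of sigma rho =1 rho :
      Cl_rel (Gamma2_in rho - TGamma_in (gmetric rho)).

Definition Cl : algebra K := quotAlg Cl_rel.
Definition Cl_in (a : A) : Cl := quot_proj Cl_rel (TGamma_in a).
Definition theta (i j : 'I_2) : Cl := quot_proj Cl_rel (TGamma_theta i j).

(* The algebra homomorphism Cl -> Cl \ox A extending Delta on A and             *)
(* theta_ij |-> theta_kl \ox u^k_i u^l_j, see [Cl_Delta_hom], [Cl_Delta_in] and *)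
(* [Cl_Delta_theta].                                                            *)
Definition Cl_Delta_free : F -> tensAlg Cl A :=
  falg_lift (fun a => tens_map Cl_in id (SLq_Delta a) : tensAlg Cl A)
    (fun ij : 'I_2 * 'I_2 =>
       \sum_k \sum_l apure (theta k l) (u k ij.1 * u l ij.2)).
Definition Cl_Delta_T : TGamma -> tensAlg Cl A :=
  @quot_lift K F TGamma_rel (tensAlg Cl A) Cl_Delta_free.
Definition Cl_Delta : Cl -> tensAlg Cl A :=
  @quot_lift K TGamma Cl_rel (tensAlg Cl A) Cl_Delta_T.

(* psi true i is psi^+_i, psi false i is psi^-_i *)
Definition psi (e : bool) (i : 'I_2) : Cl :=
  match e, val i with
  | true, 0%N => (q / ((q + q^-1) * c1)) *:
                 (theta 0 0 * theta 0 1 * theta 1 0 * theta 1 1)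
  | true, _ => theta 1 0 * theta 1 1
  | false, 0%N => theta 0 0 * theta 1 0 * theta 1 1
  | false, _ => q *: (theta 0 1 * theta 1 0 * theta 1 1)
  end.

End Clifford.

Section CliffordCoaction.
Variables (K : fieldType) (p nu0 c1 : K).
Hypothesis p0 : p != 0.

Let R := Rhat p.
Let RV := RhatV p.
Notation A := (SLq p).
Notation u := (@SLq_u K p).
Notation Cl := (Cl p nu0 c1).
Notation Cl_in := (@Cl_in K p nu0 c1).
Notation theta := (theta p nu0 c1).
Notation TGamma := (TGamma p nu0).
Notation TGamma_theta := (TGamma_theta p nu0).
Notation TGamma_in := (@TGamma_in K p nu0).

Lemma TGamma_in_hom : alg_hom TGamma_in.
Proof.
exact: (alg_hom_comp (@falg_cst_hom K A _) (quot_proj_hom (@TGamma_rel K p nu0))).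
Qed.
Lemma Cl_in_hom : alg_hom Cl_in.
Proof.
exact: (alg_hom_comp TGamma_in_hom (quot_proj_hom (@Cl_rel K p nu0 c1))).
Qed.

Lemma TGamma_comm i j k l : TGamma_theta i j * TGamma_in (u k l) =
  nu0 *: \sum_m \sum_r \sum_t \sum_s
     (R m r i t * RV t s j l) *: (TGamma_in (u k m) * TGamma_theta r s).
Proof.
have ph := quot_proj_hom (@TGamma_rel K p nu0).
have /(@quot_proj_eq0 _ _ (@TGamma_rel K p nu0)) := TGamma_rel_comm p nu0 i j k l.
rewrite (alg_homB ph) (alg_homM ph) (alg_homZ ph) => /eqP.
rewrite subr_eq0 => /eqP ->; congr (_ *: _).
rewrite (alg_hom_sum ph); apply: eq_bigr => m _.
rewrite (alg_hom_sum ph); apply: eq_bigr => r _.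
rewrite (alg_hom_sum ph); apply: eq_bigr => t _.
rewrite (alg_hom_sum ph); apply: eq_bigr => s _.
by rewrite (alg_homZ ph) (alg_homM ph).
Qed.

Lemma Cl_metric rho : sigma rho =1 rho ->
  quot_proj (@Cl_rel K p nu0 c1) (Gamma2_in nu0 rho) = Cl_in (gmetric c1 rho).
Proof.
have ph := quot_proj_hom (@Cl_rel K p nu0 c1).
move=> /(Cl_rel_metric nu0 c1)/(@quot_proj_eq0 _ _ (@Cl_rel K p nu0 c1)).
by rewrite (alg_homB ph) => /eqP; rewrite subr_eq0 => /eqP.
Qed.

Let W (a b : I4) : A :=
  let '(i, j, k, l) := a in let '(i', j', k', l') := b in
  u i i' * u j j' * u k k' * u l l'.

Definition commW (X : mat4 K) :=
  forall a c, \sum_b X a b *: W b c = \sum_b X b c *: W a b.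

Let commW_mul X Y : commW X -> commW Y -> commW (mul4 X Y).
Proof.
move=> hX hY a c; rewrite /mul4.
under eq_bigr do rewrite scaler_suml.
rewrite exchange_big /=.
under eq_bigr do under eq_bigr do rewrite -scalerA.
under eq_bigr do rewrite -scaler_sumr hY scaler_sumr.
rewrite exchange_big /=.
under eq_bigr do under eq_bigr do rewrite scalerA mulrC -scalerA.
under eq_bigr do rewrite -scaler_sumr hX scaler_sumr.
rewrite exchange_big /=; apply: eq_bigr => b _; rewrite scaler_suml.
by apply: eq_bigr => d _; rewrite scalerA mulrC.
Qed.

Let sumI4 (V : zmodType) (G : I4 -> V) :
  \sum_b G b = \sum_i \sum_j \sum_k \sum_l G (i, j, k, l).
Proof.
rewrite pair_bigA /= pair_bigA /= pair_bigA /=.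
by apply: eq_bigr => [[[[i j] k] l]] _.
Qed.

Definition RTTlike (X : 'I_2 -> 'I_2 -> 'I_2 -> 'I_2 -> K) := forall i j m n,
  \sum_k \sum_l X i j k l *: (u k m * u l n)
  = \sum_k \sum_l X k l m n *: (u i k * u j l).

Let RTT_R : RTTlike R.
Proof. by move=> i j m n; apply: SLq_RTT. Qed.
Let RTT_RV : RTTlike RV.
Proof.
move=> i j m n.
transitivity (p^-1 *: (u i m * u j n)
              + p *: (Cup p i j *: (Clow p m n *: (1 : A)))).
  rewrite -(SLq_Clow p0) -[u i m * u j n](sum2_delta i j (fun k l => u k m * u l n)).
  rewrite -!sum2Z -sum2D.
  by do 2![apply: eq_bigr => ? _]; rewrite /RV /RhatV scalerDl !scalerA -mulrA.
rewrite [Cup p i j *: _]scalerA [_ * Clow _ _ _]mulrC -scalerA -(SLq_Cup p0).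
rewrite -[u i m * u j n](sum2_delta m n (fun k l => u i k * u j l)).
rewrite -!sum2Z -sum2D; do 2![apply: eq_bigr => ? _].
rewrite /RV /RhatV [RHS]scalerDl !scalerA [m == _]eq_sym [n == _]eq_sym.
by rewrite -[p * _ * _]mulrA [Clow _ _ _ * _]mulrC.
Qed.

Let deltaR c k l (G : 'I_2 -> 'I_2 -> A) :
  \sum_x \sum_y (c * ((k == x)%:R * (l == y)%:R)) *: G x y = c *: G k l.
Proof.
rewrite -(sum2_delta k l G) -sum2Z.
by do 2![apply: eq_bigr => ? _]; rewrite scalerA.
Qed.
Let deltaL c k l (G : 'I_2 -> 'I_2 -> A) :
  \sum_x \sum_y (c * ((x == k)%:R * (y == l)%:R)) *: G x y = c *: G k l.
Proof.
rewrite -deltaR; do 2![apply: eq_bigr => ? _].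
by rewrite [k == _]eq_sym [l == _]eq_sym.
Qed.

Let pull (c : 'I_2 -> 'I_2 -> K) (G : 'I_2 -> 'I_2 -> A) a b :
  \sum_x \sum_y c x y *: (a * G x y * b) = a * (\sum_x \sum_y c x y *: G x y) * b.
Proof.
rewrite mulr_sumr mulr_suml; apply: eq_bigr => x _.
rewrite mulr_sumr mulr_suml; apply: eq_bigr => y _.
by rewrite -ascalerAr -ascalerAl.
Qed.

Let commW12 X : RTTlike X -> commW (leg12 X).
Proof.
move=> hX [[[i j] k] l] [[[i' j'] k'] l']; rewrite !sumI4 /=.
under eq_bigr do under eq_bigr do rewrite deltaR.
under [RHS]eq_bigr do under eq_bigr do rewrite deltaL.
have := congr1 (fun x => 1 * x * (u k k' * u l l')) (hX i j i' j').
by rewrite /= -!pull => H; etransitivity; [|etransitivity; [exact: H|]];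
   do 2![apply: eq_bigr => ? _]; rewrite !mul1r !mulrA.
Qed.

Let commW34 X : RTTlike X -> commW (leg34 X).
Proof.
move=> hX [[[i j] k] l] [[[i' j'] k'] l']; rewrite !sumI4 /=.
have swap (V : zmodType) (G : 'I_2 -> 'I_2 -> 'I_2 -> 'I_2 -> V) :
    \sum_x \sum_y \sum_z \sum_w G x y z w
    = \sum_z \sum_w \sum_x \sum_y G x y z w.
  under eq_bigr do rewrite exchange_big; rewrite exchange_big.
  apply: eq_bigr => z _; under eq_bigr do rewrite exchange_big.
  by rewrite exchange_big.
rewrite swap [RHS]swap.
under eq_bigr do under eq_bigr do rewrite deltaR.
under [RHS]eq_bigr do under eq_bigr do rewrite deltaL.
have := congr1 (fun x => (u i i' * u j j') * x * 1) (hX k l k' l').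
by rewrite /= -!pull => H; etransitivity; [|etransitivity; [exact: H|]];
   do 2![apply: eq_bigr => ? _]; rewrite !mulr1 !mulrA.
Qed.

Let commW23 X : RTTlike X -> commW (leg23 X).
Proof.
move=> hX [[[i j] k] l] [[[i' j'] k'] l']; rewrite !sumI4 /=.
have swap (V : zmodType) (G : 'I_2 -> 'I_2 -> 'I_2 -> 'I_2 -> V) :
    \sum_x \sum_y \sum_z \sum_w G x y z w
    = \sum_y \sum_z \sum_x \sum_w G x y z w.
  by rewrite exchange_big; apply: eq_bigr => y _; rewrite exchange_big.
rewrite swap [RHS]swap.
under eq_bigr do under eq_bigr do rewrite deltaR.
under [RHS]eq_bigr do under eq_bigr do rewrite deltaL.
have := congr1 (fun x => u i i' * x * u l l') (hX j k j' k').
by rewrite /= -!pull => H; etransitivity; [|etransitivity; [exact: H|]];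
   do 2![apply: eq_bigr => ? _]; rewrite !mulrA.
Qed.

Let commW_sigma : commW (sigma_mx p).
Proof.
by do ![apply: commW_mul]; [apply: commW23 | apply: commW12 | apply: commW34
  | apply: commW23].
Qed.

Let CC (a : I4) : K := let '(i, j, k, l) := a in Clow p i j * Clow p k l.

Let CC_W c : \sum_b CC b *: W b c = CC c *: (1 : A).
Proof.
case: c => [[[i j] k] l]; rewrite sumI4 /=.
have H x y : \sum_z \sum_w (Clow p x y * Clow p z w) *:
    (u x i * u y j * u z k * u w l)
  = (Clow p x y * Clow p k l) *: (u x i * u y j).
  transitivity (Clow p x y *: (u x i * u y j *
    (\sum_z \sum_w Clow p z w *: (u z k * u w l)) * 1)).
    rewrite -pull -sum2Z.
    by do 2![apply: eq_bigr => ? _]; rewrite scalerA mulr1 !mulrA.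
  by rewrite (SLq_Clow p0) mulr1 -ascalerAr mulr1 scalerA.
under eq_bigr do under eq_bigr do rewrite H mulrC -scalerA.
by rewrite sum2Z (SLq_Clow p0) scalerA mulrC.
Qed.

Let metricE c : metric p c1 c = - (p * c1) * \sum_b CC b * leg23 RV b c.
Proof.
case: c => [[[i j] k] l]; rewrite mulNr; congr (- (_ * _)).
rewrite sumI4 [RHS](bigD1 i) //= [X in _ + X]big1 ?addr0; last first.
  move=> x /negbTE xi; do 3![apply: big1 => ? _].
  by rewrite xi mul0r !mulr0.
apply: eq_bigr => m _; apply: eq_bigr => n _.
rewrite [RHS](bigD1 l) //= [X in _ + X]big1 ?addr0; last first.
  by move=> x /negbTE xl; rewrite xl !mulr0.
by rewrite !eqxx !mulr1.
Qed.

Let metric_W c : \sum_b metric p c1 b *: W b c = metric p c1 c *: (1 : A).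
Proof.
have leg := commW23 RTT_RV.
under eq_bigr do rewrite metricE -scalerA scaler_suml.
rewrite -scaler_sumr metricE -scalerA; congr (_ *: _).
rewrite exchange_big /=.
under eq_bigr do under eq_bigr do rewrite -scalerA.
under eq_bigr do rewrite -scaler_sumr leg scaler_sumr.
rewrite exchange_big /= scaler_suml; apply: eq_bigr => b _.
under eq_bigr do rewrite scalerA mulrC -scalerA.
by rewrite -scaler_sumr CC_W scalerA mulrC.
Qed.


(* sigma has scalar entries, so sigma-fixed coefficient families are            *)
(* combinations of scalar ones. *)
Lemma sigma_proj : exists P : mat4 K,
  (forall c a, \sum_b sigma_mx p a b * P c b = P c a) /\
  (forall rho : Gamma2 p, sigma rho =1 rho ->
     forall a, rho a = \sum_c P c a *: rho c).
Proof.
pose ev := @enum_val I4 predT; pose er := @enum_rank I4.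
pose S : 'M[K]_#|I4| := \matrix_(i, j)
  (sigma_mx p (enum_val j) (enum_val i) - (i == j)%:R).
pose M : 'M[K]_#|I4| := 1%:M - S *m pinvmx S.
have MS : M *m S = 0 by rewrite mulmxBl mul1mx mulmxKpV ?subrr.
have reidx (V : nmodType) (G : I4 -> V) :
  \sum_b G b = \sum_(i < #|I4|) G (enum_val i).
  by rewrite (reindex (@enum_val I4 predT)) //; exact/onW_bij/enum_val_bij.
exists (fun c a => M (er c) (er a)); split=> [c a | rho fix_rho a].
- have := congr1 (fun X : 'M_#|I4| => X (er c) (er a)) MS.
  rewrite [LHS]mxE [RHS]mxE; under eq_bigr do rewrite [S _ _]mxE mulrBr.
  rewrite sumrB => /eqP; rewrite subr_eq0 => /eqP.
  have -> : \sum_j M (er c) j * (j == er a)%:R = M (er c) (er a).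
    rewrite (bigD1 (er a)) //= eqxx mulr1 big1 ?addr0 // => j /negbTE ->.
    by rewrite mulr0.
  move=> <-; rewrite reidx; apply: eq_bigr => j _.
  by rewrite /er enum_rankK enum_valK mulrC.
- have rhoS j : \sum_i S i j *: rho (enum_val i) = 0.
    under eq_bigr do rewrite mxE scalerBl.
    rewrite sumrB; apply/eqP; rewrite subr_eq0; apply/eqP.
    rewrite -(reidx _ (fun b => sigma_mx p (enum_val j) b *: rho b)).
    rewrite [LHS]fix_rho (bigD1 j) //= eqxx scale1r big1 ?addr0 // => i /negbTE ->.
    by rewrite scale0r.
  rewrite reidx; under eq_bigr do rewrite /er enum_valK mxE scalerDl.
  rewrite big_split /=.
  have -> : \sum_i (1%:M : 'M[K]_#|I4|) i (enum_rank a) *: rho (enum_val i) = rho a.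
    rewrite (bigD1 (enum_rank a)) //= mxE eqxx scale1r enum_rankK.
    by rewrite big1 ?addr0 // => i /negbTE ia; rewrite mxE ia scale0r.
  rewrite -[LHS]addr0; congr (_ + _).
  under eq_bigr do rewrite mxE scaleNr mxE scaler_suml.
  rewrite sumrN exchange_big big1 ?oppr0 // => j _.
  under eq_bigr do rewrite mulrC -scalerA.
  by rewrite -scaler_sumr rhoS scaler0.
Qed.


Let Z := tensAlg Cl A.
Let D (a : A) : Z := tens_map Cl_in id (SLq_Delta a).
Let TH (i j : 'I_2) : Z := \sum_k \sum_l apure (theta k l) (u k i * u l j).

Let id_hom : alg_hom (id : A -> A). Proof. by []. Qed.
Let D_hom : alg_hom D.
Proof. exact: (alg_hom_comp (SLq_Delta_hom p0) (tens_map_hom Cl_in_hom id_hom)). Qed.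
Let D_u k l : D (u k l) = \sum_x apure (Cl_in (u k x)) (u x l).
Proof.
rewrite /D (SLq_Delta_u p0) (alg_hom_sum (tens_map_hom Cl_in_hom id_hom)).
apply: eq_bigr => x _; apply: tens_lift_pure; apply: tens_map_bilinear => //.
by case: Cl_in_hom.
Qed.

Definition I3 : finType := ('I_2 * 'I_2 * 'I_2)%type.
Let sumI3 (V : zmodType) (G : I3 -> V) :
  \sum_b G b = \sum_i \sum_j \sum_k G (i, j, k).
Proof.
by rewrite !pair_bigA /=; apply: eq_bigr => [[[i j] k]] _.
Qed.

Let N (w v : I3) : K :=
  let '(m, r, s) := w in let '(i, j, l) := v in
  \sum_t R m r i t * RV t s j l.
Let W3 (w v : I3) : A :=
  let '(m, r, s) := w in let '(i, j, l) := v in u m i * u r j * u s l.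

Let Cl_comm i j k l : theta i j * Cl_in (u k l) =
  nu0 *: \sum_(w : I3) N w (i, j, l) *:
    (Cl_in (u k w.1.1) * theta w.1.2 w.2).
Proof.
have ph := quot_proj_hom (@Cl_rel K p nu0 c1).
rewrite -(alg_homM ph) TGamma_comm (alg_homZ ph); congr (_ *: _).
rewrite sumI3 (alg_hom_sum ph); apply: eq_bigr => m _.
rewrite (alg_hom_sum ph); apply: eq_bigr => r _.
rewrite exchange_big (alg_hom_sum ph); apply: eq_bigr => s _.
rewrite (alg_hom_sum ph) /= scaler_suml; apply: eq_bigr => t _.
by rewrite (alg_homZ ph) (alg_homM ph).
Qed.

Let N_W3 w c : \sum_v N w v *: W3 v c = \sum_v N v c *: W3 w v.
Proof.
case: w => [[y c'] d]; case: c => [[i j] l]; rewrite !sumI3 /=.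
have ex3 (G : 'I_2 -> 'I_2 -> 'I_2 -> 'I_2 -> A) :
    \sum_m \sum_r \sum_s \sum_t G m r s t = \sum_t \sum_s \sum_m \sum_r G m r s t.
  under eq_bigr do under eq_bigr do rewrite exchange_big.
  under eq_bigr do rewrite exchange_big.
  rewrite exchange_big; apply: eq_bigr => t _.
  under eq_bigr do rewrite exchange_big.
  by rewrite exchange_big.
have lhsE : \sum_a \sum_x \sum_z (\sum_t R y c' a t * RV t d x z) *:
    (u a i * u x j * u z l)
  = \sum_a \sum_b R y c' a b *:
      (u a i * (\sum_x \sum_z RV b d x z *: (u x j * u z l)) * 1).
  apply: eq_bigr => a _; under eq_bigr do under eq_bigr do rewrite scaler_suml.
  under eq_bigr do rewrite exchange_big.
  rewrite exchange_big; apply: eq_bigr => b _.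
  rewrite -pull -sum2Z; do 2![apply: eq_bigr => ? _].
  by rewrite scalerA mulr1 mulrA.
have rhsE : \sum_m \sum_r \sum_s (\sum_t R m r i t * RV t s j l) *:
    (u y m * u c' r * u d s)
  = \sum_t \sum_s RV t s j l *:
      (1 * (\sum_m \sum_r R m r i t *: (u y m * u c' r)) * u d s).
  under eq_bigr do under eq_bigr do under eq_bigr do rewrite scaler_suml.
  rewrite ex3; do 2![apply: eq_bigr => ? _].
  rewrite -pull -sum2Z; do 2![apply: eq_bigr => ? _].
  by rewrite scalerA mul1r mulrC.
have ex4 (G : 'I_2 -> 'I_2 -> 'I_2 -> 'I_2 -> A) :
    \sum_m \sum_r \sum_s \sum_t G m r s t = \sum_s \sum_t \sum_m \sum_r G m r s t.
  rewrite -ex3; apply: eq_bigr => m _; apply: eq_bigr => r _.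
  by rewrite exchange_big.
rewrite lhsE rhsE; under eq_bigr do under eq_bigr do rewrite RTT_RV.
under [RHS]eq_bigr do under eq_bigr do rewrite -RTT_R.
under eq_bigr do under eq_bigr do rewrite -pull -sum2Z.
under [RHS]eq_bigr do under eq_bigr do rewrite -pull -sum2Z.
rewrite ex4; do 4![apply: eq_bigr => ? _].
by rewrite !scalerA [RV _ _ _ _ * _]mulrC mul1r mulr1 !mulrA.
Qed.

Let free_hom : alg_hom (@Cl_Delta_free K p nu0 c1).
Proof. exact: falg_lift_hom D_hom. Qed.

Let TH_comm i j k l : TH i j * D (u k l) = nu0 *:
  \sum_(w : I3) N w (i, j, l) *: (D (u k w.1.1) * TH w.1.2 w.2).
Proof.
pose E (w : I3) : Cl := Cl_in (u k w.1.1) * theta w.1.2 w.2.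
transitivity (\sum_(v : I3) apure (theta v.1.1 v.1.2 * Cl_in (u k v.2)) (W3 v (i, j, l))).
  rewrite sumI3 D_u mulr_suml; apply: eq_bigr => a _.
  rewrite mulr_suml; apply: eq_bigr => b _.
  by rewrite mulr_sumr; apply: eq_bigr => x _; rewrite apureM.
have DT w : D (u k w.1.1) * TH w.1.2 w.2 = \sum_v apure (E v) (W3 v w).
  case: w => [[m r] s] /=; rewrite sumI3 D_u mulr_suml; apply: eq_bigr => a _.
  rewrite mulr_sumr; apply: eq_bigr => b _.
  by rewrite mulr_sumr; apply: eq_bigr => x _; rewrite apureM /= !mulrA.
under [in RHS]eq_bigr do rewrite DT scaler_sumr.
rewrite exchange_big /=.
under [in RHS]eq_bigr do under eq_bigr do rewrite -apureZr.
under [in RHS]eq_bigr do rewrite -apure_sumr -N_W3 apure_sumr.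
rewrite exchange_big /= scaler_sumr; apply: eq_bigr => v _.
rewrite Cl_comm apureZl apure_suml; congr (_ *: _).
apply: eq_bigr => w _; rewrite apureZr apureZl; congr (N _ _ *: _).
by case: v => [[? ?] ?].
Qed.

Let free_in a : Cl_Delta_free nu0 c1 (falg_cst ('I_2 * 'I_2) a) = D a.
Proof. exact: falg_lift_cst D_hom a. Qed.
Let free_th i j : Cl_Delta_free nu0 c1 (falg_gen A (i, j)) = TH i j.
Proof. exact: falg_lift_gen D_hom (i, j). Qed.

Let free_rel x : @TGamma_rel K p nu0 x -> @Cl_Delta_free K p nu0 c1 x = 0.
Proof.
case=> i j k l; have fh := free_hom.
rewrite (alg_homB fh) (alg_homM fh) (alg_homZ fh) free_in free_th TH_comm.
rewrite -scalerBr; apply/eqP; rewrite scaler_eq0 subr_eq0; apply/orP; right.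
apply/eqP; rewrite sumI3 (alg_hom_sum fh); apply: eq_bigr => m _.
rewrite (alg_hom_sum fh); apply: eq_bigr => r _.
rewrite exchange_big (alg_hom_sum fh); apply: eq_bigr => s _.
rewrite (alg_hom_sum fh) /= scaler_suml; apply: eq_bigr => t _.
by rewrite (alg_homZ fh) (alg_homM fh) free_in free_th.
Qed.

Let T_hom : alg_hom (@Cl_Delta_T K p nu0 c1).
Proof. exact: quot_lift_hom free_hom free_rel. Qed.
Let T_in a : @Cl_Delta_T K p nu0 c1 (TGamma_in a) = D a.
Proof. by rewrite [LHS](quot_lift_proj free_hom free_rel) free_in. Qed.
Let T_th i j : @Cl_Delta_T K p nu0 c1 (TGamma_theta i j) = TH i j.
Proof. by rewrite [LHS](quot_lift_proj free_hom free_rel) free_th. Qed.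

Let E2 (a : I4) : Cl := let '(i, j, k, l) := a in theta i j * theta k l.

Let T_Gamma2 rho :
  @Cl_Delta_T K p nu0 c1 (Gamma2_in nu0 rho) = \sum_a D (rho a) * \sum_b apure (E2 b) (W b a).
Proof.
rewrite (alg_hom_sum T_hom); apply: eq_bigr => [[[[i j] k] l]] _.
rewrite !(alg_homM T_hom) T_in !T_th; congr (_ * _).
rewrite sumI4 mulr_suml; apply: eq_bigr => a _.
rewrite mulr_suml; apply: eq_bigr => b _.
rewrite mulr_sumr; apply: eq_bigr => c _.
by rewrite mulr_sumr; apply: eq_bigr => d _; rewrite apureM !mulrA.
Qed.

Let T_rel x : @Cl_rel K p nu0 c1 x -> @Cl_Delta_T K p nu0 c1 x = 0.
Proof.
case=> rho fix_rho; have [P [P_fix P_span]] := sigma_proj.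
rewrite (alg_homB T_hom) T_Gamma2 T_in; apply/eqP; rewrite subr_eq0; apply/eqP.
have ch := Cl_in_hom.
have scal c : \sum_b P c b *: E2 b = (\sum_b P c b * metric p c1 b) *: (1 : Cl).
  have := @Cl_metric (fun b => P c b *: (1 : A)).
  rewrite /Gamma2_in /gmetric => H.
  have ph := quot_proj_hom (@Cl_rel K p nu0 c1).
  have -> : \sum_b P c b *: E2 b = quot_proj (@Cl_rel K p nu0 c1)
    (Gamma2_in nu0 (fun b => P c b *: (1 : A))).
    rewrite (alg_hom_sum ph); apply: eq_bigr => [[[[i j] k] l]] _.
    rewrite (alg_homZ TGamma_in_hom) (alg_hom1 TGamma_in_hom) -ascalerAl mul1r.
    by rewrite (alg_homZ ph) (alg_homM ph).
  rewrite H; last first.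
    move=> b; rewrite /sigma; under eq_bigr do rewrite scalerA.
    by rewrite -scaler_suml P_fix.
  rewrite (alg_hom_sum ch) scaler_suml; apply: eq_bigr => b _.
  by rewrite !(alg_homZ ch) (alg_hom1 ch) scalerA mulrC.
pose Y c b : A := \sum_a P c a *: W b a.
have Y_fix c : sigma (Y c) =1 Y c.
  move=> e; rewrite /sigma /Y; under eq_bigr do rewrite scaler_sumr.
  rewrite exchange_big /=.
  under eq_bigr do under eq_bigr do rewrite scalerA mulrC -scalerA.
  under eq_bigr do rewrite -scaler_sumr commW_sigma scaler_sumr.
  rewrite exchange_big /=; apply: eq_bigr => b _.
  under eq_bigr do rewrite scalerA mulrC.
  by rewrite -scaler_suml P_fix.
have Y_metric c : \sum_b apure (E2 b) (Y c b)
    = (\sum_a P c a * metric p c1 a) *: (1 : Z).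
  under eq_bigr do rewrite (P_span _ (Y_fix c)) apure_sumr.
  rewrite exchange_big /=.
  under eq_bigr do under eq_bigr do rewrite apureZr -apureZl.
  under eq_bigr do rewrite -apure_suml scal apureZl -apureZr.
  rewrite -apure_sumr -[_ *: (1 : Z)]apureZr; congr (apure _ _).
  transitivity (\sum_b metric p c1 b *: Y c b).
    under [RHS]eq_bigr do rewrite (P_span _ (Y_fix c)) scaler_sumr.
    rewrite [RHS]exchange_big; apply: eq_bigr => d _.
    by rewrite scaler_suml; apply: eq_bigr => b _; rewrite scalerA mulrC.
  rewrite /Y; under [LHS]eq_bigr do rewrite scaler_sumr.
  rewrite exchange_big scaler_suml; apply: eq_bigr => a _ /=.
  under eq_bigr do rewrite scalerA mulrC -scalerA.
  by rewrite -scaler_sumr metric_W scalerA.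
transitivity (\sum_c D (rho c) * \sum_b apure (E2 b) (Y c b)).
  under eq_bigr do rewrite (P_span _ fix_rho) (alg_hom_sum D_hom) mulr_suml.
  rewrite exchange_big; apply: eq_bigr => c _ /=.
  under eq_bigr do rewrite (alg_homZ D_hom) -ascalerAl ascalerAr.
  rewrite -mulr_sumr; congr (_ * _).
  under [LHS]eq_bigr do rewrite scaler_sumr.
  rewrite exchange_big; apply: eq_bigr => b _ /=.
  by rewrite apure_sumr; apply: eq_bigr => a _; rewrite apureZr.
under eq_bigr do rewrite Y_metric -ascalerAr mulr1 scaler_suml.
rewrite exchange_big (alg_hom_sum D_hom); apply: eq_bigr => a _ /=.
rewrite (alg_homZ D_hom) (P_span _ fix_rho a) (alg_hom_sum D_hom) scaler_sumr.
by apply: eq_bigr => c _; rewrite (alg_homZ D_hom) scalerA mulrC.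
Qed.

Lemma Cl_Delta_hom : alg_hom (@Cl_Delta K p nu0 c1).
Proof. exact: quot_lift_hom T_hom T_rel. Qed.
Lemma Cl_Delta_in (a : A) :
  Cl_Delta (Cl_in a) = tens_map Cl_in id (SLq_Delta a).
Proof. by rewrite [LHS](quot_lift_proj T_hom T_rel) T_in. Qed.
Lemma Cl_Delta_theta i j :
  Cl_Delta (theta i j) = \sum_k \sum_l apure (theta k l) (u k i * u l j).
Proof. by rewrite [LHS](quot_lift_proj T_hom T_rel) T_th. Qed.

End CliffordCoaction.

Section RightCoaction.
Variables (K : comNzRingType) (H : algebra K).
Variables (D : H -> tensAlg H H) (e : H -> base_alg K).

Definition right_coaction (V : lmodType K) (d : V -> tensor V H) :=
  [/\ linear d,
      forall v, tens_assoc (tens_map d id (d v)) = tens_map id D (d v) &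
      forall v, tens_lift (fun (w : V) (h : H) => (e h : K) *: w) (d v) = v].

End RightCoaction.

Section Spinors.
Variables (K : fieldType) (p nu0 c1 : K).
Notation A := (SLq p).
Notation u := (@SLq_u K p).
Notation Cl := (Cl p nu0 c1).
Notation Cl_in := (@Cl_in K p nu0 c1).
Notation psi := (psi p nu0 c1).

(* The left ideal of Cl generated by the psi^+-_i *)
Inductive in_S0 : Cl -> Prop :=
  | in_S0_psi e i : in_S0 (psi e i)
  | in_S0_zero : in_S0 0
  | in_S0_add x y of in_S0 x & in_S0 y : in_S0 (x + y)
  | in_S0_mul c x of in_S0 x : in_S0 (c * x).

Definition S0_pred : {pred Cl} := fun x => `[< in_S0 x >].

Lemma S0P x : reflect (in_S0 x) (x \in S0_pred).
Proof. exact: asboolP. Qed.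

Fact S0_submod_closed : submod_closed S0_pred.
Proof.
split=> [|k x y /S0P xS /S0P yS]; apply/S0P; first exact: in_S0_zero.
apply: in_S0_add => //; rewrite -[x]mul1r ascalerAl; exact: in_S0_mul.
Qed.
HB.instance Definition _ := GRing.isSubmodClosed.Build K Cl S0_pred
  S0_submod_closed.

Record S0 : Type := MkS0 { S0_val : Cl; _ : S0_val \in S0_pred }.
HB.instance Definition _ := [isSub for S0_val].
HB.instance Definition _ := [Choice of S0 by <:].
HB.instance Definition _ := [SubChoice_isSubLmodule of S0 by <:].

Lemma S0_valP (s : S0) : in_S0 (val s).
Proof. by apply/S0P; exact: (valP s). Qed.

Definition S0_psi (e : bool) (i : 'I_2) : S0 :=
  MkS0 (introT (S0P _) (in_S0_psi e i)).

Definition S0_lmul (x : Cl) (s : S0) : S0 :=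
  MkS0 (introT (S0P _) (in_S0_mul x (S0_valP s))).

(* Spanning and independence over A, as unique left A-coordinates. *)
Definition S0_basis := forall s : S0,
  exists! a : {ffun bool * 'I_2 -> A},
    s = \sum_(ei : bool * 'I_2) S0_lmul (Cl_in (a ei)) (S0_psi ei.1 ei.2).

Definition S0_right_invariant :=
  forall x (a : A), in_S0 x -> in_S0 (x * Cl_in a).

Definition S0_rmul (inv : S0_right_invariant) (s : S0) (a : A) : S0 :=
  MkS0 (introT (S0P _) (inv _ a (S0_valP s))).

End Spinors.

(* Main.v *)
Require Import Defs.
From mathcomp Require Import all_boot all_order all_algebra.
From mathcomp Require Import reals.
From mathcomp Require Import complex.
From mathcomp Require Import boolp ring.

Import Order.TTheory GRing.Theory Num.Theory.
Local Open Scope ring_scope.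
Local Open Scope complex_scope.

(** Indices are numbered 1, 2 in the comments and 0, 1 in the code; an index in
    an exponent of q stands for 0 or 1.  [p] is the square root of q.

    The module of spinors is free over A = O(SL_q(2)) on the four psi, so
    [Delta_R] is forced on it: the sum of the a psi^e_i must go to the sum of
    the Delta(a) Delta'(psi^e_i).  With this definition linearity and
    compatibility with left multiplication by A are immediate, and
    coassociativity and counitality reduce to the same properties of Delta on
    A and of Delta' on the psi.  The two substantial points are compatibility
    with left multiplication by the theta_ij and with right multiplication by A.

    Left multiplication.  The sigma-invariant tensors that define the Clifford
    algebra are the images under R_23 of Sym (x) Sym and of C (x) C, where Sym
    is the p-eigenspace of R and C the invariant tensor ([Cl_braided_theta]).
    The metric vanishes on the former and is a nonzero constant on the latter,
    which gives the ten rules for putting products of two theta in normal order.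
    They show that
      theta_ij psi^e_k = a_e C_ij psi^(-e)_k + b_e C_jk psi^(-e)_i
    with scalars a_e and b_e ([theta_psi]).  Both terms are built from the
    invariant form C, for which C_kl u^k_m u^l_n = C_mn, so the action of the
    theta_ij intertwines the coactions ([S0_Delta_theta_psi]).  Products of theta
    and elements of A follow because A moves past the theta at the cost of
    coefficients in A ([theta_in_span]).

    Right multiplication.  The normal order also yields
      psi^+_j u^k_m = p^-1 q^m R^ab_jm u^k_a psi^+_b
    ([psi_even_u]).  Up to the factor q^m this is the form for which the
    relations R u u = u u R make the coaction compatible with the right action,
    and conjugation by the group-like chi, chi u^c_m = q^(m-c) u^c_m chi,
    absorbs that factor ([S0_Delta_psi_even_rmul]).  This suffices: the odd
    psi^-_i are multiples of theta_1i psi^+_2, and left and right multiplication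
    commute, so the case of left multiplication carries compatibility from the
    psi^+_i to every spinor; from the u^k_m it extends to A multiplicatively
    ([S0_Delta_rmul]). *)

Set Implicit Arguments.
Unset Strict Implicit.
Unset Printing Implicit Defensive.

(** * Linear and bilinear maps between tensor products *)

Section LinearMaps.
Variables (K : comNzRingType) (V W : lmodType K) (f : V -> W).
Hypothesis f_lin : linear f.

Lemma linear_add x y : f (x + y) = f x + f y.
Proof. by have := f_lin 1 x y; rewrite !scale1r. Qed.
Lemma linear_zero : f 0 = 0.
Proof. by apply: (addIr (f 0)); rewrite -linear_add !add0r. Qed.
Lemma linear_scal k x : f (k *: x) = k *: f x.
Proof. by have := f_lin k x 0; rewrite linear_zero !addr0. Qed.
Lemma linear_big I (r : seq I) (F : I -> V) :
  f (\sum_(i <- r) F i) = \sum_(i <- r) f (F i).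
Proof. exact: (big_morph f linear_add linear_zero). Qed.

End LinearMaps.

Lemma alg_hom_linear (K : comNzRingType) (A B : algebra K) (f : A -> B) :
  alg_hom f -> linear f.
Proof. by case. Qed.

Lemma id_linear (K : comNzRingType) (V : lmodType K) : linear (id : V -> V).
Proof. by []. Qed.

Section PureSums.
Variables (K : comNzRingType) (V W : lmodType K) (I : Type) (r : seq I).

Lemma pure_suml (F : I -> V) (w : W) :
  (\sum_(i <- r) F i) \ox w = \sum_(i <- r) F i \ox w.
Proof.
by apply: (@linear_big _ _ _ (fun v => v \ox w)) => k x y;
   rewrite pureDl pureZl.
Qed.
Lemma pure_sumr (v : V) (F : I -> W) :
  v \ox (\sum_(i <- r) F i) = \sum_(i <- r) v \ox F i.
Proof.
by apply: (@linear_big _ _ _ (fun w => v \ox w)) => k x y;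
   rewrite pureDr pureZr.
Qed.

End PureSums.

Section TensorFunctor.
Variables (K : comNzRingType) (V W V' W' : lmodType K).
Variables (f : V -> W) (g : V' -> W').
Hypotheses (f_lin : linear f) (g_lin : linear g).

Lemma tens_map_pure v v' : tens_map f g (v \ox v') = f v \ox g v'.
Proof. exact: tens_lift_pure (tens_map_bilinear f_lin g_lin) _ _. Qed.
Lemma tens_map_linear : linear (tens_map f g).
Proof. exact: tens_lift_linear (tens_map_bilinear f_lin g_lin). Qed.

End TensorFunctor.

Section TensorAssociator.
Variables (K : comNzRingType) (U V W : lmodType K).

Let inner w :
  bilinear_map (fun (u : U) (v : V) => u \ox (v \ox w : tensor V W)).
Proof.
by split=> [v k x y | u k x y];
   rewrite ?(pureDl, pureZl) // ?(pureDr, pureZr).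
Qed.

Let outer : bilinear_map (fun (t : tensor U V) (w : W) =>
  tens_lift (fun u v => u \ox (v \ox w : tensor V W)) t).
Proof.
split=> [w | t k x y]; first exact: tens_lift_linear (inner w).
move: t; apply: tens_eq => [||u v].
- exact: tens_lift_linear (inner _).
- by apply: linear_sumP; apply: tens_lift_linear; exact: inner.
- by rewrite !(tens_lift_pure (inner _)) !(pureDr, pureZr).
Qed.

Lemma tens_assoc_pure (u : U) (v : V) (w : W) :
  tens_assoc ((u \ox v) \ox w) = u \ox (v \ox w).
Proof. by rewrite /tens_assoc (tens_lift_pure outer) (tens_lift_pure (inner w)). Qed.
Lemma tens_assoc_linear : linear (@tens_assoc K U V W).
Proof. exact: tens_lift_linear outer. Qed.

End TensorAssociator.

Section BilinearMaps.
Variables (K : comNzRingType) (V W Z V' W' Z' : lmodType K).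
Variables (f : V -> W -> Z) (g : V' -> W' -> Z').
Hypotheses (f_bil : bilinear_map f) (g_bil : bilinear_map g).
Let b := tens_mul2_bilinear f_bil g_bil.

Lemma tens_mul2Dl x y z :
  tens_mul2 f g (x + y) z = tens_mul2 f g x z + tens_mul2 f g y z.
Proof. exact: (linear_add (b.1 z)). Qed.
Lemma tens_mul2Dr x y z :
  tens_mul2 f g x (y + z) = tens_mul2 f g x y + tens_mul2 f g x z.
Proof. exact: (linear_add (b.2 x)). Qed.

End BilinearMaps.

Section TensorProductOfProducts.
Variables (K : comNzRingType).

(** Module axioms pass to tensor products: with suitable choices of the four
    products this is associativity of an action of a tensor product of algebras,
    or the commutation of a left action with a right one. *)
Lemma tens_mul2A (X Y Z XY YZ T X' Y' Z' XY' YZ' T' : lmodType K)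
    (a : X -> Y -> XY) (b : XY -> Z -> T) (c : Y -> Z -> YZ) (d : X -> YZ -> T)
    (a' : X' -> Y' -> XY') (b' : XY' -> Z' -> T')
    (c' : Y' -> Z' -> YZ') (d' : X' -> YZ' -> T') :
  bilinear_map a -> bilinear_map b -> bilinear_map c -> bilinear_map d ->
  bilinear_map a' -> bilinear_map b' -> bilinear_map c' -> bilinear_map d' ->
  (forall x y z, b (a x y) z = d x (c y z)) ->
  (forall x y z, b' (a' x y) z = d' x (c' y z)) ->
  forall x y z, tens_mul2 b b' (tens_mul2 a a' x y) z =
                tens_mul2 d d' x (tens_mul2 c c' y z).
Proof.
move=> ba bb bc bd ba' bb' bc' bd' H H' x y z.
elim/tens_ind: x => [x x'|x1 x2 H1 H2].
  elim/tens_ind: y => [y y'|y1 y2 H1 H2].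
    elim/tens_ind: z => [z z'|z1 z2 H1 H2].
      by rewrite !tens_mul2_pure // H H'.
    by rewrite !tens_mul2Dr // H1 H2.
  by rewrite tens_mul2Dr // !tens_mul2Dl // tens_mul2Dr // H1 H2.
by rewrite !tens_mul2Dl // H1 H2.
Qed.

(** Lets a map that respects products, such as a coaction or a coproduct, be
    applied to each leg of an action on a tensor product. *)
Lemma tens_map_mul2 (X Y Z X1 Y1 Z1 X' Y' Z' X1' Y1' Z1' : lmodType K)
    (m : X -> Y -> Z) (m1 : X1 -> Y1 -> Z1)
    (m' : X' -> Y' -> Z') (m1' : X1' -> Y1' -> Z1')
    (f : X -> X1) (g : Y -> Y1) (h : Z -> Z1)
    (f' : X' -> X1') (g' : Y' -> Y1') (h' : Z' -> Z1') :
  bilinear_map m -> bilinear_map m1 -> bilinear_map m' -> bilinear_map m1' ->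
  linear f -> linear g -> linear h -> linear f' -> linear g' -> linear h' ->
  (forall x y, h (m x y) = m1 (f x) (g y)) ->
  (forall x y, h' (m' x y) = m1' (f' x) (g' y)) ->
  forall x y, tens_map h h' (tens_mul2 m m' x y) =
              tens_mul2 m1 m1' (tens_map f f' x) (tens_map g g' y).
Proof.
move=> bm bm1 bm' bm1' lf lg lh lf' lg' lh' H H' x y.
have mf := tens_map_linear lf lf'; have mg := tens_map_linear lg lg'.
have mh := tens_map_linear lh lh'.
elim/tens_ind: x => [x x'|x1 x2 H1 H2].
  elim/tens_ind: y => [y y'|y1 y2 H1 H2].
    by rewrite !(tens_mul2_pure, tens_map_pure) // H H'.
  by rewrite tens_mul2Dr // (linear_add mh) (linear_add mg) tens_mul2Dr // H1 H2.
by rewrite tens_mul2Dl // (linear_add mh) (linear_add mf) tens_mul2Dl // H1 H2.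
Qed.

(** With the m equal to multiplications this says that reassociating tensors is
    an algebra homomorphism; with an action as m, that it respects actions. *)
Lemma tens_assoc_mul2 (X Y Z X' Y' Z' X'' Y'' Z'' : lmodType K)
    (m : X -> Y -> Z) (m' : X' -> Y' -> Z') (m'' : X'' -> Y'' -> Z'') :
  bilinear_map m -> bilinear_map m' -> bilinear_map m'' ->
  forall x y, tens_assoc (tens_mul2 (tens_mul2 m m') m'' x y) =
              tens_mul2 m (tens_mul2 m' m'') (tens_assoc x) (tens_assoc y).
Proof.
move=> bm bm' bm'' x y.
have la U V W := @tens_assoc_linear K U V W.
have [b1 b2] := (tens_mul2_bilinear bm bm', tens_mul2_bilinear bm' bm'').
elim/tens_ind: x => [t x''|x1 x2 H1 H2]; last first.
  by rewrite tens_mul2Dl // !(linear_add (la _ _ _)) tens_mul2Dl // H1 H2.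
elim/tens_ind: y => [s y''|y1 y2 H1 H2]; last first.
  by rewrite tens_mul2Dr // !(linear_add (la _ _ _)) tens_mul2Dr // H1 H2.
elim/tens_ind: t => [x x'|x1 x2 H1 H2]; last first.
  by rewrite pureDl tens_mul2Dl // !(linear_add (la _ _ _)) tens_mul2Dl // H1 H2.
elim/tens_ind: s => [y y'|y1 y2 H1 H2]; last first.
  by rewrite pureDl tens_mul2Dr // !(linear_add (la _ _ _)) tens_mul2Dr // H1 H2.
by rewrite !(tens_mul2_pure, tens_assoc_pure).
Qed.

Lemma counit_bilinear (H : algebra K) (e : H -> base_alg K) (V : lmodType K) :
  linear e -> bilinear_map (fun (v : V) (h : H) => (e h : K) *: v).
Proof.
move=> e_lin; split=> [h k x y | v k x y].
  by rewrite scalerDr !scalerA mulrC.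
by rewrite e_lin scalerDl scalerA.
Qed.

Lemma tens_counit_mul2 (H : algebra K) (e : H -> base_alg K)
    (X Y Z : lmodType K) (m : X -> Y -> Z) :
  alg_hom e -> bilinear_map m ->
  forall x y, tens_lift (fun (v : Z) (h : H) => (e h : K) *: v)
      (tens_mul2 m (fun h h' : H => h * h') x y) =
    m (tens_lift (fun (v : X) (h : H) => (e h : K) *: v) x)
      (tens_lift (fun (v : Y) (h : H) => (e h : K) *: v) y).
Proof.
move=> e_hom bm x y; have be V := @counit_bilinear H e V (alg_hom_linear e_hom).
have le V := tens_lift_linear (be V); have bH := mul_bilinear H.
elim/tens_ind: x => [x h|x1 x2 H1 H2].
  elim/tens_ind: y => [y h'|y1 y2 H1 H2].
    rewrite tens_mul2_pure // !(tens_lift_pure (be _)) (alg_homM e_hom).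
    by rewrite (linear_scal (bm.1 _)) (linear_scal (bm.2 _)) scalerA.
  rewrite tens_mul2Dr // !(linear_add (le _)) H1 H2.
  by rewrite (linear_add (bm.2 _)).
rewrite tens_mul2Dl // !(linear_add (le _)) H1 H2.
by rewrite (linear_add (bm.1 _)).
Qed.

End TensorProductOfProducts.

(** * Sums over indices *)

Lemma sum_I2 (V : nmodType) (F : 'I_2 -> V) : \sum_i F i = F 0 + F 1.
Proof.
by rewrite big_ord_recl big_ord1; congr (_ + F _); apply: val_inj.
Qed.

Lemma I2_cases (P : 'I_2 -> Prop) : P 0 -> P 1 -> forall i, P i.
Proof.
move=> P0 P1 [[|[|//]] lt_i]; [have -> : Ordinal lt_i = 0 by exact: val_inj |
  have -> : Ordinal lt_i = 1 by exact: val_inj]; by [].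
Qed.

Lemma sum_I4 (V : nmodType) (G : I4 -> V) :
  \sum_b G b = \sum_i \sum_j \sum_k \sum_l G (i, j, k, l).
Proof.
by rewrite !pair_bigA; apply: eq_bigr => [[[[i j] k] l]] _.
Qed.

Lemma exchange2 (V : nmodType) (F : 'I_2 -> 'I_2 -> 'I_2 -> 'I_2 -> V) :
  \sum_i \sum_j \sum_k \sum_l F i j k l = \sum_k \sum_l \sum_i \sum_j F i j k l.
Proof.
under eq_bigr do rewrite exchange_big; rewrite exchange_big.
apply: eq_bigr => k _; under eq_bigr do rewrite exchange_big.
by rewrite exchange_big.
Qed.

(** * Invariant tensors of the braiding *)

Section CliffordRelations.
Variables (K : fieldType) (p nu0 c1 : K).
Hypothesis p0 : p != 0.
Notation R := (Rhat p).
Notation RV := (RhatV p).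
Notation theta := (theta p nu0 c1).
Notation Cl := (Cl p nu0 c1).
Implicit Types f g : 'I_2 -> 'I_2 -> K.

Lemma RhatVK i j k l :
  \sum_a \sum_b RV i j a b * R a b k l = (i == k)%:R * (j == l)%:R.
Proof.
elim/I2_cases: i; elim/I2_cases: j; elim/I2_cases: k; elim/I2_cases: l;
by rewrite !sum_I2 /Rhat /RhatV /Clow /Cup /=; field.
Qed.

Let app (X : mat4 K) (s : I4 -> K) : I4 -> K := fun b => \sum_a X b a * s a.

Let app_mul X Y s b : app (mul4 X Y) s b = app X (app Y s) b.
Proof.
rewrite /app /mul4; under eq_bigr do rewrite mulr_suml.
rewrite exchange_big; apply: eq_bigr => a _ /=.
by rewrite mulr_sumr; apply: eq_bigr => c _; rewrite mulrA.
Qed.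

Let app_leg12 X s i j k l :
  app (leg12 X) s (i, j, k, l) = \sum_x \sum_y X i j x y * s (x, y, k, l).
Proof.
rewrite /app sum_I4; elim/I2_cases: k; elim/I2_cases: l;
by rewrite !sum_I2 /= !(mulr1, mul1r, mulr0, mul0r, addr0, add0r).
Qed.
Let app_leg23 X s i j k l :
  app (leg23 X) s (i, j, k, l) = \sum_x \sum_y X j k x y * s (i, x, y, l).
Proof.
rewrite /app sum_I4; elim/I2_cases: i; elim/I2_cases: l;
by rewrite !sum_I2 /= !(mulr1, mul1r, mulr0, mul0r, addr0, add0r).
Qed.
Let app_leg34 X s i j k l :
  app (leg34 X) s (i, j, k, l) = \sum_x \sum_y X k l x y * s (i, j, x, y).
Proof.
rewrite /app sum_I4; elim/I2_cases: i; elim/I2_cases: j;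
by rewrite !sum_I2 /= !(mulr1, mul1r, mulr0, mul0r, addr0, add0r).
Qed.

Let eq_app X s t : s =1 t -> app X s =1 app X t.
Proof. by move=> st b; apply: eq_bigr => a _; rewrite st. Qed.

(** The tensor R_23 (f (x) g). *)
Definition middle_braid f g : I4 -> K := fun '(i, j, k, l) =>
  \sum_x \sum_y R j k x y * (f i x * g y l).

(** As sigma = R_23 R_12 R_34^-1 R_23^-1, conjugation by R_23 turns it into
    R_12 R_34^-1, whose eigenvectors are the f (x) g with f and g eigenvectors
    of R and of R^-1. *)
Lemma sigma_middle_braid f g (lam mu : K) :
  lam * mu = 1 ->
  (forall i j, \sum_x \sum_y R i j x y * f x y = lam * f i j) ->
  (forall i j, \sum_x \sum_y RV i j x y * g x y = mu * g i j) ->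
  forall b, \sum_a sigma_mx p b a * middle_braid f g a = middle_braid f g b.
Proof.
move=> lm1 Rf RVg b; rewrite -[LHS]/(app _ _ b) /sigma_mx !app_mul.
pose s : I4 -> K := fun '(i, j, k, l) => f i j * g k l.
have mbE : middle_braid f g =1 app (leg23 R) s.
  by move=> [[[i j] k] l]; rewrite app_leg23.
have fixE : app (leg12 R) (app (leg34 RV) (app (leg23 RV) (middle_braid f g))) =1 s.
  have legK : app (leg23 RV) (middle_braid f g) =1 s.
    move=> [[[i j] k] l]; rewrite (eq_app _ mbE) app_leg23.
    under eq_bigr do under eq_bigr do rewrite app_leg23.
    have := RhatVK j k; rewrite !sum_I2 => H.
    transitivity (\sum_x \sum_y ((j == x)%:R * (k == y)%:R) * s (i, x, y, l)).
      rewrite !sum_I2; rewrite -!H !sum_I2; ring.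
    elim/I2_cases: j {H}; elim/I2_cases: k;
    by rewrite !sum_I2 /= !(mulr1, mul1r, mulr0, mul0r, addr0, add0r).
  have leg34s : app (leg34 RV) (app (leg23 RV) (middle_braid f g)) =1
      (fun a => mu * s a).
    move=> [[[i j] k] l]; rewrite (eq_app _ legK) app_leg34 /s.
    rewrite mulrCA -RVg !sum_I2; ring.
  move=> [[[i j] k] l]; rewrite (eq_app _ leg34s) app_leg12 /s.
  transitivity (mu * g k l * (lam * f i j)); first by rewrite -Rf !sum_I2; ring.
  by rewrite -[RHS]mul1r -lm1; ring.
by rewrite (eq_app _ fixE) mbE.
Qed.

Definition Cpairing f : K := \sum_i \sum_j Clow p i j * f i j.

(** The inverse braiding in the metric cancels R_23, so that only the two
    evaluations of the invariant form remain. *)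
Lemma metric_middle_braid f g :
  \sum_a metric p c1 a * middle_braid f g a = - (p * c1 * Cpairing f * Cpairing g).
Proof.
rewrite sum_I4 /metric /middle_braid.
transitivity (- (p * c1) * \sum_i \sum_l \sum_m \sum_n Clow p i m * Clow p n l *
   \sum_x \sum_y (\sum_a \sum_b RV m n a b * R a b x y) * (f i x * g y l)).
  by rewrite !sum_I2; ring.
under eq_bigr do under eq_bigr do under eq_bigr do under eq_bigr do
  under eq_bigr do under eq_bigr do rewrite RhatVK.
rewrite !sum_I2 /= /Cpairing !sum_I2; ring.
Qed.

Lemma Cl_middle_braid f g (lam mu : K) :
  lam * mu = 1 ->
  (forall i j, \sum_x \sum_y R i j x y * f x y = lam * f i j) ->
  (forall i j, \sum_x \sum_y RV i j x y * g x y = mu * g i j) ->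
  \sum_i \sum_j \sum_k \sum_l
    middle_braid f g (i, j, k, l) *: (theta i j * theta k l) =
  - (p * c1 * Cpairing f * Cpairing g) *: (1 : Cl).
Proof.
move=> lm1 Rf RVg; pose rho : Gamma2 p := fun a => middle_braid f g a *: (1 : SLq p).
have ph := quot_proj_hom (@Cl_rel K p nu0 c1).
have ih := TGamma_in_hom p nu0.
have fix_rho : sigma rho =1 rho.
  move=> b; rewrite /sigma /rho -(sigma_middle_braid lm1 Rf RVg b) scaler_suml.
  by apply: eq_bigr => a _; rewrite scalerA.
have := Cl_metric nu0 c1 fix_rho.
rewrite /gmetric /rho; under [in RHS]eq_bigr do rewrite scalerA.
rewrite -scaler_suml metric_middle_braid (alg_homZ (Cl_in_hom p nu0 c1)).
rewrite (alg_hom1 (Cl_in_hom p nu0 c1)) => <-.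
rewrite (alg_hom_sum ph) sum_I4.
do 4![apply: eq_bigr => ? _].
rewrite (alg_homM ph) (alg_homM ph) -[quot_proj _ (TGamma_in _ _)]/(Cl_in _ _ _).
by rewrite (alg_homZ (Cl_in_hom p nu0 c1)) (alg_hom1 (Cl_in_hom p nu0 c1))
  -ascalerAl mul1r.
Qed.

End CliffordRelations.

(** * Normal ordering of products of generators *)

Section CliffordNormalOrder.
Variables (K : fieldType) (p nu0 c1 : K).
Hypothesis p0 : p != 0.
Notation R := (Rhat p).
Notation RV := (RhatV p).
Notation t := (theta p nu0 c1).
Notation Cl := (Cl p nu0 c1).
Notation q := (p ^+ 2).
Notation qhat := (p ^+ 2 - (p ^+ 2)^-1).
Notation qtwo := (p ^+ 2 + (p ^+ 2)^-1).

(** Regrouping the Clifford relations by these products keeps every instance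
    below down to at most four nonzero terms. *)
Definition braided_theta i j k l : Cl :=
  \sum_x \sum_y R x y j k *: (t i x * t y l).

Lemma Cl_braided_theta (f g : 'I_2 -> 'I_2 -> K) (lam mu : K) :
  lam * mu = 1 ->
  (forall i j, \sum_x \sum_y R i j x y * f x y = lam * f i j) ->
  (forall i j, \sum_x \sum_y RV i j x y * g x y = mu * g i j) ->
  \sum_i \sum_l \sum_x \sum_y (f i x * g y l) *: braided_theta i x y l =
  - (p * c1 * Cpairing p f * Cpairing p g) *: (1 : Cl).
Proof.
move=> lm1 Rf RVg; rewrite -(Cl_middle_braid nu0 c1 p0 lm1 Rf RVg).
apply: eq_bigr => i _; under [RHS]eq_bigr do rewrite exchange_big.
rewrite [RHS]exchange_big; apply: eq_bigr => l _ /=.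
under [RHS]eq_bigr do under eq_bigr do rewrite scaler_suml.
under [RHS]eq_bigr do under eq_bigr do under eq_bigr do rewrite scaler_suml.
rewrite [RHS]exchange2; do 2![apply: eq_bigr => ? _].
rewrite scaler_sumr; apply: eq_bigr => ? _; rewrite scaler_sumr.
by apply: eq_bigr => ? _; rewrite scalerA mulrC.
Qed.

Lemma braided_theta00 i l : braided_theta i 0 0 l = p *: (t i 0 * t 0 l).
Proof.
rewrite /braided_theta !sum_I2 /Rhat /Clow /Cup /=.
by rewrite !(mulr1, mul1r, mulr0, mul0r, addr0, add0r, subrr, oppr0, scale0r).
Qed.
Lemma braided_theta11 i l : braided_theta i 1 1 l = p *: (t i 1 * t 1 l).
Proof.
rewrite /braided_theta !sum_I2 /Rhat /Clow /Cup /=.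
by rewrite !(mulr1, mul1r, mulr0, mul0r, addr0, add0r, subrr, oppr0, scale0r).
Qed.
Lemma braided_theta10 i l : braided_theta i 1 0 l = p^-1 *: (t i 0 * t 1 l).
Proof.
rewrite /braided_theta !sum_I2 /Rhat /Clow /Cup /=.
rewrite !(mulr1, mul1r, mulr0, mul0r, addr0, add0r, subr0, sub0r, oppr0, scale0r).
rewrite -[RHS]addr0 -[in RHS](scale0r (t i 1 * t 0 l)).
by congr (_ *: _ + _ *: _); field.
Qed.
Lemma braided_theta01 i l :
  braided_theta i 0 1 l = (p^-1 * qhat) *: (t i 0 * t 1 l) + p^-1 *: (t i 1 * t 0 l).
Proof.
rewrite /braided_theta !sum_I2 /Rhat /Clow /Cup /=.
rewrite !(mulr1, mul1r, mulr0, mul0r, addr0, add0r, subr0, sub0r, oppr0, scale0r).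
by congr (_ *: _ + _ *: _); field.
Qed.

(** The general eigenvector of R for the eigenvalue p:
    x e_1 e_1 + y (e_1 e_2 + q^-1 e_2 e_1) + z e_2 e_2. *)
Definition qsym (x y z : K) (i j : 'I_2) : K :=
  if i == 0 then if j == 0 then x else y else if j == 0 then q^-1 * y else z.

Lemma Rhat_qsym x y z i j :
  \sum_a \sum_b R i j a b * qsym x y z a b = p * qsym x y z i j.
Proof.
elim/I2_cases: i; elim/I2_cases: j;
by rewrite !sum_I2 /qsym /Rhat /Clow /Cup /=; field.
Qed.
Lemma RhatV_qsym x y z i j :
  \sum_a \sum_b RV i j a b * qsym x y z a b = p^-1 * qsym x y z i j.
Proof.
elim/I2_cases: i; elim/I2_cases: j;
by rewrite !sum_I2 /qsym /RhatV /Clow /Cup /=; field.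
Qed.
Lemma Cpairing_qsym x y z : Cpairing p (qsym x y z) = 0.
Proof. by rewrite /Cpairing !sum_I2 /qsym /Clow /Cup /=; field. Qed.

Lemma Cl_qsym x y z x' y' z' :
  \sum_i \sum_l \sum_a \sum_b
    (qsym x y z i a * qsym x' y' z' b l) *: braided_theta i a b l = 0.
Proof.
rewrite (Cl_braided_theta (mulfV p0) (Rhat_qsym _ _ _) (RhatV_qsym _ _ _)).
by rewrite Cpairing_qsym mulr0 mul0r oppr0 scale0r.
Qed.

Let p2 : q != 0. Proof. by rewrite expf_neq0. Qed.

Let thetaE := (braided_theta00, braided_theta11, braided_theta10, braided_theta01).
Let simpE := (mulr1, mul1r, mulr0, mul0r, scale0r, scale1r, addr0, add0r).

Let pV0 : p^-1 != 0. Proof. by rewrite invr_eq0. Qed.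

Lemma theta_sq00 : t 0 0 * t 0 0 = 0.
Proof.
have := Cl_qsym 1 0 0 1 0 0; rewrite !sum_I2 /qsym /= !simpE thetaE => /eqP.
by rewrite scaler_eq0 (negbTE p0) => /eqP.
Qed.
Lemma theta_sq11 : t 1 1 * t 1 1 = 0.
Proof.
have := Cl_qsym 0 0 1 0 0 1; rewrite !sum_I2 /qsym /= !simpE thetaE => /eqP.
by rewrite scaler_eq0 (negbTE p0) => /eqP.
Qed.
Lemma theta_sq10 : t 1 0 * t 1 0 = 0.
Proof.
have := Cl_qsym 0 0 1 1 0 0; rewrite !sum_I2 /qsym /= !simpE thetaE => /eqP.
by rewrite scaler_eq0 (negbTE pV0) => /eqP.
Qed.
Lemma theta_sq01 : t 0 1 * t 0 1 = - qhat *: (t 0 0 * t 1 1).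
Proof.
have := Cl_qsym 1 0 0 0 0 1; rewrite !sum_I2 /qsym /= !simpE !thetaE.
rewrite -scalerA -scalerDr => /eqP; rewrite scaler_eq0 (negbTE pV0) addrC addr_eq0.
by rewrite -scaleNr => /eqP.
Qed.

Let solve2 (V : lmodType K) (a b : K) (x y : V) :
  b != 0 -> a *: x + b *: y = 0 -> y = - (a / b) *: x.
Proof.
move=> b0 /(congr1 (fun v => b^-1 *: v)).
rewrite scaler0 scalerDr !scalerA mulVf // scale1r => /eqP.
by rewrite addrC addr_eq0 -scaleNr mulrC => /eqP.
Qed.
Let solve3 (V : lmodType K) (a b c : K) (x y z : V) :
  c != 0 -> a *: x + b *: y + c *: z = 0 -> z = - (a / c) *: x - (b / c) *: y.
Proof.
move=> c0 /(congr1 (fun v => c^-1 *: v)).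
rewrite scaler0 !scalerDr !scalerA mulVf // scale1r => /eqP.
by rewrite addrC addr_eq0 opprD -!scaleNr ![c^-1 * _]mulrC => /eqP.
Qed.

Lemma theta_01_00 :
  t 0 1 * t 0 0 = - q ^+ 2 *: (t 0 0 * t 0 1) - qhat *: (t 0 0 * t 1 0).
Proof.
have := Cl_qsym 1 0 0 0 1 0; rewrite !sum_I2 /qsym /= !simpE !thetaE.
rewrite scalerDr !scalerA addrC addrA => /solve3 ->; last by rewrite mulf_neq0 ?invr_eq0 ?p2.
by congr (- _ *: _ - _ *: _); field; rewrite p0 oner_neq0.
Qed.
Lemma theta_11_01 :
  t 1 1 * t 0 1 = - q ^+ 2 *: (t 0 1 * t 1 1) - qhat *: (t 1 0 * t 1 1).
Proof.
have := Cl_qsym 0 1 0 0 0 1; rewrite !sum_I2 /qsym /= !simpE !thetaE.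
rewrite scalerDr !scalerA addrA => /solve3 ->; last by rewrite mulf_neq0 ?invr_eq0.
by congr (- _ *: _ - _ *: _); field; rewrite p0 ?oner_neq0.
Qed.
Lemma theta_10_00 : t 1 0 * t 0 0 = - (t 0 0 * t 1 0).
Proof.
have := Cl_qsym 0 1 0 1 0 0; rewrite !sum_I2 /qsym /= !simpE !thetaE.
rewrite !scalerA => /solve2 ->; last by rewrite mulf_neq0 ?invr_eq0.
by rewrite -[RHS]scaleN1r; congr (_ *: _); field; rewrite p0 ?oner_neq0.
Qed.
Lemma theta_11_10 : t 1 1 * t 1 0 = - (t 1 0 * t 1 1).
Proof.
have := Cl_qsym 0 0 1 0 1 0; rewrite !sum_I2 /qsym /= !simpE !thetaE.
rewrite addrC !scalerA => /solve2 ->; last by rewrite mulf_neq0 ?invr_eq0.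
by rewrite -[RHS]scaleN1r; congr (_ *: _); field; rewrite p0 ?oner_neq0.
Qed.

Hypothesis qtwo0 : qtwo != 0.

(* The sums theta_11 theta_22 + theta_22 theta_11 and theta_12 theta_21 +
   theta_21 theta_12 are found by eliminating between the symmetric relation
   and the only inhomogeneous one, which comes from C (x) C. *)
Let sym_relation :
  t 0 0 * t 1 1 + (t 0 1 * t 1 0 + t 1 0 * t 0 1) = - q ^- 2 *: (t 1 1 * t 0 0).
Proof.
have := Cl_qsym 0 1 0 0 1 0; rewrite !sum_I2 /qsym /= !simpE !thetaE.
rewrite theta_sq10 scaler0 add0r !scalerA.
move=> /(congr1 (fun x => p *: x)); rewrite scaler0 !scalerDr !scalerA.
rewrite (_ : p * (p ^- 2 * p) = 1); last by field.
rewrite (_ : p * (p ^- 2 / q / p) = q ^- 2); last by field.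
rewrite mulfV // !scale1r scaleNr => H; apply/eqP; rewrite -addr_eq0 -H.
by rewrite addrA [_ + t 0 1 * _]addrC -!addrA [_ *: _ + _]addrC.
Qed.

Let Cup_relation :
  q ^- 2 *: (t 0 0 * t 1 1) + t 1 1 * t 0 0 =
  t 0 1 * t 1 0 + t 1 0 * t 0 1 - (c1 * qtwo ^+ 2) *: (1 : Cl).
Proof.
have RC i j : \sum_x \sum_y R i j x y * Cup p x y = - p ^- 3 * Cup p i j.
  elim/I2_cases: i; elim/I2_cases: j;
  by rewrite !sum_I2 /Rhat /Clow /Cup /=; field.
have RVC i j : \sum_x \sum_y RV i j x y * Cup p x y = - p ^+ 3 * Cup p i j.
  elim/I2_cases: i; elim/I2_cases: j;
  by rewrite !sum_I2 /RhatV /Clow /Cup /=; field.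
have lm : - p ^- 3 * - p ^+ 3 = 1 :> K by field.
have := Cl_braided_theta lm RC RVC.
have -> : Cpairing p (Cup p) = - qtwo.
  by rewrite /Cpairing !sum_I2 /Clow /Cup /=; field.
rewrite !sum_I2 /Cup /= !(simpE, subr0, sub0r, oppr0, thetaE).
rewrite theta_sq10 scaler0 add0r !scalerA.
move=> /(congr1 (fun x => p^-1 *: x)); rewrite !scalerDr !scalerA.
rewrite (_ : p^-1 * (p^-1 * - p * p) = -1); last by field.
rewrite (_ : p^-1 * (- p / p * p) = -1); last by field.
rewrite (_ : p^-1 * (- p * - p / p) = 1); last by field.
rewrite (_ : p^-1 * (p^-1 / p / p) = q ^- 2); last by field.
rewrite (_ : p^-1 * - (p * c1 * - qtwo * - qtwo) = - (c1 * qtwo ^+ 2)); last first.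
  by field.
rewrite !scaleN1r scale1r scaleNr => <-.
by rewrite !addrA [RHS](ACl ((1*3)*(2*6)*4*5)) /= !subrr !add0r.
Qed.

Let mixed_sum :
  t 0 1 * t 1 0 + t 1 0 * t 0 1 = - q ^- 2 *: (t 1 1 * t 0 0) - t 0 0 * t 1 1.
Proof. by rewrite -sym_relation [RHS]addrC addKr. Qed.

Lemma theta_11_00 :
  t 1 1 * t 0 0 = - (q * c1 * qtwo) *: (1 : Cl) - t 0 0 * t 1 1.
Proof.
have H : (q^-1 * qtwo) *: (t 1 1 * t 0 0 + t 0 0 * t 1 1) =
    - (c1 * qtwo ^+ 2) *: (1 : Cl).
  have -> : q^-1 * qtwo = 1 + q ^- 2 by field.
  rewrite scalerDr !scalerDl !scale1r addrA [LHS](ACl (4*1*2*3)) /= Cup_relation.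
  rewrite mixed_sum scaleNr [LHS](ACl (3*(1*4)*(2*5))) /= addNr addNr.
  by rewrite addr0 addr0 scaleNr.
apply/eqP; rewrite -subr_eq opprK; apply/eqP.
have nz : q^-1 * qtwo != 0 by rewrite mulf_neq0 ?invr_eq0.
by apply: (scalerI nz); rewrite H scalerA; congr (_ *: _); field; rewrite p0.
Qed.

Lemma theta_10_01 :
  t 1 0 * t 0 1 = (q^-1 * c1 * qtwo) *: (1 : Cl)
                  - (q^-1 * qhat) *: (t 0 0 * t 1 1) - t 0 1 * t 1 0.
Proof.
apply/eqP; rewrite -subr_eq opprK [t 1 0 * _ + _]addrC mixed_sum theta_11_00.
apply/eqP; rewrite scalerBr scalerA -addrA; congr (_ *: _ + _); first by field.
rewrite -scaleNr -[X in _ - X]scale1r -scalerBl -scaleNr; congr (_ *: _).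
by field.
Qed.

End CliffordNormalOrder.

(** * Clifford multiplication on spinors *)

Section SpinorAction.
Variables (K : fieldType) (p nu0 c1 : K).
Hypotheses (p0 : p != 0) (c10 : c1 != 0).
Notation t := (theta p nu0 c1).
Notation Cl := (Cl p nu0 c1).
Notation psi := (psi p nu0 c1).
Notation q := (p ^+ 2).
Notation qhat := (p ^+ 2 - (p ^+ 2)^-1).
Notation qtwo := (p ^+ 2 + (p ^+ 2)^-1).
Hypothesis qtwo0 : qtwo != 0.

Let v : Cl := t 1 0 * t 1 1.

Lemma theta10_v : t 1 0 * v = 0.
Proof. by rewrite mulrA theta_sq10 // mul0r. Qed.
Lemma theta11_v : t 1 1 * v = 0.
Proof. by rewrite mulrA theta_11_10 // mulNr -mulrA theta_sq11 // mulr0 oppr0. Qed.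

Let N := c1 * qtwo.

Lemma theta00_00v : t 0 0 * (t 0 0 * v) = 0.
Proof. by rewrite mulrA theta_sq00 // mul0r. Qed.
Lemma theta01_00v : t 0 1 * (t 0 0 * v) = - q ^+ 2 *: (t 0 0 * (t 0 1 * v)).
Proof.
rewrite mulrA theta_01_00 // mulrBl -!ascalerAl -!mulrA theta10_v.
by rewrite mulr0 scaler0 subr0.
Qed.
Lemma theta10_00v : t 1 0 * (t 0 0 * v) = 0.
Proof. by rewrite mulrA theta_10_00 // mulNr -mulrA theta10_v mulr0 oppr0. Qed.
Lemma theta11_00v : t 1 1 * (t 0 0 * v) = - (q * N) *: v.
Proof.
rewrite mulrA theta_11_00 // mulrBl -!ascalerAl -!mulrA theta11_v mulr0 subr0.
by rewrite mul1r.
Qed.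

Lemma theta01_01v : t 0 1 * (t 0 1 * v) = 0.
Proof.
by rewrite mulrA theta_sq01 // -!ascalerAl -mulrA theta11_v mulr0 scaler0.
Qed.
Lemma theta10_01v : t 1 0 * (t 0 1 * v) = (q^-1 * N) *: v.
Proof.
rewrite mulrA theta_10_01 // !mulrBl -!ascalerAl -!mulrA theta11_v theta10_v.
by rewrite !mulr0 scaler0 !subr0 mul1r.
Qed.
Lemma theta11_01v : t 1 1 * (t 0 1 * v) = 0.
Proof.
rewrite mulrA theta_11_01 // mulrBl -!ascalerAl -!mulrA theta11_v.
by rewrite mulr0 mulr0 !scaler0 subr0.
Qed.

Lemma theta00_0001v : t 0 0 * (t 0 0 * (t 0 1 * v)) = 0.
Proof. by rewrite mulrA theta_sq00 // mul0r. Qed.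
Lemma theta01_0001v :
  t 0 1 * (t 0 0 * (t 0 1 * v)) = - (q^-1 * qhat * N) *: (t 0 0 * v).
Proof.
rewrite mulrA theta_01_00 // mulrBl -!ascalerAl -!mulrA theta01_01v theta10_01v.
by rewrite mulr0 scaler0 sub0r -ascalerAr scalerA scaleNr mulrCA mulrA.
Qed.
Lemma theta10_0001v :
  t 1 0 * (t 0 0 * (t 0 1 * v)) = - (q^-1 * N) *: (t 0 0 * v).
Proof.
rewrite mulrA theta_10_00 // mulNr -mulrA theta10_01v.
by rewrite -ascalerAr scaleNr.
Qed.
Lemma theta11_0001v :
  t 1 1 * (t 0 0 * (t 0 1 * v)) = - (q * N) *: (t 0 1 * v).
Proof.
rewrite mulrA theta_11_00 // mulrBl -!ascalerAl -!mulrA theta11_01v mulr0 subr0.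
by rewrite mul1r.
Qed.

(** Invariance leaves only the two contractions C_ij psi_k and C_jk psi_i; these
    are their coefficients on psi^+ ([e = true]) and on psi^-. *)
Definition gamma_outer (e : bool) : K := if e then - p^-1 else 0.
Definition gamma_inner (e : bool) : K := if e then - p else - (p * N).

Lemma psi_even0 : psi true 0 = (q / N) *: (t 0 0 * (t 0 1 * v)).
Proof. by rewrite /psi /= /qpar !mulrA [N in RHS]mulrC. Qed.
Lemma psi_even1 : psi true 1 = v. Proof. by []. Qed.
Lemma psi_odd0 : psi false 0 = t 0 0 * v. Proof. by rewrite mulrA. Qed.
Lemma psi_odd1 : psi false 1 = q *: (t 0 1 * v). Proof. by rewrite mulrA. Qed.

Let N0 : N != 0. Proof. by rewrite mulf_neq0. Qed.

Lemma theta_psi i j e k : t i j * psi e k =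
  (gamma_outer e * Clow p i j) *: psi (~~ e) k +
  (gamma_inner e * Clow p j k) *: psi (~~ e) i.
Proof.
case: e; rewrite /negb /gamma_outer /gamma_inner;
elim/I2_cases: k; rewrite ?(psi_even0, psi_even1, psi_odd0, psi_odd1);
elim/I2_cases: i; elim/I2_cases: j;
rewrite ?(psi_even0, psi_even1, psi_odd0, psi_odd1) -?ascalerAr;
rewrite ?(theta10_v, theta11_v, theta00_00v, theta01_00v, theta10_00v, theta11_00v,
  theta01_01v, theta10_01v, theta11_01v, theta00_0001v, theta01_0001v,
  theta10_0001v, theta11_0001v);
rewrite /Clow /Cup /= !(mulr1, mulr0, mul0r, subr0, sub0r, oppr0, scale0r,
  scaler0, addr0, add0r, scalerA) //.
all: rewrite -?scalerDl.
all: rewrite -[LHS]scale1r ?scalerA ?scaler0.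
all: try by congr (_ *: _); field; rewrite ?p0 ?N0 ?oner_neq0.
by rewrite -[LHS](scale0r (t 0 1 * v)); congr (_ *: _); field; rewrite p0.
Qed.

(** * Right multiplication on even spinors *)

Notation u := (@SLq_u K p).
Notation A := (SLq p).
Notation inA := (@Cl_in K p nu0 c1).
Notation R := (Rhat p).
Notation RV := (RhatV p).

Lemma Cl_theta_comm i j k l : t i j * inA (u k l) =
  nu0 *: \sum_m \sum_r \sum_n \sum_s
     (R m r i n * RV n s j l) *: (inA (u k m) * t r s).
Proof.
have ph := quot_proj_hom (@Cl_rel K p nu0 c1).
rewrite -[LHS](alg_homM ph) TGamma_comm (alg_homZ ph); congr (_ *: _).
do 4![rewrite (alg_hom_sum ph); apply: eq_bigr => ? _].
by rewrite (alg_homZ ph) (alg_homM ph).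
Qed.

Let simpE := (mulr1, mul1r, mulr0, mul0r, subr0, sub0r, oppr0, scale0r, addr0, add0r).

Let RE : ((R 0 0 0 0 = p) * (R 1 1 1 1 = p) * (R 0 1 0 1 = p^-1 * qhat)%R *
  (R 0 1 1 0 = p^-1) * (R 1 0 0 1 = p^-1) * (R 1 0 1 0 = 0))%type.
Proof. by do !split; rewrite /Rhat /Clow /Cup /=; field. Qed.
Let RVE : ((RV 0 0 0 0 = p^-1) * (RV 1 1 1 1 = p^-1) * (RV 0 1 0 1 = 0) *
  (RV 0 1 1 0 = p) * (RV 1 0 0 1 = p) * (RV 1 0 1 0 = - p * qhat)%R)%type.
Proof. by do !split; rewrite /RhatV /Clow /Cup /=; field. Qed.
(* R and its inverse conserve the number of indices equal to 2. *)
Let R0 (i j k l : 'I_2) : (i + j)%N != (k + l)%N -> R i j k l = 0.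
Proof.
elim/I2_cases: i; elim/I2_cases: j; elim/I2_cases: k; elim/I2_cases: l => // _;
by rewrite /Rhat /Clow /Cup /= !simpE.
Qed.
Let RV0 (i j k l : 'I_2) : (i + j)%N != (k + l)%N -> RV i j k l = 0.
Proof.
elim/I2_cases: i; elim/I2_cases: j; elim/I2_cases: k; elim/I2_cases: l => // _;
by rewrite /RhatV /Clow /Cup /= !simpE.
Qed.

Lemma theta11_u0 k : t 1 1 * inA (u k 0) =
  nu0 *: (inA (u k 0) * t 1 1 - (q * qhat) *: (inA (u k 1) * t 1 0)).
Proof.
rewrite Cl_theta_comm !sum_I2 !RE !RVE.
do ![rewrite R0 //]; do ![rewrite RV0 //]; rewrite !simpE -scaleNr.
rewrite -[inA (u k 0) * _ in RHS]scale1r.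
by congr (_ *: (_ *: _ + _ *: _)); field.
Qed.
Lemma theta11_u1 k : t 1 1 * inA (u k 1) = nu0 *: (inA (u k 1) * t 1 1).
Proof.
rewrite Cl_theta_comm !sum_I2 !RE !RVE.
do ![rewrite R0 //]; do ![rewrite RV0 //]; rewrite !simpE.
by rewrite mulfV // scale1r.
Qed.
Lemma theta10_u0 k :
  t 1 0 * inA (u k 0) = nu0 *: (q^-1 *: (inA (u k 0) * t 1 0)).
Proof.
rewrite Cl_theta_comm !sum_I2 !RE !RVE.
do ![rewrite R0 //]; do ![rewrite RV0 //]; rewrite !simpE.
by congr (_ *: (_ *: _)); field.
Qed.
Lemma theta10_u1 k : t 1 0 * inA (u k 1) = nu0 *: (q *: (inA (u k 1) * t 1 0)).
Proof.
rewrite Cl_theta_comm !sum_I2 !RE !RVE.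
do ![rewrite R0 //]; do ![rewrite RV0 //]; rewrite !simpE.
by congr (_ *: (_ *: _)); field.
Qed.
Lemma theta01_u0 k : t 0 1 * inA (u k 0) =
  nu0 *: (q *: (inA (u k 0) * t 0 1) - qhat ^+ 2 *: (inA (u k 0) * t 1 0)
          - qhat *: (inA (u k 1) * t 0 0)).
Proof.
rewrite Cl_theta_comm !sum_I2 !RE !RVE.
do ![rewrite R0 //]; do ![rewrite RV0 //]; rewrite !simpE.
by rewrite -!scaleNr; congr (_ *: (_ *: _ + _ *: _ + _ *: _)); field.
Qed.
Lemma theta01_u1 k : t 0 1 * inA (u k 1) =
  nu0 *: ((q^-1 * qhat) *: (inA (u k 0) * t 1 1) + q^-1 *: (inA (u k 1) * t 0 1)).
Proof.
rewrite Cl_theta_comm !sum_I2 !RE !RVE.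
do ![rewrite R0 //]; do ![rewrite RV0 //]; rewrite !simpE.
by congr (_ *: (_ *: _ + _ *: _)); field.
Qed.
Lemma theta00_u0 k : t 0 0 * inA (u k 0) = nu0 *: (inA (u k 0) * t 0 0).
Proof.
rewrite Cl_theta_comm !sum_I2 !RE !RVE.
do ![rewrite R0 //]; do ![rewrite RV0 //]; rewrite !simpE.
by rewrite mulfV // scale1r.
Qed.
Lemma theta00_u1 k : t 0 0 * inA (u k 1) =
  nu0 *: (qhat *: (inA (u k 0) * t 1 0) + inA (u k 1) * t 0 0).
Proof.
rewrite Cl_theta_comm !sum_I2 !RE !RVE.
do ![rewrite R0 //]; do ![rewrite RV0 //]; rewrite !simpE.
rewrite -[inA (u k 1) * _ in RHS]scale1r.
by congr (_ *: (_ *: _ + _ *: _)); field.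
Qed.

Hypothesis nu_sq : nu0 ^+ 2 = 1.

Let nu_nu (V : lmodType K) (x : V) : nu0 *: (nu0 *: x) = x.
Proof. by rewrite scalerA -expr2 nu_sq scale1r. Qed.

Lemma psi_even1_u0 k : v * inA (u k 0) = q^-1 *: (inA (u k 0) * v).
Proof.
rewrite -mulrA theta11_u0 -ascalerAr mulrBr -ascalerAr !mulrA theta10_u0 theta10_u1.
rewrite -!ascalerAl -!mulrA theta_sq10 // mulr0 !scaler0 subr0.
by rewrite nu_nu.
Qed.
Lemma psi_even1_u1 k : v * inA (u k 1) = q *: (inA (u k 1) * v).
Proof.
by rewrite -mulrA theta11_u1 -ascalerAr !mulrA theta10_u1 -!ascalerAl nu_nu -mulrA.
Qed.

Let t01v_u0 k : t 0 1 * v * inA (u k 0) =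
  nu0 *: (inA (u k 0) * (t 0 1 * v) - (q^-1 * qhat) *: (inA (u k 1) * (t 0 0 * v))).
Proof.
rewrite -mulrA psi_even1_u0 -ascalerAr mulrA theta01_u0 -ascalerAl !mulrBl -!ascalerAl.
rewrite -!mulrA theta10_v mulr0 scaler0 subr0 !scalerA.
rewrite !scalerBr !scalerA.
by congr (_ *: _ - _ *: _); field.
Qed.
Let t01v_u1 k : t 0 1 * v * inA (u k 1) = nu0 *: (inA (u k 1) * (t 0 1 * v)).
Proof.
rewrite -mulrA psi_even1_u1 -ascalerAr mulrA theta01_u1 -ascalerAl mulrDl -!ascalerAl.
rewrite -!mulrA theta11_v mulr0 scaler0 add0r !scalerA.
by congr (_ *: _); field.
Qed.
Let t0001v_u0 k : t 0 0 * (t 0 1 * v) * inA (u k 0) =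
  inA (u k 0) * (t 0 0 * (t 0 1 * v)).
Proof.
rewrite -mulrA t01v_u0 -ascalerAr mulrBr -ascalerAr !(mulrA (t 0 0) (inA _)).
rewrite theta00_u0 theta00_u1 -!ascalerAl mulrDl -!ascalerAl -!mulrA.
rewrite theta10_00v theta00_00v !(mulr0, scaler0, addr0, subr0).
by rewrite nu_nu.
Qed.
Let t0001v_u1 k : t 0 0 * (t 0 1 * v) * inA (u k 1) =
  (q^-1 * qhat * N) *: (inA (u k 0) * v) + inA (u k 1) * (t 0 0 * (t 0 1 * v)).
Proof.
rewrite -mulrA t01v_u1 -ascalerAr [t 0 0 * _]mulrA theta00_u1 -ascalerAl mulrDl nu_nu.
rewrite -ascalerAl -!mulrA theta10_01v -ascalerAr scalerA.
by congr (_ *: _ + _); field.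
Qed.

(** Moving u^k_m to the left past two or four theta produces many products of
    theta; normal ordering kills or collapses them, and of all the braidings only
    one copy of R survives. *)
Lemma psi_even_u j k m : psi true j * inA (u k m) =
  \sum_a \sum_b (p^-1 * q ^+ m * R a b j m) *: (inA (u k a) * psi true b).
Proof.
elim/I2_cases: j; elim/I2_cases: m; rewrite !sum_I2 !RE; do ![rewrite R0 //];
rewrite !(mulr0, scale0r, addr0, add0r) ?psi_even0 ?psi_even1.
- rewrite -ascalerAl t0001v_u0 -!ascalerAr scalerA; congr (_ *: _).
  by field; rewrite p0 N0.
- rewrite -ascalerAl t0001v_u1 scalerDr -!ascalerAr !scalerA.
  by congr (_ *: _ + _ *: _); field; rewrite p0 N0.
- by rewrite psi_even1_u0; congr (_ *: _); field.
- by rewrite psi_even1_u1; congr (_ *: _); field.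
Qed.

End SpinorAction.

(** * Generators of O(SL_q(2)) and of the Clifford algebra *)

Section Generation.
Variables (K : fieldType) (p nu0 c1 : K).
Notation A := (SLq p).
Notation u := (@SLq_u K p).
Notation Cl := (Cl p nu0 c1).
Notation inCl := (@Cl_in K p nu0 c1).
Notation t := (theta p nu0 c1).

Lemma SLq_ind (Q : A -> Prop) :
  (forall k : K, Q (k *: (1 : A))) -> (forall i j, Q (u i j)) ->
  (forall x y, Q x -> Q y -> Q (x + y)) ->
  (forall x y, Q x -> Q y -> Q (x * y)) -> forall a, Q a.
Proof.
move=> Qk Qu QD QM; have ph := quot_proj_hom (@SLq_rel K p).
have ch := @falg_cst_hom K (base_alg K) ('I_2 * 'I_2).
elim/quot_projW; elim/quotW; elim=> [k|[i j]|s IHs r IHr|s IHs r IHr].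
- suff -> : quot_proj (@SLq_rel K p) (falg_cst _ k) = (k : K) *: (1 : A) by exact: Qk.
  rewrite -[in LHS](mulr1 k) -[k * 1]/(k *: (1 : base_alg K)).
  by rewrite (alg_homZ ch) (alg_hom1 ch) (alg_homZ ph) (alg_hom1 ph).
- exact: Qu.
- by rewrite -fq_pi_add [quot_proj _ _](alg_homD ph); exact: QD.
- by rewrite -fq_pi_mul [quot_proj _ _](alg_homM ph); exact: QM.
Qed.

Lemma Cl_ind (Q : Cl -> Prop) :
  (forall a, Q (inCl a)) -> (forall i j, Q (t i j)) ->
  (forall x y, Q x -> Q y -> Q (x + y)) ->
  (forall x y, Q x -> Q y -> Q (x * y)) -> forall x, Q x.
Proof.
move=> Qa Qt QD QM.
have ph := alg_hom_comp (quot_proj_hom (@TGamma_rel K p nu0))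
  (quot_proj_hom (@Cl_rel K p nu0 c1)).
elim/quot_projW; elim/quot_projW; elim/quotW.
elim=> [a|[i j]|s IHs r IHr|s IHs r IHr].
- exact: Qa.
- exact: Qt.
- by rewrite -fq_pi_add [quot_proj _ _](alg_homD ph); exact: QD.
- by rewrite -fq_pi_mul [quot_proj _ _](alg_homM ph); exact: QM.
Qed.

(** Lets a theta be moved to the right of all of A, so that it acts on the basis
    of left-invariant spinors directly. *)
Lemma theta_in_span i j a : exists b : 'I_2 -> 'I_2 -> A,
  t i j * inCl a = \sum_r \sum_s inCl (b r s) * t r s.
Proof.
have ih := Cl_in_hom p nu0 c1.
elim/SLq_ind: a i j => [k|m l|x y IHx IHy|x y IHx IHy] i j.
- exists (fun r s => ((i == r)%:R * (j == s)%:R * k) *: (1 : A)).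
  rewrite (alg_homZ ih) (alg_hom1 ih) -ascalerAr mulr1.
  rewrite -(sum2_delta i j (fun r s => k *: t r s)).
  do 2![apply: eq_bigr => ? _].
  by rewrite (alg_homZ ih) (alg_hom1 ih) -ascalerAl mul1r scalerA.
- exists (fun r s => nu0 *: \sum_a \sum_n
     (Rhat p a r i n * RhatV p n s j l) *: u m a).
  rewrite Cl_theta_comm exchange_big scaler_sumr; apply: eq_bigr => r _ /=.
  under eq_bigr do rewrite exchange_big.
  rewrite exchange_big scaler_sumr; apply: eq_bigr => s _ /=.
  rewrite (alg_homZ ih) -ascalerAl (alg_hom_sum ih) mulr_suml; congr (_ *: _).
  apply: eq_bigr => a _; rewrite (alg_hom_sum ih) mulr_suml.
  by apply: eq_bigr => n _; rewrite (alg_homZ ih) -ascalerAl.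
- have [b Hb] := IHx i j; have [b' Hb'] := IHy i j.
  exists (fun r s => b r s + b' r s).
  rewrite (alg_homD ih) mulrDr Hb Hb' -sum2D.
  by do 2![apply: eq_bigr => ? _]; rewrite (alg_homD ih) mulrDl.
- have [b Hb] := IHx i j.
  have /choice[b' Hb'] : forall rs : 'I_2 * 'I_2, exists b' : 'I_2 -> 'I_2 -> A,
      t rs.1 rs.2 * inCl y = \sum_r \sum_s inCl (b' r s) * t r s.
    by move=> rs; exact: IHy.
  exists (fun r s => \sum_m \sum_n b m n * b' (m, n) r s).
  rewrite (alg_homM ih) mulrA Hb mulr_suml.
  under eq_bigr do rewrite mulr_suml.
  under eq_bigr do under eq_bigr do rewrite -mulrA (Hb' (_, _)) mulr_sumr.
  under eq_bigr do under eq_bigr do under eq_bigr do rewrite mulr_sumr.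
  rewrite exchange2; do 2![apply: eq_bigr => ? _].
  rewrite (alg_hom_sum ih) mulr_suml; apply: eq_bigr => m _.
  rewrite (alg_hom_sum ih) mulr_suml; apply: eq_bigr => n _.
  by rewrite (alg_homM ih) mulrA.
Qed.

End Generation.

(** * The left ideal of spinors *)

Section SpinorModule.
Variables (K : fieldType) (p nu0 c1 : K).
Notation Cl := (Cl p nu0 c1).
Notation S0 := (S0 p nu0 c1).
Notation lmul := (@S0_lmul K p nu0 c1).
Notation inCl := (@Cl_in K p nu0 c1).

Lemma S0_val_linear : linear (@S0_val K p nu0 c1).
Proof. by move=> k x y; exact: (linearP (val : S0 -> Cl)). Qed.

Lemma S0_val_inj : injective (@S0_val K p nu0 c1).
Proof. exact: val_inj. Qed.
Lemma S0_val_lmul x s : S0_val (lmul x s) = x * S0_val s.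
Proof. by []. Qed.

Lemma S0_lmul_bilinear : bilinear_map lmul.
Proof.
split=> [s k x y | x k s s']; apply: S0_val_inj.
  by rewrite S0_val_linear !S0_val_lmul mulrDl -ascalerAl.
by rewrite S0_val_linear !S0_val_lmul S0_val_linear mulrDr -ascalerAr.
Qed.
Lemma S0_lmulA x y s : lmul (x * y) s = lmul x (lmul y s).
Proof. by apply: val_inj; rewrite /= mulrA. Qed.
Lemma S0_lmul1 s : lmul 1 s = s.
Proof. by apply: val_inj; rewrite /= mul1r. Qed.

Section RightMultiplication.
Variable S0_inv : S0_right_invariant p nu0 c1.
Notation rmul := (S0_rmul S0_inv).

Lemma S0_val_rmul s a : S0_val (rmul s a) = S0_val s * inCl a.
Proof. by []. Qed.

Lemma S0_rmul_bilinear : bilinear_map rmul.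
Proof.
have ih := Cl_in_hom p nu0 c1.
split=> [a k s s' | s k a b]; apply: S0_val_inj.
  by rewrite S0_val_linear !S0_val_rmul S0_val_linear mulrDl -ascalerAl.
rewrite S0_val_linear !S0_val_rmul (alg_homD ih) (alg_homZ ih).
by rewrite mulrDr -ascalerAr.
Qed.
Lemma S0_rmulA s a b : rmul (rmul s a) b = rmul s (a * b).
Proof. by apply: val_inj; rewrite /= -mulrA (alg_homM (Cl_in_hom p nu0 c1)). Qed.
Lemma S0_lrmulA x s a : rmul (lmul x s) a = lmul x (rmul s a).
Proof. by apply: val_inj; rewrite /= mulrA. Qed.

End RightMultiplication.
End SpinorModule.

(** * The coaction on spinors *)

Section SpinorCoaction.
Variables (K : fieldType) (p nu0 c1 : K).
Hypotheses (p0 : p != 0) (c10 : c1 != 0).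
Hypothesis qtwo0 : p ^+ 2 + (p ^+ 2)^-1 != 0.
Hypothesis nu_sq : nu0 ^+ 2 = 1.
Hypothesis psi_basis : S0_basis p nu0 c1.
Hypothesis S0_inv : S0_right_invariant p nu0 c1.

Notation A := (SLq p).
Notation u := (@SLq_u K p).
Notation H := (SLqt p).
Notation inH := (@SLqt_in K p).
Notation Cl := (Cl p nu0 c1).
Notation inCl := (@Cl_in K p nu0 c1).
Notation t := (theta p nu0 c1).
Notation S0 := (S0 p nu0 c1).
Notation psi := (S0_psi p nu0 c1).
Notation lmul := (@S0_lmul K p nu0 c1).
Notation rmul := (S0_rmul S0_inv).
Notation mulH := (fun h h' : H => h * h').
Notation chi := (chi p).

Let ih := Cl_in_hom p nu0 c1.
Let lmul_bil := @S0_lmul_bilinear K p nu0 c1.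
Let mulH_bil := mul_bilinear H.

Notation act := (tens_mul2 lmul mulH).

Definition Cl_coact (x : Cl) : tensAlg Cl H := tens_map id inH (Cl_Delta x).
Notation coCl := Cl_coact.
Notation q := (p ^+ 2).

Let act_bil : bilinear_map act. Proof. exact: tens_mul2_bilinear. Qed.

Lemma Cl_coact_hom : alg_hom coCl.
Proof.
have id_hom : alg_hom (id : Cl -> Cl) by [].
exact: (alg_hom_comp (Cl_Delta_hom nu0 c1 p0) (tens_map_hom id_hom (SLqt_in_hom p))).
Qed.
Let ch := Cl_coact_hom.

Let actM x y z : act (coCl (x * y)) z = act (coCl x) (act (coCl y) z).
Proof.
rewrite (alg_homM ch); apply: tens_mul2A => //; try exact: mul_bilinear.
- by move=> *; exact: S0_lmulA.
- by move=> *; rewrite mulrA.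
Qed.
Let act1 z : act (coCl 1) z = z.
Proof.
rewrite (alg_hom1 ch); elim/tens_ind: z => [s h|x y Hx Hy].
  by rewrite tens_mul2_pure // S0_lmul1 mul1r.
by rewrite tens_mul2Dr // Hx Hy.
Qed.

Definition psi_coact e i : tensor S0 H := \sum_j psi e j \ox (inH (u j i) * chi).

Definition psi_coord (s : S0) : bool * 'I_2 -> A := sval (cid (psi_basis s)).

Let coordE s : s = \sum_ei lmul (inCl (psi_coord s ei)) (psi ei.1 ei.2).
Proof. by rewrite /psi_coord; case: cid => a [ /= Ha _]. Qed.
Let coord_uniq s (a : bool * 'I_2 -> A) :
  s = \sum_ei lmul (inCl (a ei)) (psi ei.1 ei.2) -> psi_coord s =1 a.
Proof.
move=> Hs ei; rewrite /psi_coord; case: cid => b [ /= Hb uniq_b].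
rewrite (uniq_b [ffun x => a x]) ?ffunE //.
by rewrite {1}Hs; apply: eq_bigr => x _; rewrite ffunE.
Qed.

Definition S0_Delta (s : S0) : tensor S0 H :=
  \sum_ei act (coCl (inCl (psi_coord s ei))) (psi_coact ei.1 ei.2).
Notation Delta := S0_Delta.

Lemma S0_Delta_linear : linear Delta.
Proof.
move=> k s s'; rewrite /Delta scaler_sumr -big_split; apply: eq_bigr => ei _ /=.
rewrite -act_bil.1 -(alg_homZ ch) -(alg_homD ch) -(alg_homZ ih) -(alg_homD ih).
congr (act (coCl (inCl _)) _).
apply: (@coord_uniq _ (fun ei => k *: psi_coord s ei + psi_coord s' ei)).
rewrite {1}[s]coordE {1}[s']coordE scaler_sumr -big_split.
by apply: eq_bigr => x _; rewrite /= (alg_homD ih) (alg_homZ ih) lmul_bil.1.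
Qed.
Let DD := linear_add S0_Delta_linear.
Let DZ := linear_scal S0_Delta_linear.
Let Dsum := linear_big S0_Delta_linear.

Let Delta_in a s : Delta (lmul (inCl a) s) = act (coCl (inCl a)) (Delta s).
Proof.
rewrite /Delta (linear_big (act_bil.2 _)); apply: eq_bigr => ei _.
rewrite -actM -(alg_homM ih); congr (act (coCl (inCl _)) _).
apply: (@coord_uniq _ (fun ei => a * psi_coord s ei)).
rewrite {1}[s]coordE (linear_big (lmul_bil.2 _)); apply: eq_bigr => x _.
by rewrite (alg_homM ih) S0_lmulA.
Qed.

Lemma S0_Delta_psi e i : Delta (psi e i) = psi_coact e i.
Proof.
have Hc : psi_coord (psi e i) =1 (fun ei => (ei == (e, i))%:R *: (1 : A)).
  apply: coord_uniq; rewrite (bigD1 (e, i)) //= eqxx scale1r (alg_hom1 ih).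
  rewrite S0_lmul1 big1 ?addr0 // => x /negbTE ->.
  by rewrite scale0r (alg_hom0 ih) (linear_zero (lmul_bil.1 _)).
rewrite /Delta (bigD1 (e, i)) //= Hc eqxx scale1r (alg_hom1 ih) act1.
rewrite big1 ?addr0 // => x /negbTE xe; rewrite Hc xe scale0r.
by rewrite (alg_hom0 ih) (alg_hom0 ch) (linear_zero (act_bil.1 _)).
Qed.

Lemma S0_ind_basis (Q : S0 -> Prop) : Q 0 -> (forall x y, Q x -> Q y -> Q (x + y)) ->
  (forall a e i, Q (lmul (inCl a) (psi e i))) -> forall s, Q s.
Proof. by move=> Q0 QD Qa s; rewrite [s]coordE; apply: big_ind => // -[]. Qed.

Let coCl_theta i j :
  coCl (t i j) = \sum_a \sum_b t a b \ox inH (u a i * u b j).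
Proof.
have hid : alg_hom (id : Cl -> Cl) by [].
have mh := tens_map_hom hid (SLqt_in_hom p).
have hl := alg_hom_linear (SLqt_in_hom p).
rewrite /Cl_coact (Cl_Delta_theta nu0 c1 p0) (alg_hom_sum mh).
apply: eq_bigr => a _; rewrite (alg_hom_sum mh); apply: eq_bigr => b _.
exact: tens_map_pure.
Qed.

Let L e m (w : A) : tensor S0 H := psi e m \ox (inH w * chi).
Let L_lin e m : linear (L e m).
Proof.
move=> k x y; rewrite /L (alg_homD (SLqt_in_hom p)) (alg_homZ (SLqt_in_hom p)).
by rewrite mulrDl -ascalerAl pureDr pureZr.
Qed.

Let S0_theta_psi i j e k : lmul (t i j) (psi e k) =
  (gamma_outer p e * Clow p i j) *: psi (~~ e) k +
  (gamma_inner p c1 e * Clow p j k) *: psi (~~ e) i.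
Proof.
have lv := @S0_val_linear K p nu0 c1.
apply: val_inj; rewrite [RHS]S0_val_linear [S0_val (_ *: _)](linear_scal lv).
by rewrite /= theta_psi.
Qed.

(** The coefficients of theta on spinors are the invariant form C applied to two
    neighbouring indices, and C absorbs the corresponding two factors u. *)
Lemma S0_Delta_theta_psi i j e k :
  Delta (lmul (t i j) (psi e k)) = act (coCl (t i j)) (psi_coact e k).
Proof.
rewrite S0_theta_psi DD !DZ !S0_Delta_psi coCl_theta.
have -> : act (\sum_a \sum_b t a b \ox inH (u a i * u b j)) (psi_coact e k) =
    \sum_a \sum_b \sum_m ((gamma_outer p e * Clow p a b) *: L (~~ e) m (u a i * u b j * u m k)
     + (gamma_inner p c1 e * Clow p b m) *: L (~~ e) a (u a i * u b j * u m k)).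
  rewrite (linear_big (act_bil.1 _)); apply: eq_bigr => a _.
  rewrite (linear_big (act_bil.1 _)); apply: eq_bigr => b _.
  rewrite (linear_big (act_bil.2 _)); apply: eq_bigr => m _.
  rewrite tens_mul2_pure // S0_theta_psi pureDl !pureZl.
  by rewrite mulrA -(alg_homM (SLqt_in_hom p)).
under eq_bigr do under eq_bigr do rewrite big_split.
rewrite sum2D; congr (_ + _).
- under eq_bigr do rewrite exchange_big.
  rewrite exchange_big /= scaler_sumr; apply: eq_bigr => m _.
  rewrite -scalerA -[_ \ox _]/(L _ _ _) -(linear_scal (@L_lin _ _)).
  rewrite -[u m k]mul1r ascalerAl -(SLq_Clow p0) mulr_suml.
  rewrite (linear_big (@L_lin _ _)) scaler_sumr; apply: eq_bigr => a _.
  rewrite mulr_suml (linear_big (@L_lin _ _)) scaler_sumr; apply: eq_bigr => b _.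
  by rewrite -ascalerAl (linear_scal (@L_lin _ _)) scalerA mul1r.
- rewrite scaler_sumr; apply: eq_bigr => a _.
  rewrite -scalerA -[_ \ox _]/(L _ _ _) -(linear_scal (@L_lin _ _)).
  rewrite -[u a i]mulr1 ascalerAr -(SLq_Clow p0) mulr_sumr.
  rewrite (linear_big (@L_lin _ _)) scaler_sumr; apply: eq_bigr => b _.
  rewrite mulr_sumr (linear_big (@L_lin _ _)) scaler_sumr; apply: eq_bigr => m _.
  by rewrite -ascalerAr (linear_scal (@L_lin _ _)) scalerA mulr1 mulrA.
Qed.

Lemma S0_Delta_lmul x s : Delta (lmul x s) = act (coCl x) (Delta s).
Proof.
elim/Cl_ind: x s => [a|i j|x y IHx IHy|x y IHx IHy] s.
- exact: Delta_in.
- elim/S0_ind_basis: s => [|s s' IH IH'|a e k].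
  + by rewrite (linear_zero (lmul_bil.2 _)) (linear_zero S0_Delta_linear)
      (linear_zero (act_bil.2 _)).
  + by rewrite (linear_add (lmul_bil.2 _)) !DD (linear_add (act_bil.2 _)) IH IH'.
  + rewrite Delta_in -actM -S0_lmulA S0_Delta_psi.
    have [b ->] := theta_in_span nu0 c1 i j a.
    rewrite (linear_big (lmul_bil.1 _)) Dsum (alg_hom_sum ch).
    rewrite (linear_big (act_bil.1 _)); apply: eq_bigr => r _.
    rewrite (linear_big (lmul_bil.1 _)) Dsum (alg_hom_sum ch).
    rewrite (linear_big (act_bil.1 _)); apply: eq_bigr => s _.
    by rewrite S0_lmulA Delta_in actM S0_Delta_theta_psi.
- by rewrite (linear_add (lmul_bil.1 _)) DD (alg_homD ch) (linear_add (act_bil.1 _))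
    IHx IHy.
- by rewrite S0_lmulA IHx IHy actM.
Qed.

Let inH_lin : linear inH := alg_hom_linear (SLqt_in_hom p).

Let HD_hom := SLqt_Delta_hom p0.
Let He_hom := SLqt_eps_hom p0.

Lemma SLqt_Delta_uchi i j :
  @SLqt_Delta K p (inH (u i j) * chi) =
  \sum_k apure (inH (u i k) * chi) (inH (u k j) * chi).
Proof.
rewrite (alg_homM HD_hom) (SLqt_Delta_in p0) (SLqt_Delta_chi p0) (SLq_Delta_u p0).
rewrite (alg_hom_sum (tens_map_hom (SLqt_in_hom p) (SLqt_in_hom p))).
rewrite mulr_suml; apply: eq_bigr => k _.
by rewrite tens_map_pure // -[_ \ox _]/(apure _ _) apureM.
Qed.

Let coCl_in_u i j : coCl (inCl (u i j)) = \sum_k inCl (u i k) \ox inH (u k j).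
Proof.
have hid : alg_hom (id : Cl -> Cl) by [].
have hidA : alg_hom (id : A -> A) by [].
have mh := tens_map_hom hid (SLqt_in_hom p).
have mh' := tens_map_hom ih hidA.
have hl := alg_hom_linear ih.
rewrite /Cl_coact (Cl_Delta_in nu0 c1 p0) (SLq_Delta_u p0) (alg_hom_sum mh').
rewrite (alg_hom_sum mh); apply: eq_bigr => k _.
by rewrite !tens_map_pure.
Qed.

Let tens_assoc_hom (B C D : algebra K) :
  alg_hom (@tens_assoc K B C D : tensAlg (tensAlg B C) D -> tensAlg B (tensAlg C D)).
Proof.
have mb := @mul_bilinear K.
split=> [||x y]; first exact: tens_assoc_linear.
- exact: tens_assoc_pure.
- exact: (tens_assoc_mul2 (mb B) (mb C) (mb D)).
Qed.

Lemma Cl_coact_in_coassoc a :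
  tens_assoc (tens_map coCl id (coCl (inCl a))) =
  tens_map id (@SLqt_Delta K p) (coCl (inCl a)).
Proof.
have hid : alg_hom (id : Cl -> Cl) by [].
have hidH : alg_hom (id : H -> H) by [].
have h1 := tens_map_hom ch hidH; have h2 := tens_map_hom hid HD_hom.
have hco := alg_hom_comp ih ch.
move: a; apply: (@SLq_hom_eq K p (tensAlg Cl (tensAlg H H))
  (fun a => tens_assoc (tens_map coCl id (coCl (inCl a))))
  (fun a => tens_map id (@SLqt_Delta K p) (coCl (inCl a)))).
- exact: (alg_hom_comp hco (alg_hom_comp h1 (tens_assoc_hom Cl H H))).
- exact: (alg_hom_comp hco h2).
- move=> i j; rewrite coCl_in_u (alg_hom_sum h1) (alg_hom_sum h2).
  rewrite (alg_hom_sum (tens_assoc_hom Cl H H)).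
  have lin := alg_hom_linear ch; have lin2 := alg_hom_linear HD_hom.
  transitivity (\sum_k \sum_l inCl (u i k) \ox (inH (u k l) \ox inH (u l j))).
    rewrite exchange_big; apply: eq_bigr => l _ /=.
    rewrite tens_map_pure // coCl_in_u pure_suml.
    rewrite (linear_big (@tens_assoc_linear K Cl H H)).
    by apply: eq_bigr => k _; rewrite tens_assoc_pure.
  apply: eq_bigr => k _; rewrite tens_map_pure // (SLqt_Delta_in p0).
  rewrite (SLq_Delta_u p0) (alg_hom_sum (tens_map_hom (SLqt_in_hom p) (SLqt_in_hom p))).
  rewrite pure_sumr; apply: eq_bigr => l _; by rewrite tens_map_pure.
Qed.

Let H3_bil : bilinear_map (tens_mul2 mulH mulH).
Proof. exact: tens_mul2_bilinear. Qed.

(** Both sides of coassociativity carry the action of A to the action of its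
    iterated coproduct, so it need only be checked on the psi, where it is
    the coproduct of the u^j_i chi. *)
Lemma S0_Delta_coassoc s :
  tens_assoc (tens_map Delta id (Delta s)) = tens_map id (@SLqt_Delta K p) (Delta s).
Proof.
have ca := @tens_assoc_linear K S0 H H; have lD := S0_Delta_linear.
have lDi := tens_map_linear S0_Delta_linear (@id_linear K H).
have lH := alg_hom_linear HD_hom; have lc := alg_hom_linear ch.
have liD := tens_map_linear (@id_linear K S0) lH.
elim/S0_ind_basis: s => [|s s' IH IH'|a e i].
- by rewrite (linear_zero S0_Delta_linear) (linear_zero lDi) (linear_zero ca)
    (linear_zero liD).
- by rewrite DD (linear_add lDi) (linear_add ca) (linear_add liD) IH IH'.
rewrite Delta_in.
rewrite (@tens_map_mul2 _ _ _ _ _ _ _ _ _ _ _ _ _ lmul act mulH mulH coCl Delta Delta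
  id id id) //; last exact: S0_Delta_lmul.
rewrite tens_assoc_mul2 // Cl_coact_in_coassoc.
rewrite (@tens_map_mul2 _ _ _ _ _ _ _ _ _ _ _ _ _ lmul lmul mulH (tens_mul2 mulH mulH)
  id id id (@SLqt_Delta K p) (@SLqt_Delta K p) (@SLqt_Delta K p)) //; last first.
  exact: (alg_homM HD_hom).
congr (tens_mul2 _ _ _ _).
rewrite S0_Delta_psi /psi_coact (linear_big lDi) (linear_big ca) (linear_big liD).
transitivity (\sum_k \sum_j psi e k \ox
    ((inH (u k j) * chi) \ox (inH (u j i) * chi) : tensor H H)).
  rewrite exchange_big; apply: eq_bigr => j _ /=.
  rewrite (tens_map_pure S0_Delta_linear (@id_linear K H)) S0_Delta_psi pure_suml.
  by rewrite (linear_big ca); apply: eq_bigr => k _; rewrite tens_assoc_pure.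
apply: eq_bigr => k _; rewrite tens_map_pure // SLqt_Delta_uchi.
by rewrite pure_sumr.
Qed.

Let counit_V (V : lmodType K) : tensor V H -> V :=
  tens_lift (fun (v : V) (h : H) => (@SLqt_eps K p h : K) *: v).
Let eps_bil V := @counit_bilinear K H (@SLqt_eps K p) V (alg_hom_linear He_hom).

Lemma Cl_coact_in_counit a : counit_V (coCl (inCl a)) = inCl a.
Proof.
have lin : linear (@counit_V Cl) := tens_lift_linear (eps_bil Cl).
have hom : alg_hom (@counit_V Cl : tensAlg Cl H -> Cl).
  split=> // [|x y].
    rewrite [LHS](tens_lift_pure (eps_bil Cl)).
    by rewrite (alg_hom1 He_hom) scale1r.
  exact: (tens_counit_mul2 He_hom (mul_bilinear Cl)).
move: a; apply: (@SLq_hom_eq K p Cl (fun a => counit_V (coCl (inCl a))) inCl) => //.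
  exact: (alg_hom_comp (alg_hom_comp ih ch) hom).
move=> i j; rewrite coCl_in_u (linear_big lin) -[RHS](sum1_delta j (fun k => inCl (u i k))).
apply: eq_bigr => k _; rewrite [LHS](tens_lift_pure (eps_bil Cl)).
by rewrite (SLqt_eps_in p0) (SLq_eps_u p0) eq_sym.
Qed.

Lemma S0_Delta_counit s :
  tens_lift (fun (w : S0) (h : H) => (@SLqt_eps K p h : K) *: w) (Delta s) = s.
Proof.
have lin : linear (@counit_V S0) := tens_lift_linear (eps_bil S0).
rewrite -[LHS]/(counit_V _); elim/S0_ind_basis: s => [|s s' IH IH'|a e i].
- by rewrite (linear_zero S0_Delta_linear) (linear_zero lin).
- by rewrite DD (linear_add lin) IH IH'.
rewrite Delta_in [LHS](tens_counit_mul2 He_hom lmul_bil).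
rewrite -/(counit_V _) -/(counit_V _) Cl_coact_in_counit; congr (lmul _ _).
rewrite S0_Delta_psi /psi_coact (linear_big lin).
rewrite -[RHS](sum1_delta i (fun k => psi e k)).
apply: eq_bigr => k _; rewrite [LHS](tens_lift_pure (eps_bil S0)).
rewrite (alg_homM He_hom) (SLqt_eps_chi p0) mulr1.
by rewrite (SLqt_eps_in p0) (SLq_eps_u p0) eq_sym.
Qed.

Notation ract := (tens_mul2 rmul mulH).
Let rmul_bil := @S0_rmul_bilinear K p nu0 c1 S0_inv.
Let coA (a : A) : tensAlg A H := tens_map id inH (SLq_Delta a).
Let ract_bil : bilinear_map ract. Proof. exact: tens_mul2_bilinear. Qed.

Let coA_hom : alg_hom coA.
Proof.
have hid : alg_hom (id : A -> A) by [].
exact: (alg_hom_comp (SLq_Delta_hom p0) (tens_map_hom hid (SLqt_in_hom p))).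
Qed.
Let coA_u i j : coA (u i j) = \sum_k u i k \ox inH (u k j).
Proof.
have hid : alg_hom (id : A -> A) by [].
rewrite /coA (SLq_Delta_u p0) (alg_hom_sum (tens_map_hom hid (SLqt_in_hom p))).
by apply: eq_bigr => k _; rewrite tens_map_pure.
Qed.

Let ractM z x y : ract (ract z x) y = ract z ((x : tensAlg A H) * y).
Proof.
apply: tens_mul2A => //; try exact: mul_bilinear.
- by move=> *; exact: S0_rmulA.
- by move=> *; rewrite mulrA.
Qed.
Let actract x z y : ract (act x z) y = act x (ract z y).
Proof.
apply: tens_mul2A => // *; first exact: S0_lrmulA.
by rewrite mulrA.
Qed.

Lemma psi_even_rmul j k m : rmul (psi true j) (u k m) =
  \sum_a \sum_b (p^-1 * (p ^+ 2) ^+ m * Rhat p a b j m) *: lmul (inCl (u k a)) (psi true b).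
Proof.
have lv := @S0_val_linear K p nu0 c1.
apply: S0_val_inj; rewrite S0_val_rmul (linear_big lv) /=.
rewrite (psi_even_u p0 c10 qtwo0 nu_sq) /=.
apply: eq_bigr => a _; rewrite (linear_big lv); apply: eq_bigr => b _.
by rewrite (linear_scal lv).
Qed.

Lemma chi_u i j : chi * inH (u i j) = (qpar p ^ (j%:Z - i%:Z)) *: (inH (u i j) * chi).
Proof.
transitivity (inH (SLq_chi (u i j)) * chi); first exact: crossed_chiC.
by rewrite (SLq_chi_u p0) (alg_homZ (SLqt_in_hom p)) -ascalerAl.
Qed.

(** This is where chi enters: moving it past u^f_m produces q^(m-f), which
    turns the factor q^f of the commutation rule of psi_e with u^k_f into q^m.
    As q^m does not depend on the summation indices, the relations
    R u u = u u R apply. *)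
Lemma S0_Delta_psi_even_rmul j k m :
  Delta (rmul (psi true j) (u k m)) = ract (Delta (psi true j)) (coA (u k m)).
Proof.
pose M c d (w : A) : tensor S0 H :=
  lmul (inCl (u k c)) (psi true d) \ox (inH w * chi).
have M_lin c d : linear (M c d).
  move=> x w w'; rewrite /M (linear_add inH_lin) (linear_scal inH_lin) mulrDl.
  by rewrite -ascalerAl pureDr pureZr.
have actE a b : act (coCl (inCl (u k a))) (psi_coact true b) =
    \sum_c \sum_d M c d (u c a * u d b).
  rewrite coCl_in_u (linear_big (act_bil.1 _)); apply: eq_bigr => c _.
  rewrite (linear_big (act_bil.2 _)); apply: eq_bigr => d _.
  by rewrite tens_mul2_pure // mulrA -(alg_homM (SLqt_in_hom p)).
transitivity (\sum_c \sum_d M c d ((p^-1 * q ^+ m) *: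
    \sum_a \sum_b Rhat p a b j m *: (u c a * u d b))).
  rewrite psi_even_rmul Dsum; under eq_bigr do rewrite Dsum.
  under eq_bigr do under eq_bigr do rewrite DZ Delta_in S0_Delta_psi actE -sum2Z.
  rewrite exchange2; do 2![apply: eq_bigr => ? _].
  rewrite (linear_scal (@M_lin _ _)) (linear_big (@M_lin _ _)) scaler_sumr.
  apply: eq_bigr => ? _; rewrite (linear_big (@M_lin _ _)) scaler_sumr.
  by apply: eq_bigr => ? _; rewrite (linear_scal (@M_lin _ _)) scalerA.
rewrite S0_Delta_psi coA_u (linear_big (ract_bil.1 _)).
under [RHS]eq_bigr do rewrite (linear_big (ract_bil.2 _)).
transitivity (\sum_e \sum_f \sum_c \sum_d
    (p^-1 * q ^+ m * Rhat p c d e f) *: M c d (u e j * u f m)).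
  rewrite exchange2; apply: eq_bigr => c _; apply: eq_bigr => d _.
  rewrite -SLq_RTT (linear_scal (@M_lin _ _)) (linear_big (@M_lin _ _)) scaler_sumr.
  apply: eq_bigr => ? _; rewrite (linear_big (@M_lin _ _)) scaler_sumr.
  by apply: eq_bigr => ? _; rewrite (linear_scal (@M_lin _ _)) scalerA.
apply: eq_bigr => e _; apply: eq_bigr => f _.
rewrite tens_mul2_pure // psi_even_rmul -mulrA chi_u -ascalerAr pureZr.
rewrite pure_suml scaler_sumr; apply: eq_bigr => c _.
rewrite pure_suml scaler_sumr; apply: eq_bigr => d _.
rewrite pureZl scalerA mulrA -(alg_homM (SLqt_in_hom p)); congr (_ *: _).
have q0 : q != 0 by rewrite expf_neq0.
rewrite !mulrA; congr (_ * _); rewrite [RHS]mulrAC [RHS]mulrC; congr (_ * _).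
by rewrite -[q ^+ f]/(q ^ f%:Z) -expfzDr // subrK.
Qed.

(** Compatibility for one a and all spinors is multiplicative in a, which leaves
    the generators of A; left multiplication then reduces all spinors to the
    even psi, the odd ones being multiples of theta_1i psi^+_2. *)
Lemma S0_Delta_rmul s a : Delta (rmul s a) = ract (Delta s) (coA a).
Proof.
elim/SLq_ind: a s => [k|k m|x y IHx IHy|x y IHx IHy] s.
- rewrite (alg_homZ coA_hom) (linear_scal (ract_bil.2 _)) (alg_hom1 coA_hom).
  rewrite (linear_scal (rmul_bil.2 _)) DZ; congr (_ *: _).
  have -> : rmul s 1 = s by apply: S0_val_inj; rewrite S0_val_rmul (alg_hom1 ih) mulr1.
  elim/tens_ind: (Delta s) => [w h|x y Hx Hy].
    rewrite tens_mul2_pure // mulr1; congr (_ \ox _).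
    by apply: S0_val_inj; rewrite S0_val_rmul (alg_hom1 ih) mulr1.
  by rewrite tens_mul2Dl // -Hx -Hy.
- pose good s := Delta (rmul s (u k m)) = ract (Delta s) (coA (u k m)).
  have good_lmul x w : good w -> good (lmul x w).
    by rewrite /good S0_lrmulA !S0_Delta_lmul actract => ->.
  have good_psi e i : good (psi e i).
    have g1 : good (psi true 1) by exact: S0_Delta_psi_even_rmul.
    case: e; first exact: S0_Delta_psi_even_rmul.
    elim/I2_cases: i.
      suff -> : psi false 0 = lmul (t 0 0) (psi true 1) by exact: good_lmul.
      by apply: S0_val_inj; exact: psi_odd0.
    suff -> : psi false 1 = lmul ((p ^+ 2) *: t 0 1) (psi true 1) by exact: good_lmul.
    by apply: S0_val_inj; rewrite S0_val_lmul -ascalerAl; exact: psi_odd1.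
  rewrite -/(good s); elim/S0_ind_basis: s => [|s s' IH IH'|a e i].
  + by rewrite /good (linear_zero (rmul_bil.1 _)) (linear_zero S0_Delta_linear)
      (linear_zero (ract_bil.1 _)).
  + by rewrite /good (linear_add (rmul_bil.1 _)) !DD (linear_add (ract_bil.1 _)) IH IH'.
  + exact: good_lmul.
- by rewrite (linear_add (rmul_bil.2 _)) DD (alg_homD coA_hom) (linear_add (ract_bil.2 _))
    IHx IHy.
- by rewrite -S0_rmulA // IHy IHx ractM (alg_homM coA_hom).
Qed.

End SpinorCoaction.

Theorem theorem6p4 (R : realType) (q p nu0 : R[i]) (c1 : R)
    (q_neq0 : q != 0)
    (q_not_root_of_unity : forall n : nat, (0 < n)%N -> q ^+ n != 1)
    (q_real_or_unit : q \is Num.real \/ `|q| = 1)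
    (p_sqrt_q : p ^+ 2 = q)
    (nu0_sign : nu0 = 1 \/ nu0 = -1)
    (c1_neq0 : c1 != 0)
    (psi_basis : S0_basis p nu0 c1%:C)
    (S0_inv : S0_right_invariant p nu0 c1%:C) :
  exists Delta_R : S0 p nu0 c1%:C -> tensor (S0 p nu0 c1%:C) (SLqt p),
    (* (i) *)
    [/\ right_coaction (@SLqt_Delta _ p) (@SLqt_eps _ p) Delta_R,
        forall (e : bool) (i : 'I_2),
          Delta_R (S0_psi p nu0 c1%:C e i) =
          \sum_(j < 2) S0_psi p nu0 c1%:C e j \ox (SLqt_in (SLq_u p j i) * chi p)
      & forall (s : S0 p nu0 c1%:C) (a : SLq p),
          Delta_R (S0_rmul S0_inv s a) =
          tens_mul2 (S0_rmul S0_inv) (fun h h' : SLqt p => h * h')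
            (Delta_R s) (tens_map id (@SLqt_in _ p) (SLq_Delta a))] /\
    (* (ii) *)
    forall (x : Cl p nu0 c1%:C) (s : S0 p nu0 c1%:C),
      Delta_R (S0_lmul x s) =
      tens_mul2 (@S0_lmul _ p nu0 c1%:C) (fun h h' : SLqt p => h * h')
        (tens_map id (@SLqt_in _ p) (Cl_Delta x)) (Delta_R s).
Proof.
have p0 : p != 0.
  by apply: contraNneq q_neq0 => p_eq0; rewrite -p_sqrt_q p_eq0 expr0n.
have c10 : c1%:C != 0 by rewrite fmorph_eq0.
have nu_sq : nu0 ^+ 2 = 1 by case: nu0_sign => ->; rewrite ?sqrrN expr1n.
(* q + q^-1 = 0 would make q a fourth root of unity. *)
have qtwo0 : p ^+ 2 + (p ^+ 2)^-1 != 0.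
  apply/eqP; rewrite p_sqrt_q => /(congr1 (fun x => q * x)).
  rewrite mulr0 mulrDr mulfV // -expr2 => /eqP; rewrite addr_eq0 => /eqP q2.
  by have := q_not_root_of_unity 4%N isT; rewrite (exprM q 2 2) q2 sqrrN expr1n eqxx.
exists (S0_Delta psi_basis); split; last exact: S0_Delta_lmul.
split; last exact: S0_Delta_rmul.
- split; [exact: S0_Delta_linear | exact: S0_Delta_coassoc | exact: S0_Delta_counit].
- by move=> e i; exact: S0_Delta_psi.
Qed.
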